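(* Let $\mathbb D=\{z\in\mathbb C : |z|<1\}$, let $R\in(0,1)$, and let $S$ be a set with $S\subset\overline S\subset R\mathbb D=\{z\in\mathbb C:|z|<R\}$, with $s_0:=\sup\{|s| : s\in S\}<R<1$. Let $u$ be a subharmonic function on $\overline{\mathbb D}$ with $u(0)=0$, and let $0<r\le 2R$. Then for any function $h\colon[0,r]\to\mathbb R^+$ such that $h(0)=0$ and $$N_0^h(r):=\int_0^r\frac{h(s)}{s}\,ds<+\infty$$ there is a set $E\subset S$ such that $$\inf_{z\in S\setminus E}u(z)\ \ge\ -\left(\frac{2s_0}{R-s_0}+\frac{\ln(2R/r)}{-\ln R}\Bigl(\frac{1+R}{1-R}\Bigr)^2+N_0^h(r)\right)\sup_{\partial\mathbb D}u$$ and $$\mathfrak m_h^{r}(E)\ \le\ \frac{5^2}{-\ln R}\Bigl(\frac{1+R}{1-R}\Bigr)^2\ \le\ \frac{100}{(1-R)^2\ln\frac1R}.$$ In particular, for $p\in(0,2]$ and a real number $B>0$, in the case of the function $h=B\,h_p$, i.e. $h(t)=B\,c_p\,t^p$ with $c_p=\dfrac{\pi^{p/2}}{\Gamma(p/2+1)}$, the quantity $N_0^h(r)$ in the lower bound for $u$ equals $$N_0^h(r)=B\,\frac{c_p}{p}\,r^p,$$ and the $p$-dimensional content of radius $r$ of the exceptional set $E$ satisfies $$p\text{-}\mathfrak m^{r}(E)\ \le\ \frac1B\cdot\frac{5^2}{-\ln R}\Bigl(\frac{1+R}{1-R}\Bigr)^2\ \le\ \frac{100}{B(1-R)^2\ln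\frac1R}.$$
   Context: $\mathbb R^+:=\{x\in\mathbb R: x\ge 0\}$. $\overline S$ denotes the closure of $S$ and $\partial$ the boundary. A function is called subharmonic on a set $K\subset\mathbb C$ (here $K=\overline{\mathbb D}$) if it is the restriction to $K$ of a function subharmonic on some open neighborhood of $K$; subharmonic functions may take the value $-\infty$. The infimum over the empty set is $+\infty$. Hausdorff $h$-content of radius $r$: for $r>0$, a function $h\colon[0,r]\to\mathbb R^+$ and $S\subset\mathbb C$, $$\mathfrak m_h^{r}(S):=\inf\Bigl\{\sum_{j\in N}h(r_j)\ :\ N\subset\mathbb N,\ S\subset\bigcup_{j\in N}\overline B_{x_j}(r_j),\ x_j\in\mathbb C,\ 0\le r_j\le r \text{ for all } j\in N\Bigr\}\in[0,+\infty],$$ where $\overline B_x(t):=\{y\in\mathbb C:|y-x|\le t\}$. For $p\ge 0$ put $h_p(t):=c_pt^p$ for $t\in\mathbb R^+$, with $c_p:=\dfrac{\pi^{p/2}}{\Gamma(p/2+1)}$. The $p$-dimensional (Hausdorff) content of radius $r$ is $p\text{-}\mathfrak m^{r}:=\mathfrak m_{h_p}^{r}$. *)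

(* Defs.v *)
(* MathComp-Analysis *)
From HB Require Import structures.
From mathcomp Require Import all_boot all_order all_algebra.
From mathcomp Require Import complex.
From mathcomp Require Import all_classical all_reals all_analysis.

Set Implicit Arguments.
Unset Strict Implicit.
Unset Printing Implicit Defensive.

Import Order.TTheory GRing.Theory Num.Theory numFieldNormedType.Exports.

Local Open Scope classical_set_scope.
Local Open Scope complex_scope.
Local Open Scope ring_scope.

(* The bare type K[i] carries no topology; viewing it as a numClosedFieldType
   makes MathComp-Analysis equip it with the topology of its norm. *)
Definition Cplx (K : realType) : numClosedFieldType := K[i].

(* MathComp's `|z| lives in K[i], with zero imaginary part. *)
Definition modulus (K : realType) (z : Cplx K) : K := complex.Re `|z|.

Definition disc (K : realType) (t : K) : set (Cplx K) :=
  [set z | modulus z < t].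

Definition closed_disc (K : realType) (x : Cplx K) (t : K) : set (Cplx K) :=
  [set y | modulus (y - x) <= t].

Definition boundary (T : topologicalType) (A : set T) : set T :=
  closure A `\` interior A.

(* z + rho e^(i t) *)
Definition circle_point (K : realType) (z : Cplx K) (rho t : K) : Cplx K :=
  z + ((rho * cos t) +i* (rho * sin t)).

Definition circle_mean (K : realType) (v : Cplx K -> \bar K) (z : Cplx K)
    (rho : K) : \bar K :=
  (((2 * pi)^-1)%:E *
   \int[lebesgue_measure]_(t in `[0%R, (2 * pi)%R]) v (circle_point z rho t))%E.

(* The constant -oo is allowed.  By upper semicontinuity v is bounded above on
   each circle in U, so its mean is well defined in [-oo, +oo[. *)
Definition subharmonic_open (K : realType) (U : set (Cplx K))
    (v : Cplx K -> \bar K) : Prop :=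
  [/\ forall z, U z -> (v z < +oo)%E,
      forall z (a : K), U z -> (v z < a%:E)%E ->
        \forall w \near z, (v w < a%:E)%E
    & forall z (rho : K), 0 < rho -> closed_disc z rho `<=` U ->
        (v z <= circle_mean v z rho)%E].

Definition subharmonic_on (K : realType) (A : set (Cplx K))
    (u : Cplx K -> \bar K) : Prop :=
  exists (U : set (Cplx K)) (v : Cplx K -> \bar K),
    [/\ open U, A `<=` U, subharmonic_open U v & {in A, u =1 v}].

(* Only the values of h on [0, r] matter. *)
Definition hausdorff_content (K : realType) (h : K -> K) (r : K)
    (S : set (Cplx K)) : \bar K :=
  ereal_inf [set y | exists (N : set nat) (x : nat -> Cplx K) (rad : nat -> K),
    [/\ forall j, N j -> 0 <= rad j <= r,
        S `<=` \bigcup_(j in N) closed_disc (x j) (rad j)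
      & y = (\esum_(j in N) (h (rad j))%:E)%E]].

Definition Gamma (K : realType) (x : K) : K :=
  \int[lebesgue_measure]_(t in `]0, +oo[) (t `^ (x - 1) * expR (- t)).

Definition c_ (K : realType) (p : K) : K := pi `^ (p / 2) / Gamma (p / 2 + 1).

Definition h_ (K : realType) (p t : K) : K := c_ p * t `^ p.

Definition dim_content (K : realType) (p r : K) (S : set (Cplx K)) : \bar K :=
  hausdorff_content (h_ p) r S.

(* For a non-measurable h >= 0 the library integral is the lower integral. *)
Definition N0 (K : realType) (h : K -> K) (r : K) : \bar K :=
  (\int[lebesgue_measure]_(s in `]0%R, r]) (h s / s)%:E)%E.

(* The library's sup of the empty set is 0. *)
Definition sup_modulus (K : realType) (S : set (Cplx K)) : K :=
  sup [set modulus s | s in S].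

(* Main.v *)
Require Import Defs.
From HB Require Import structures.
From mathcomp Require Import all_boot all_order all_algebra.
From mathcomp Require Import complex.
From mathcomp Require Import all_classical all_reals all_analysis.
From mathcomp Require Import measurable_realfun.
From mathcomp Require Import ring lra.

(** Why the theorem holds.  Let [M] be the supremum of [u] over the unit circle.
    By the maximum principle [V := M - u] is a nonnegative superharmonic function
    on the unit disc with [V 0 = M], and the claim becomes an upper bound for [V]
    off a set of small content ([subharmonic_flip]).

    For a point [z] of the disc of radius [R] consider the means of [V] over the
    images [mob R z tau] of the circles about [0] under the automorphism of that
    disc carrying [0] to [z].  Written on the scale [t = 2 R tau] this is
    [profile z t]; its lower limit as [t] tends to [0] is at least [V z]
    ([center_le]), and at [t = 2 R] it is a Poisson integral, at most
    [(R + |z|) / (R - |z|) M] by Harnack's inequality ([harnack]).  So everything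
    depends on how fast the profile grows as [t] decreases.

    In terms of the Riesz measure of [V], an increment of the profile between two
    scales is the integral of a difference of two logarithmic potentials, which
    is nonnegative, at most [ln (t2 / t1)], and vanishes outside the Euclidean
    disc of radius [t2] about [z].  The Riesz measure itself is never
    constructed: [mean_compare] compares superpositions of means of [V] as soon
    as the difference of the corresponding potentials is nonnegative with compact
    support.  It is proved by moving a circle average from the difference of
    potentials to [V] and letting the radius tend to [0].  As the potentials are
    explicit ([mean_pot], which rests on Jensen's formula [mean_logp]), it yields
    [family_bound]: normalized increments over discs of overlap at most [m] add
    up to at most [m M / ln (T / R)] for [R < T < 1].  The choice [T = R ^ R]
    turns [1 / ln (T / R)] into the constant [capacity].

    The exceptional set consists of the points at which some increment between
    scales [t1 < t2 <= t] exceeds [M h(t) ln (t2 / t1)].  A greedy selection of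
    Besicovitch type ([greedy_cover]) covers it by such discs of radius [t], and
    at most nine of them contain a common point ([precedes_overlap]); hence
    [family_bound] bounds the sum of the [h(t)] by [25 capacity], which is the
    bound on the content ([exceptional_content]).

    At all other points the increments over a geometric grid of scales are at
    most [M] times the integral of [h(t) / t], in the lower sense when [h] is not
    measurable ([N0_grid]); from [r] to [2 R] the growth is at most
    [M capacity ln (2 R / r)], again by [family_bound].  Adding the Poisson bound
    and refining the grid gives the estimate of [V] ([steady_bound]).  For power
    gauges it remains to integrate [t ^ (p - 1)] and to divide by [B]. *)

Set Implicit Arguments.
Unset Strict Implicit.
Unset Printing Implicit Defensive.

Import Order.TTheory GRing.Theory Num.Theory numFieldNormedType.Exports.

Local Open Scope classical_set_scope.
Local Open Scope ring_scope.

(** * Averages over a turn *)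

Section line.
Context {K : realType}.
Local Notation mu := (@lebesgue_measure K).
Local Open Scope ereal_scope.

Lemma integral_lebesgue_affine (c b : K) (f : K -> \bar K) : (0 < c)%R ->
  measurable_fun [set: K] f -> (forall x, 0 <= f x) ->
  \int[mu]_x f x = c%:E * \int[mu]_x f (c * x + b)%R.
Proof.
move=> c0 mf f0.
have mphi : measurable_fun setT (fun x : measurableTypeR K => (c * x + b)%R : measurableTypeR K).
  by apply: measurable_funD => //; exact: measurable_funM.
pose phi_mixin := isMeasurableFun.Build _ _ _ _ _ mphi.
pose phi : {mfun _ >-> _} := HB.pack (fun x : measurableTypeR K => (c * x + b)%R : measurableTypeR K) phi_mixin.
pose k : {nonneg K} := NngNum (ltW c0).
rewrite -[X in _ * X](@ge0_integral_pushforward _ _ _ _ _ _ mphi mu setT f)//.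
rewrite -(@ge0_integral_mscale _ _ _ (pushforward mu phi) _ _ k)//.
apply: eq_measure_integral => A mA _.
apply: (@lebesgue_measure_unique K (mscale k (pushforward mu phi))) => //.
move=> _ [[u v] _ <-].
rewrite /= /mscale/= /pushforward.
rewrite (_ : phi @^-1` `]u, v] = `]((u - b) / c)%R, ((v - b) / c)%R]%classic).
  rewrite !lebesgue_measure_itv/= !lte_fin.
  rewrite ltr_pM2r ?invr_gt0// ltrD2r; case: ifPn => // uv; last by rewrite mule0.
  rewrite -!EFinD -EFinM; congr (_%:E); field; exact: lt0r_neq0.
apply/seteqP; split => x /=; rewrite !in_itv/= ltr_pdivrMr// ler_pdivlMr//;
  rewrite ltrBlDr lerBrDr (mulrC x); exact.
Qed.

Lemma integral_lebesgue_shift (b : K) (f : K -> \bar K) :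
  measurable_fun [set: K] f -> (forall x, 0 <= f x) ->
  \int[mu]_x f (x + b)%R = \int[mu]_x f x.
Proof.
move=> mf f0; rewrite (@integral_lebesgue_affine 1 b f)// mul1e.
by apply: eq_integral => x _; rewrite mul1r.
Qed.

End line.

Section circle_average.
Context {K : realType}.
Local Notation mu := (@lebesgue_measure K).
Local Open Scope ereal_scope.

Lemma integral_itv_affine (c b u v : K) (f : K -> \bar K) : (0 < c)%R ->
  measurable_fun [set: K] f -> (forall x, 0 <= f x) ->
  \int[mu]_(x in `[(c * u + b)%R, (c * v + b)%R]) f x =
  c%:E * \int[mu]_(x in `[u, v]) f (c * x + b)%R.
Proof.
move=> c0 mf f0.
rewrite integral_mkcond [in RHS]integral_mkcond.
rewrite (@integral_lebesgue_affine _ c b)//; first last.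
- by move=> x; apply: erestrict_ge0 => y _; exact: f0.
- by apply/(measurable_restrictT _ _).1 => //; exact: measurable_funTS.
congr (_ * _); apply: eq_integral => x _; rewrite !patchE.
have -> // : ((c * x + b)%R \in `[(c * u + b)%R, (c * v + b)%R]%classic) =
         (x \in `[u, v]%classic).
apply/idP/idP; rewrite !inE/= !in_itv/= !lerD2r !ler_pM2l//.
Qed.

Lemma turn_gt0 : (0 < 2 * pi :> K)%R.
Proof. by rewrite mulr_gt0// pi_gt0. Qed.

Definition turn := uniform_prob turn_gt0.

HB.instance Definition _ := Probability.on turn.

Definition mean (f : K -> \bar K) : \bar K := \int[turn]_t f t.

Lemma meanE (f : K -> \bar K) :
  measurable_fun [set: K] f -> (forall x, 0 <= f x) ->
  mean f = ((2 * pi)^-1)%:E * \int[mu]_(t in `[0%R, (2 * pi)%R]) f t.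
Proof. by move=> mf f0; rewrite /mean integral_uniform// subr0. Qed.

Lemma mean_cst (c : \bar K) : mean (fun=> c) = c.
Proof. by rewrite /mean integral_cst// [X in _ * X](@probability_setT _ _ _ turn) mule1. Qed.

Lemma periodicz (f : K -> \bar K) (P : K) : (forall t, f (t + P)%R = f t) ->
  forall (n : int) t, f (t + P * n%:~R)%R = f t.
Proof.
move=> fP; have fPn (n : nat) t : f (t + P * n%:R)%R = f t.
  elim: n t => [|n IHn] t; first by rewrite mulr0 addr0.
  by rewrite -natr1 mulrDr mulr1 addrA fP IHn.
move=> [n|n] t; first exact: fPn.
by rewrite NegzE mulrNz mulrN -[in RHS](subrK (P * n.+1%:R)%R t) fPn.
Qed.

Lemma integral_period_shift (f : K -> \bar K) (P a : K) : (0 < P)%R ->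
  measurable_fun [set: K] f -> (forall x, 0 <= f x) ->
  (forall t, f (t + P)%R = f t) ->
  \int[mu]_(t in `[0%R, P]) f (t + a)%R = \int[mu]_(t in `[0%R, P]) f t.
Proof.
move=> P0 mf f0 fP.
wlog /andP[a0 aP] : a / (0 <= a < P)%R.
  move=> /(_ (a - P * (Num.floor (a / P))%:~R)%R) <-.
    apply: eq_integral => t _; rewrite -[in RHS](periodicz fP (Num.floor (a / P))).
    by rewrite addrA subrK.
  have := floor_itv (a / P); rewrite -subr_ge0 => /andP[h1 h2].
  apply/andP; split.
    by rewrite subr_ge0 mulrC -ler_pdivlMr// -subr_ge0.
  rewrite ltrBlDr -[X in (_ < X + _)%R]mulr1 -mulrDr addrC mulrC -ltr_pdivrMr//.
  by move: h2; rewrite intrD.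
have split_itv (u v w : K) : (u <= v <= w)%R ->
    \int[mu]_(t in `[u, w]) f t =
    \int[mu]_(t in `[u, v]) f t + \int[mu]_(t in `[v, w]) f t.
  move=> /andP[uv vw].
  rewrite -[X in _ + X](@integral_itv_obnd_cbnd _ _ (BRight w) f); last exact: measurable_funTS.
  rewrite -ge0_integral_setU//=.
  - by rewrite -itv_bndbnd_setU// !bnd_simp.
  - exact: measurable_funTS.
  - apply/disj_setPS => x []/=; rewrite !in_itv/= => /andP[_ xv] /andP[vx _].
    by move: vx; rewrite ltNge xv.
have shiftE (u v b : K) : \int[mu]_(x in `[(u + b)%R, (v + b)%R]) f x =
    \int[mu]_(x in `[u, v]) f (x + b)%R.
  rewrite -[u in LHS]mul1r -[v in LHS]mul1r integral_itv_affine// mul1e.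
  by under eq_integral do rewrite mul1r.
rewrite -shiftE add0r (split_itv a P (P + a)%R); last first.
  by rewrite (ltW aP) lerDl.
rewrite (split_itv 0 a P)%R; last by rewrite a0 ltW.
rewrite addeC; congr (_ + _).
rewrite -[X in `[X, _]]add0r addrC -[RHS]/(\int[mu]_(x in `[0%R, a]) f x).
rewrite [X in `[_, X]]addrC addrC shiftE.
by under eq_integral do rewrite fP.
Qed.

Lemma mean_shift (f : K -> \bar K) (a : K) :
  measurable_fun [set: K] f -> (forall x, 0 <= f x) ->
  (forall t, f (t + 2 * pi)%R = f t) ->
  mean (fun t => f (t + a)%R) = mean f.
Proof.
move=> mf f0 fP; rewrite !meanE//.
  by rewrite integral_period_shift// turn_gt0.
by apply: measurableT_comp => //; exact: measurable_funD.
Qed.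

Lemma mean_double (f : K -> \bar K) :
  measurable_fun [set: K] f -> (forall x, 0 <= f x) ->
  (forall t, f (t + 2 * pi)%R = f t) ->
  mean (fun t => f (2 * t)%R) = mean f.
Proof.
move=> mf f0 fP; rewrite !meanE//; last first.
  by apply: measurableT_comp => //; exact: measurable_funM.
congr (_ * _).
have h : \int[mu]_(t in `[0%R, (2 * pi)%R]) f (t + 2 * pi)%R = \int[mu]_(t in `[0%R, (2 * pi)%R]) f t.
  by under eq_integral do rewrite fP.
have := @integral_itv_affine 2 0 0 (2 * pi)%R f (ltr0Sn K 1) mf f0.
rewrite mulr0 !addr0 => /(congr1 (fun x => 2^-1%:E * x)).
rewrite muleA -EFinM mulVf// mul1e.
under [X in _ = X -> _]eq_integral do rewrite addr0.
move=> <-.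
rewrite -(@integral_itv_bndo_bndc _ (BLeft 0%R) (2 * (2 * pi))%R f); last exact: measurable_funTS.
have p0 := turn_gt0.
rewrite (@itv_bndbnd_setU _ _ (BLeft 0%R) (BLeft (2 * pi)%R) _); last 2 first.
- by rewrite bnd_simp ltW.
- by rewrite bnd_simp [leRHS]mulr_natl mulr2n lerDl ltW.
rewrite ge0_integral_setU//=; last 2 first.
- exact: measurable_funTS.
- apply/disj_setPS => x []/=; rewrite !in_itv/= => /andP[_ xv] /andP[vx _].
  by move: vx; rewrite leNgt xv.
rewrite !integral_itv_bndo_bndc; [|exact: measurable_funTS..].
have := @integral_itv_affine 1 (2 * pi) 0 (2 * pi)%R f (@ltr01 K) mf f0.
rewrite mulr0 add0r mul1r mul1e.
under [X in _ = X -> _]eq_integral do rewrite mul1r fP.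
have -> : (2 * pi + 2 * pi = 2 * (2 * pi) :> K)%R by ring.
move=> ->.
set I := (X in _ * (X + X)); have I0 : 0 <= I by exact: integral_ge0.
rewrite ge0_muleDr// -ge0_muleDl ?lee_fin// -EFinD.
by rewrite (_ : 2^-1 + 2^-1 = 1)%R ?mul1e//; field.
Qed.

End circle_average.

(** * Area and its invariance under rigid motions *)

Notation area K := (@lebesgue_measure K \x @lebesgue_measure K)%E.

Section area.
Context {K : realType}.
Local Notation mu := (@lebesgue_measure K).
Local Open Scope ereal_scope.


Implicit Types f : K * K -> \bar K.

Lemma integral_areaE f : measurable_fun [set: K * K] f -> (forall p, 0 <= f p) ->
  \int[area K]_p f p = \int[mu]_x \int[mu]_y f (x, y).
Proof. by move=> mf f0; exact: fubini_tonelli1. Qed.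

Lemma integral_areaE2 f : measurable_fun [set: K * K] f -> (forall p, 0 <= f p) ->
  \int[area K]_p f p = \int[mu]_y \int[mu]_x f (x, y).
Proof. by move=> mf f0; exact: fubini_tonelli2. Qed.

Lemma integral_area_shearx (a : K) f :
  measurable_fun [set: K * K] f -> (forall p, 0 <= f p) ->
  \int[area K]_p f (p.1 + a * p.2, p.2)%R = \int[area K]_p f p.
Proof.
move=> mf f0; rewrite [RHS]integral_areaE2// integral_areaE2//=; last first.
  apply: measurableT_comp => //; apply/measurable_fun_pair => //=.
  by apply: measurable_funD => //; exact: measurable_funM.
apply: eq_integral => y _.
rewrite (@integral_lebesgue_shift _ (a * y)%R (fun x => f (x, y)))//.
by apply: measurableT_comp => //; exact/measurable_fun_pair.
Qed.

Lemma integral_area_sheary (a : K) f :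
  measurable_fun [set: K * K] f -> (forall p, 0 <= f p) ->
  \int[area K]_p f (p.1, p.2 + a * p.1)%R = \int[area K]_p f p.
Proof.
move=> mf f0; rewrite [RHS]integral_areaE// integral_areaE//=; last first.
  apply: measurableT_comp => //; apply/measurable_fun_pair => //=.
  by apply: measurable_funD => //; exact: measurable_funM.
apply: eq_integral => x _.
rewrite (@integral_lebesgue_shift _ (a * x)%R (fun y => f (x, y)))//.
by apply: measurableT_comp => //; exact/measurable_fun_pair.
Qed.

Lemma integral_area_translate (a b : K) f :
  measurable_fun [set: K * K] f -> (forall p, 0 <= f p) ->
  \int[area K]_p f (p.1 + a, p.2 + b)%R = \int[area K]_p f p.
Proof.
move=> mf f0; rewrite [RHS]integral_areaE// integral_areaE//=; last first.
  apply: measurableT_comp => //.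
  by apply/measurable_fun_pair => //=; exact: measurable_funD.
rewrite -[RHS](@integral_lebesgue_shift _ a)//.
- apply: eq_integral => x _.
  rewrite (@integral_lebesgue_shift _ b (fun y => f (x + a, y)%R))//.
  by apply: measurableT_comp => //; exact/measurable_fun_pair.
- exact: (measurable_fun_fubini_tonelli_F (m2 := mu)).
- by move=> x; exact: integral_ge0.
Qed.

(** A rotation other than the half-turn is a product of three shears, and each
    shear preserves the area by Tonelli's theorem; the half-turn is the square
    of a quarter-turn. *)
Lemma integral_area_rotate (c s : K) f : (c ^+ 2 + s ^+ 2 = 1)%R ->
  measurable_fun [set: K * K] f -> (forall p, 0 <= f p) ->
  \int[area K]_p f (c * p.1 - s * p.2, s * p.1 + c * p.2)%R = \int[area K]_p f p.
Proof.
wlog cN1 : c s f / (c != -1)%R => [wl|] cs mf f0.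
  have [cE|c1] := eqVneq c (-1)%R; last exact: wl.
  have sE : s = 0%R.
    by apply/eqP; rewrite -sqrf_eq0; apply/eqP; move: cs; rewrite cE; lra.
  have N1 : (0 != -1 :> K)%R by rewrite eq_sym oppr_eq0 oner_eq0.
  have e01 : (0 ^+ 2 + 1 ^+ 2 = 1 :> K)%R by ring.
  have mrot (g : K * K -> \bar K) : measurable_fun [set: K * K] g ->
      measurable_fun [set: K * K] (fun p => g (0 * p.1 - 1 * p.2, 1 * p.1 + 0 * p.2)%R).
    move=> mg; apply: measurableT_comp => //; apply/measurable_fun_pair => /=.
      by apply: measurable_funB; exact: measurable_funM.
    by apply: measurable_funD; exact: measurable_funM.
  rewrite -[RHS](wl 0%R 1%R f)// -[RHS](wl 0%R 1%R)//; last exact: mrot.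
  by apply: eq_integral => p _ /=; rewrite cE sE; congr (f (_, _)); ring.
have c1 : (1 + c != 0)%R by rewrite addrC addr_eq0.
pose T := (s / (1 + c))%R.
have sT : (s * T = 1 - c)%R.
  rewrite /T mulrA -expr2; have -> : (s ^+ 2 = (1 - c) * (1 + c))%R by apply: (@addrI _ (c ^+ 2)%R); rewrite cs; ring.
  by rewrite mulfK.
have Tc : (T * (1 + c) = s)%R by rewrite /T divfK.
have mshx a (g : K * K -> \bar K) : measurable_fun [set: K * K] g ->
    measurable_fun [set: K * K] (fun p => g (p.1 + a * p.2, p.2)%R).
  move=> mg; apply: measurableT_comp => //; apply/measurable_fun_pair => //=.
  by apply: measurable_funD => //; exact: measurable_funM.
have mshy a (g : K * K -> \bar K) : measurable_fun [set: K * K] g ->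
    measurable_fun [set: K * K] (fun p => g (p.1, p.2 + a * p.1)%R).
  move=> mg; apply: measurableT_comp => //; apply/measurable_fun_pair => //=.
  by apply: measurable_funD => //; exact: measurable_funM.
rewrite -[RHS](@integral_area_shearx (- T))//.
rewrite -[RHS](@integral_area_sheary s)//; last exact: mshx.
rewrite -[RHS](@integral_area_shearx (- T))//=; last exact: (mshy s _ (mshx (- T)%R f mf)).
apply: eq_integral => -[x y] _ /=; congr (f (_, _)).
  have -> : (x + - T * y + - T * (y + s * (x + - T * y)) =
    x - s * T * x - (2 * T - s * T * T) * y)%R by ring.
  rewrite sT; have -> : (2 * T - (1 - c) * T = T * (1 + c))%R by ring.
  by rewrite Tc; ring.
have -> : (y + s * (x + - T * y) = s * x + y - s * T * y)%R by ring.
by rewrite sT; ring.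
Qed.

End area.

(** * The modulus and the unit circle *)

Section modulus.
Context {K : realType}.
Implicit Types (z w : Cplx K) (t : K).
Local Open Scope complex_scope.

Lemma normE z : `|z| = (modulus z)%:C.
Proof. by rewrite /modulus normc_def. Qed.

Lemma modulusE z :
  modulus z = Num.sqrt (complex.Re z ^+ 2 + complex.Im z ^+ 2).
Proof. by rewrite /modulus normc_def. Qed.

Lemma sqr_modulus z : modulus z ^+ 2 = complex.Re z ^+ 2 + complex.Im z ^+ 2.
Proof. by rewrite modulusE sqr_sqrtr// addr_ge0// sqr_ge0. Qed.

Lemma modulus_ge0 z : 0 <= modulus z.
Proof. by rewrite modulusE sqrtr_ge0. Qed.

Lemma modulusM z w : modulus (z * w) = modulus z * modulus w.
Proof. by apply: (@complexI K); rewrite rmorphM/= -!normE normrM. Qed.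

Lemma modulusV z : modulus z^-1 = (modulus z)^-1.
Proof. by apply: (@complexI K); rewrite fmorphV/= -!normE normfV. Qed.

Lemma modulusN z : modulus (- z) = modulus z.
Proof. by apply: (@complexI K); rewrite -!normE normrN. Qed.

Lemma modulusB z w : modulus (z - w) = modulus (w - z).
Proof. by rewrite -modulusN opprB. Qed.

Lemma modulus0 : modulus (0 : Cplx K) = 0.
Proof. by apply: (@complexI K); rewrite -normE normr0. Qed.

Lemma modulus1 : modulus (1 : Cplx K) = 1.
Proof. by apply: (@complexI K); rewrite -normE normr1. Qed.

Lemma modulus_eq0 z : (modulus z == 0) = (z == 0).
Proof.
by rewrite -(inj_eq (@complexI K)) -normE normr_eq0.
Qed.

Lemma modulus_gt0 z : (0 < modulus z) = (z != 0).
Proof. by rewrite lt_neqAle modulus_ge0 andbT eq_sym modulus_eq0. Qed.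

Lemma modulusD z w : modulus (z + w) <= modulus z + modulus w.
Proof. by rewrite -lecR rmorphD/= -!normE ler_normD. Qed.

Lemma modulusBl z w : modulus z - modulus w <= modulus (z - w).
Proof. by rewrite lerBlDr (le_trans _ (modulusD _ _))// subrK. Qed.

Lemma modulus_conj z : modulus z^*%C = modulus z.
Proof. by rewrite !modulusE; case: z => a b /=; rewrite sqrrN. Qed.

Lemma modulus_real t : modulus (t%:C : Cplx K) = `|t|.
Proof. by rewrite modulusE/= expr0n addr0 sqrtr_sqr. Qed.

Lemma Re_le_modulus z : `|complex.Re z| <= modulus z.
Proof.
by rewrite modulusE -sqrtr_sqr ler_sqrt ?lerDl ?sqr_ge0// addr_ge0// sqr_ge0.
Qed.

Lemma Im_le_modulus z : `|complex.Im z| <= modulus z.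
Proof.
by rewrite modulusE -sqrtr_sqr ler_sqrt ?lerDr ?sqr_ge0// addr_ge0// sqr_ge0.
Qed.

Lemma modulus_le_ReIm z : modulus z <= `|complex.Re z| + `|complex.Im z|.
Proof.
rewrite modulusE -[leRHS]ger0_norm ?addr_ge0// -[leRHS]sqrtr_sqr.
rewrite ler_sqrt ?sqr_ge0// sqrrD !real_normK ?num_real//.
by rewrite addrAC lerDl mulrn_wge0// mulr_ge0.
Qed.

Definition expi t : Cplx K := cos t +i* sin t.

Lemma Re_expi t : complex.Re (expi t) = cos t. Proof. by []. Qed.

Lemma Im_expi t : complex.Im (expi t) = sin t. Proof. by []. Qed.

Lemma expi_conj t : (expi t)^*%C = expi (- t).
Proof. by rewrite /expi cosN sinN. Qed.

Lemma modulus_expi t : modulus (expi t) = 1.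
Proof. by rewrite modulusE/= cos2Dsin2 sqrtr1. Qed.

Lemma expiD s t : expi (s + t) = expi s * expi t.
Proof. by rewrite /expi cosD sinD; simpc; congr (_ +i* _); rewrite addrC; ring. Qed.

Lemma expi0 : expi 0 = 1.
Proof. by rewrite /expi cos0 sin0. Qed.

Lemma expi_neq0 t : expi t != 0.
Proof. by rewrite -modulus_eq0 modulus_expi oner_eq0. Qed.

Lemma expiN t : expi (- t) = (expi t)^-1.
Proof.
apply: (mulfI (expi_neq0 t)); rewrite mulfV ?expi_neq0//.
by rewrite -expiD subrr expi0.
Qed.

Lemma expi_turn t : expi (t + 2 * pi) = expi t.
Proof.
have := @cosD2pi K t; have := @sinD2pi K t; rewrite -[pi *+ 2]mulr_natl.
by rewrite /expi => -> ->.
Qed.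

Lemma expi_half t : expi (t + pi) = - expi t.
Proof. by rewrite /expi cosDpi sinDpi; simpc. Qed.

(** Every nonzero complex number has a polar form, by surjectivity of
    [t |-> (cos t, sin t)] onto the unit circle. *)
Lemma polar_form z : exists t, z = (modulus z)%:C * expi t.
Proof.
have [->|z0] := eqVneq z 0; first by exists 0; rewrite modulus0 mul0r.
have m0 : 0 < modulus z by rewrite modulus_gt0.
set x := complex.Re z / modulus z.
have xsq : x ^+ 2 + (complex.Im z / modulus z) ^+ 2 = 1.
  by rewrite !expr_div_n -mulrDl -sqr_modulus divff// expf_neq0// gt_eqF.
have x1 : -1 <= x <= 1.
  rewrite -ler_norml normrM normfV (ger0_norm (modulus_ge0 z)).
  by rewrite ler_pdivrMr// mul1r Re_le_modulus.
pose t := acos x; pose e : K := if 0 <= complex.Im z then 1 else -1.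
exists (e * t).
have cosE : cos (e * t) = x.
  by rewrite /e; case: ifP => _; rewrite ?mulN1r ?mul1r ?cosN acosK.
have sinE : sin (e * t) = complex.Im z / modulus z.
  have st : sin t = `|complex.Im z / modulus z|.
    by rewrite /t sin_acos// -xsq addrAC subrr add0r sqrtr_sqr.
  move: st; rewrite normrM normfV (ger0_norm (modulus_ge0 z)) /e => st.
  case: ifPn => [i0|]; first by rewrite mul1r st ger0_norm.
  rewrite -ltNge => i0; rewrite mulN1r sinN st ltr0_norm//.
  by rewrite mulNr opprK.
rewrite /expi cosE sinE /x; simpc; rewrite !(mulrC (modulus z)) !divfK ?gt_eqF//.
by case: (z).
Qed.

Lemma circle_pointE z (rho t : K) : circle_point z rho t = z + rho%:C * expi t.
Proof. by rewrite /circle_point /expi; congr (_ + _); simpc. Qed.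

Lemma nbhs_modulusP z (P : set (Cplx K)) :
  (\forall w \near z, P w) <->
  exists2 e : K, 0 < e & forall w, modulus (w - z) < e -> P w.
Proof.
split.
  move=> /nbhs_ballP[e /= e0 eP].
  exists (complex.Re e); first by move: e0; rewrite ltcE => /andP[].
  move=> w wz; apply: eP; rewrite -ball_normE/= -normrN opprB normE.
  have -> : e = (complex.Re e)%:C.
    by case: e e0 {wz} => a b; rewrite ltcE/= => /andP[/eqP ->].
  by rewrite ltcR.
move=> [e e0 eP]; apply/nbhs_ballP; exists e%:C; first by rewrite /= ltcR.
move=> w; rewrite -ball_normE/= -normrN opprB normE ltcR; exact: eP.
Qed.

End modulus.

#[global] Opaque expi modulus.

(** * The truncated logarithmic kernel *)

Lemma measurable_invr (K : realType) : measurable_fun [set: K] (@GRing.inv K).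
Proof.
rewrite (_ : GRing.inv = fun x : K => x * (x ^+ 2) `^ (-1)); last first.
  apply/funext => x; rewrite powR_inv1 ?sqr_ge0//.
  have [->|x0] := eqVneq x 0; first by rewrite invr0 mul0r.
  by field.
apply: measurable_funM => //; apply: (measurableT_comp (measurable_powR (-1))).
exact: measurable_funX.
Qed.

Section log_kernel.
Context {K : realType}.
Local Open Scope ereal_scope.

(** The truncated logarithmic kernel [ln^+ (rho / m)] at distance [m], with its
    true value [+oo] at the pole, so that identities between kernels hold
    everywhere and not only almost everywhere. *)
Definition logp (rho m : K) : \bar K :=
  if m == 0%R then +oo else (Num.max 0 (ln (rho / m)))%:E.

Lemma logp_ge0 rho m : 0 <= logp rho m.
Proof. by rewrite /logp; case: ifP => // _; rewrite lee_fin le_max lexx. Qed.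

Lemma logp_pole rho : logp rho 0 = +oo.
Proof. by rewrite /logp eqxx. Qed.

Lemma logpE rho m : (0 < m <= rho)%R -> logp rho m = (ln (rho / m))%:E.
Proof.
move=> /andP[m0 mr]; rewrite /logp gt_eqF//; congr (_%:E); apply/max_idPr.
by rewrite ln_ge0// ler_pdivlMr// mul1r.
Qed.

Lemma logp_eq0 rho m : (0 < rho <= m)%R -> logp rho m = 0.
Proof.
move=> /andP[r0 rm]; have m0 : (0 < m)%R by exact: lt_le_trans rm.
rewrite /logp gt_eqF//; congr (_%:E); apply/max_idPl.
by rewrite ln_le0// ler_pdivrMr// mul1r.
Qed.

Lemma logp_le rho C m : (0 <= m)%R -> (0 < rho)%R -> (rho <= C)%R ->
  logp rho m <= logp C m.
Proof.
move=> m0 rho0 rC; rewrite /logp; case: ifPn => // mN0.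
have mp : (0 < m)%R by rewrite lt_neqAle eq_sym mN0.
have C0 : (0 < C)%R by exact: lt_le_trans rC.
rewrite lee_fin ge_max !le_max lexx/= ler_ln ?posrE ?divr_gt0//.
by rewrite ler_pM2r ?invr_gt0// rC orbT.
Qed.

Lemma measurable_logp rho : measurable_fun [set: K] (logp rho).
Proof.
apply: measurable_fun_if => //=.
- exact: measurable_fun_eqr.
- apply/measurable_EFinP; apply: measurable_maxr => //.
  apply: measurable_funTS.
  apply: (measurableT_comp (measurable_ln (R:=K)) (g := fun m : K => (rho / m)%R)).
  by apply: measurable_funM => //; exact: measurable_invr.
Qed.

(** Only the last term has a pole, and it is supported in a disc of radius
    [rho]; the other term is the mean of the kernel over a circle of radius
    [rho], by [mean_logp]. *)
Lemma logp_split rho C m : (0 <= m)%R -> (0 < rho)%R -> (rho <= C)%R -> (m <= C)%R ->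
  logp C m = (ln (C / Num.max m rho))%:E + logp rho m.
Proof.
move=> m0 rho0 rC mC; have C0 : (0 < C)%R by exact: lt_le_trans rC.
have [->|mN0] := eqVneq m 0%R; first by rewrite /logp eqxx addey.
have {m0 mN0} m0 : (0 < m)%R by rewrite lt_neqAle eq_sym mN0.
have [mr|rm] := lerP m rho.
  rewrite !logpE ?m0//; rewrite -EFinD -lnM ?posrE ?divr_gt0//.
  by congr (ln _)%:E; field; rewrite !gt_eqF.
by rewrite (@logp_eq0 rho m) ?rho0 ?ltW// adde0 logpE// m0.
Qed.

Lemma logp_scale C D m : (0 <= m)%R -> (0 < C)%R -> (C <= D)%R -> (m <= C)%R ->
  logp D m = logp C m + (ln (D / C))%:E.
Proof.
move=> m0 C0 CD mC; have D0 : (0 < D)%R by exact: lt_le_trans CD.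
have [->|mN0] := eqVneq m 0%R; first by rewrite /logp eqxx addye.
have {m0 mN0} m0 : (0 < m)%R by rewrite lt_neqAle eq_sym mN0.
rewrite !logpE ?m0 ?mC ?(le_trans mC)// -EFinD -lnM ?posrE ?divr_gt0//.
by congr (ln _)%:E; field; rewrite !gt_eqF.
Qed.

Lemma logp_mul C D m n : (0 <= m)%R -> (0 < n <= D)%R -> (m <= C)%R -> (0 < C)%R ->
  logp C m + logp D n = logp (C * D) (m * n).
Proof.
move=> m0 /andP[n0 nD] mC C0; have D0 : (0 < D)%R by exact: lt_le_trans nD.
have [->|mN0] := eqVneq m 0%R.
  by rewrite mul0r /logp eqxx gt_eqF.
have {m0 mN0} m0 : (0 < m)%R by rewrite lt_neqAle eq_sym mN0.
rewrite !logpE ?m0 ?n0//; last by rewrite mulr_gt0//=; apply: ler_pM => //; exact: ltW.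
rewrite -EFinD -lnM ?posrE ?divr_gt0//.
by congr (ln _)%:E; field; rewrite !gt_eqF.
Qed.

End log_kernel.

Section mean_basics.
Context {K : realType}.
Local Open Scope ereal_scope.
Implicit Types f g : K -> \bar K.

Lemma mean_ge0 f : (forall t, 0 <= f t) -> 0 <= mean f.
Proof. by move=> f0; exact: integral_ge0. Qed.

Lemma meanD f g : measurable_fun [set: K] f -> measurable_fun [set: K] g ->
  (forall t, 0 <= f t) -> (forall t, 0 <= g t) ->
  mean (fun t => f t + g t) = mean f + mean g.
Proof. by move=> mf mg f0 g0; rewrite /mean ge0_integralD. Qed.

Lemma meanZ (c : K) f : measurable_fun [set: K] f -> (forall t, 0 <= f t) -> (0 <= c)%R ->
  mean (fun t => c%:E * f t) = c%:E * mean f.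
Proof. by move=> mf f0 c0; rewrite /mean ge0_integralZl_EFin. Qed.

Lemma le_mean f g : measurable_fun [set: K] f -> measurable_fun [set: K] g ->
  (forall t, 0 <= f t) -> (forall t, f t <= g t) -> mean f <= mean g.
Proof.
move=> mf mg f0 fg; apply: ge0_le_integral => //.
Qed.

Lemma eq_mean f g : f =1 g -> mean f = mean g.
Proof. by move=> fg; congr mean; apply/funext. Qed.

(** For negative [c] the equation is read backwards, since only nonnegative
    functions can be added under the mean. *)
Lemma mean_add_cst f g (c : K) : measurable_fun [set: K] f -> measurable_fun [set: K] g ->
  (forall t, 0 <= f t) -> (forall t, 0 <= g t) ->
  (forall t, f t = g t + c%:E) -> mean f = mean g + c%:E.
Proof.
move=> mf mg f0 g0 fg; have [c0|c0] := leP 0%R c.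
  by rewrite (eq_mean fg) meanD ?mean_cst// lee_fin.
have gf t : g t = f t + (- c)%:E by rewrite fg -addeA -EFinD subrr adde0.
rewrite (eq_mean gf) meanD ?mean_cst ?lee_fin ?oppr_ge0 ?ltW//.
by rewrite -addeA -EFinD addNr adde0.
Qed.

Lemma mean_fatou (h : (K -> \bar K)^nat) : (forall n, measurable_fun [set: K] (h n)) ->
  (forall n t, 0 <= h n t) ->
  mean (fun t => limn_einf (h^~ t)) <= limn_einf (fun n => mean (h n)).
Proof. by move=> mh h0; apply: fatou => // n t _; exact: h0. Qed.

Lemma meanZe (c : \bar K) f : measurable_fun [set: K] f -> (forall t, 0 <= f t) -> 0 <= c ->
  mean (fun t => c * f t) = c * mean f.
Proof. by move=> mf f0 c0; rewrite /mean ge0_integralZl. Qed.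

Section tonelli.
Variable F : K -> K * K -> \bar K.
Hypothesis mF : measurable_fun [set: K * (K * K)] (fun q => F q.1 q.2).
Hypothesis F0 : forall t p, 0 <= F t p.
Local Notation mu := (@lebesgue_measure K).

Let measurable_inner : measurable_fun [set: K * K]
  (fun q => \int[mu]_y F q.1 (q.2, y)).
Proof.
apply: (measurable_fun_fubini_tonelli_F (m2 := mu)
  (fun q : (K * K) * K => F q.1.1 (q.1.2, q.2))) => //.
apply: (measurableT_comp mF (g := fun q : (K * K) * K => (q.1.1, (q.1.2, q.2)))).
apply: measurable_fun_pair; last apply: measurable_fun_pair.
- by apply: measurableT_comp => //; exact: measurable_fst.
- by apply: measurableT_comp => //; exact: measurable_fst.
- exact: measurable_snd.
Qed.

Let measurable_slice t : measurable_fun [set: K * K] (F t).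
Proof. by apply: (measurableT_comp mF (g := pair t)); exact: pair1_measurable. Qed.

Lemma measurable_mean : measurable_fun [set: K * K] (fun p => mean (F^~ p)).
Proof.
exact: (measurable_fun_fubini_tonelli_G (m1 := turn) (fun q => F q.1 q.2)).
Qed.

Lemma measurable_area_integral : measurable_fun [set: K] (fun t => \int[area K]_p F t p).
Proof.
under eq_fun do rewrite integral_areaE//.
apply: (measurable_fun_fubini_tonelli_F (m2 := mu)
  (fun q : K * K => \int[mu]_y F q.1 (q.2, y))) => // q.
exact: integral_ge0.
Qed.

Lemma mean_area : mean (fun t => \int[area K]_p F t p) = \int[area K]_p mean (F^~ p).
Proof.
rewrite integral_areaE; last 2 first.
- exact: measurable_mean.
- by move=> p; exact: integral_ge0.
transitivity (mean (fun t => \int[mu]_x \int[mu]_y F t (x, y))).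
  by congr mean; apply/funext => t; rewrite integral_areaE.
have inner0 (q : K * K) : 0 <= \int[mu]_y F q.1 (q.2, y) by exact: integral_ge0.
rewrite /mean (fubini_tonelli (m1 := turn) (m2 := mu)
  (fun q : K * K => \int[mu]_y F q.1 (q.2, y)) measurable_inner inner0).
apply: eq_integral => x _.
rewrite (fubini_tonelli (m1 := turn) (m2 := mu)
  (fun q : K * K => F q.1 (x, q.2)))//.
apply: (measurableT_comp mF (g := fun q : K * K => (q.1, (x, q.2)))).
by apply: measurable_fun_pair => //; exact: measurable_fun_pair.
Qed.

End tonelli.

Lemma mean_sum (J : Type) (s : seq J) (h : J -> K -> \bar K) :
  (forall j, measurable_fun [set: K] (h j)) -> (forall j t, 0 <= h j t) ->
  mean (fun t => \sum_(j <- s) h j t) = \sum_(j <- s) mean (h j).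
Proof. by move=> mh h0; rewrite /mean ge0_integral_sum. Qed.

Lemma measurable_mean2 (F : K -> K -> \bar K) :
  measurable_fun [set: K * K] (fun p => F p.1 p.2) -> (forall s t, 0 <= F s t) ->
  measurable_fun [set: K] (fun s => mean (F s)).
Proof.
move=> mF F0.
exact: (measurable_fun_fubini_tonelli_F (m2 := turn) (fun p => F p.1 p.2)).
Qed.

Lemma mean_mean (F : K -> K -> \bar K) :
  measurable_fun [set: K * K] (fun p => F p.1 p.2) -> (forall s t, 0 <= F s t) ->
  mean (fun s => mean (F s)) = mean (fun t => mean (F^~ t)).
Proof.
move=> mF F0.
exact: (fubini_tonelli (m1 := turn) (m2 := turn) (fun p => F p.1 p.2)).
Qed.

End mean_basics.

#[global] Opaque mean logp integral.

(** * Logarithmic means over circles *)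

Section complex_measurability.
Context {K : realType} (d : measure_display) (T : measurableType d).
Implicit Types f g : T -> Cplx K.
Local Open Scope complex_scope.

(** Measurability for the product sigma-algebra of the plane. *)
Definition cmeas f : Prop :=
  measurable_fun [set: T] (fun x => complex.Re (f x)) /\
  measurable_fun [set: T] (fun x => complex.Im (f x)).

Lemma cmeas_cst z : cmeas (fun=> z).
Proof. by split; exact: measurable_cst. Qed.

Lemma cmeasD f g : cmeas f -> cmeas g -> cmeas (fun x => f x + g x).
Proof.
move=> [f1 f2] [g1 g2]; split.
  by under eq_fun do rewrite raddfD/=; exact: measurable_funD.
by under eq_fun do rewrite raddfD/=; exact: measurable_funD.
Qed.

Lemma cmeasM f g : cmeas f -> cmeas g -> cmeas (fun x => f x * g x).
Proof.
move=> [f1 f2] [g1 g2]; split.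
  rewrite (_ : (fun _ => _) = fun x => complex.Re (f x) * complex.Re (g x) -
    complex.Im (f x) * complex.Im (g x)).
    by apply: measurable_funB; exact: measurable_funM.
  by apply/funext => x; case: (f x) => a b; case: (g x).
rewrite (_ : (fun _ => _) = fun x => complex.Re (f x) * complex.Im (g x) +
    complex.Im (f x) * complex.Re (g x)).
  by apply: measurable_funD; exact: measurable_funM.
by apply/funext => x; case: (f x) => a b; case: (g x).
Qed.

Lemma cmeasN f : cmeas f -> cmeas (fun x => - f x).
Proof.
move=> [f1 f2]; split.
  by under eq_fun do rewrite raddfN/=; exact: measurableT_comp.
by under eq_fun do rewrite raddfN/=; exact: measurableT_comp.
Qed.

Lemma cmeasB f g : cmeas f -> cmeas g -> cmeas (fun x => f x - g x).
Proof. by move=> mf mg; apply: cmeasD => //; exact: cmeasN. Qed.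

Lemma cmeasV f : cmeas f -> cmeas (fun x => (f x)^-1).
Proof.
move=> [f1 f2].
have mn : measurable_fun [set: T]
    (fun x => (complex.Re (f x) ^+ 2 + complex.Im (f x) ^+ 2)^-1).
  apply: (measurableT_comp (@measurable_invr K)).
  by apply: measurable_funD; exact: measurable_funX.
split.
  rewrite (_ : (fun _ => _) = fun x => complex.Re (f x) *
    (complex.Re (f x) ^+ 2 + complex.Im (f x) ^+ 2)^-1); first exact: measurable_funM.
  by apply/funext => x; case: (f x).
rewrite (_ : (fun _ => _) = fun x => - (complex.Im (f x) *
    (complex.Re (f x) ^+ 2 + complex.Im (f x) ^+ 2)^-1)).
  by apply: measurableT_comp => //; exact: measurable_funM.
by apply/funext => x; case: (f x).
Qed.

Lemma cmeas_expi (g : T -> K) : measurable_fun [set: T] g -> cmeas (fun x => expi (g x)).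
Proof.
move=> mg; split.
  under eq_fun do rewrite Re_expi; apply: measurableT_comp => //.
  by apply: continuous_measurable_fun; exact: continuous_cos.
under eq_fun do rewrite Im_expi; apply: measurableT_comp => //.
by apply: continuous_measurable_fun; exact: continuous_sin.
Qed.

Lemma measurable_modulus f : cmeas f -> measurable_fun [set: T] (fun x => modulus (f x)).
Proof.
move=> [f1 f2].
rewrite (_ : (fun _ => _) = fun x => Num.sqrt
    (complex.Re (f x) ^+ 2 + complex.Im (f x) ^+ 2)).
  apply: (@measurableT_comp _ _ _ _ _ _ (@Num.sqrt K)).
    by apply: continuous_measurable_fun => x; exact: sqrt_continuous.
  by apply: measurable_funD; exact: measurable_funX.
by apply/funext => x; rewrite modulusE.
Qed.

Lemma measurable_logp_modulus rho f : cmeas f ->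
  measurable_fun [set: T] (fun x => logp rho (modulus (f x))).
Proof.
by move=> mf; apply: (measurableT_comp (measurable_logp rho)); exact: measurable_modulus.
Qed.

End complex_measurability.

Section truncation.
Context {K : realType}.
Local Open Scope ereal_scope.

Lemma trunc_add (a b c : \bar K) (L N : K) : 0 <= a -> 0 <= b -> 0 <= c ->
  (L <= N)%R -> a + b = c + L%:E -> a <= L%:E \/ b <= L%:E ->
  mine a N%:E + mine b N%:E <= mine c N%:E + L%:E.
Proof.
move=> a0 b0 c0 LN abc aLbL; have [cN|Nc] := leP c N%:E.
  by rewrite -abc leeD// ge_min lexx.
case: aLbL => h; [rewrite addeC|]; rewrite leeD// ge_min ?lexx ?orbT ?h//.
Qed.

Lemma cvg_trunc (a : \bar K) : mine a n%:R%:E @[n --> \oo] --> a.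
Proof.
case: a => [r| |].
- apply: cvg_near_cst; near=> n; apply/min_idPl; rewrite lee_fin.
  by near: n; exact: nbhs_infty_ger.
- under eq_fun do rewrite min_r ?leey//.
  exact/cvgenyP.
- by under eq_fun do rewrite min_l ?leNye//; exact: cvg_cst.
Unshelve. all: by end_near. Qed.

Lemma limn_einf_le (u : (\bar K)^nat) c : (forall n0, exists2 n, (n0 <= n)%N & u n <= c) ->
  limn_einf u <= c.
Proof.
move=> uc; rewrite limn_einf_lim; apply: lime_le; first exact: is_cvg_einfs.
apply: nearW => n0; have [n n0n unc] := uc n0; apply: le_trans unc.
by apply: ereal_inf_lbound; exists n.
Qed.

Lemma limn_einf_ge (u : (\bar K)^nat) c : (\forall n \near \oo, c <= u n) ->
  c <= limn_einf u.
Proof.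
move=> [N _ uc]; rewrite limn_einf_lim; apply: lime_ge; first exact: is_cvg_einfs.
exists N => // n Nn; apply: le_ereal_inf_tmp => _ [m /= nm <-].
by apply: uc; exact: leq_trans nm.
Qed.

End truncation.

Section doubling.
Context {K : realType}.
Local Open Scope ereal_scope.
Variables (f g : K -> K -> \bar K) (L : K) (c : K -> K).
Hypothesis L0 : (0 <= L)%R.
Hypothesis mf : forall b, measurable_fun [set: K] (f b).
Hypothesis mg : forall b, measurable_fun [set: K] (g b).
Hypothesis f0 : forall b t, 0 <= f b t.
Hypothesis g0 : forall b t, 0 <= g b t.
Hypothesis f_turn : forall b t, f b (t + 2 * pi)%R = f b t.
Hypothesis f_half : forall b t, f b (t + pi)%R = g b t.
Hypothesis f_prod : forall b t, (0 <= b <= 1)%R ->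
  f b t + g b t = f (b ^+ 2)%R (2 * t)%R + L%:E.
Hypothesis f_bnd : forall b x t, (b < 1)%R -> (0 <= x <= b)%R -> f x t <= (c b)%:E.
Hypothesis f_or_g : forall t, f 1%R t <= L%:E \/ g 1%R t <= L%:E.

Let mf2 b : measurable_fun [set: K] (fun t => f b (2 * t)%R).
Proof.
apply: (measurableT_comp (mf b) (g := fun t : K => (2 * t)%R)).
exact: measurable_funM.
Qed.

Let mean_double_f b : (0 <= b <= 1)%R ->
  mean (f b) + mean (f b) = mean (f (b ^+ 2)) + L%:E.
Proof.
move=> b01.
have Eg : mean (g b) = mean (f b).
  by rewrite -(mean_shift pi (mf b) (f0 b) (f_turn b)); apply: eq_mean => t; rewrite f_half.
rewrite -[in X in _ + X]Eg -(meanD (mf b) (mg b) (f0 b) (g0 b)).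
rewrite -(mean_double (mf (b ^+ 2)%R) (f0 (b ^+ 2)%R) (f_turn (b ^+ 2)%R)).
apply: mean_add_cst.
- exact: emeasurable_funD (mf b) (mg b).
- exact: mf2.
- by move=> t; exact: adde_ge0.
- by move=> t; exact: f0.
- by move=> t; exact: f_prod.
Qed.

Let mean_f_lt1 b : (0 <= b < 1)%R -> mean (f b) = L%:E.
Proof.
move=> /andP[b0 b1].
have bnd x : (0 <= x <= b)%R -> 0 <= mean (f x) <= (c b)%:E.
  move=> xb; apply/andP; split; first exact: mean_ge0.
  rewrite -(@mean_cst K (c b)%:E); apply: le_mean => //.
  by move=> t; exact: f_bnd.
have fin x : (0 <= x <= b)%R -> mean (f x) \is a fin_num.
  move=> /bnd/andP[m0 mc]; rewrite ge0_fin_numE//; exact: le_lt_trans mc (ltry _).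
pose D x := (fine (mean (f x)) - L)%R.
have Dsq x : (0 <= x <= b)%R -> (2 * D x = D (x ^+ 2))%R.
  move=> xb; have /andP[x0 x1] := xb.
  have xb2 : (0 <= x ^+ 2 <= b)%R.
    by rewrite sqr_ge0/= expr2 (le_trans _ x1)// ler_piMl// (le_trans x1)// ltW.
  have := @mean_double_f x; rewrite x0 (le_trans x1 (ltW b1)) => /(_ isT).
  rewrite -(fineK (fin _ xb)) -(fineK (fin _ xb2)) -!EFinD => -[h].
  by rewrite /D mulrBr mulr_natl mulr2n h; ring.
have powb n : (0 <= b ^+ (2 ^ n) <= b)%R.
  rewrite exprn_ge0//= -[leRHS]expr1.
  apply: ler_wiXn2l => //; [exact: ltW|exact: expn_gt0].
have Dn n : (2 ^+ n * D b = D (b ^+ (2 ^ n)))%R.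
  elim: n => [|n IHn]; first by rewrite expn0 mul1r expr1.
  by rewrite exprS -mulrA IHn (Dsq _ (powb n)) -exprM -expnSr.
have Dbnd n : (2 ^+ n * `|D b| <= c b + L)%R.
  have -> : (2 ^+ n * `|D b| = `|D (b ^+ (2 ^ n))|)%R.
    by rewrite -Dn normrM ger0_norm// exprn_ge0.
  have := bnd _ (powb n); rewrite -(fineK (fin _ (powb n))) !lee_fin => /andP[h1 h2].
  have LL := L0; rewrite /D ler_norml; apply/andP; split; lra.
have D0 : D b = 0%R.
  apply/eqP; rewrite -normr_eq0; apply/eqP/le_anti; rewrite normr_ge0 andbT.
  rewrite leNgt; apply/negP => Dp.
  have := Dbnd (Num.truncn ((c b + L) / `|D b|)).+1.
  rewrite leNgt => /negP; apply; rewrite -ltr_pdivrMr//.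
  have := truncnS_gt ((c b + L) / `|D b|); move/lt_le_trans; apply.
  rewrite -natrX ler_nat; exact/ltnW/ltn_expl.
have bb : (0 <= b <= b)%R by rewrite b0 lexx.
by rewrite -(fineK (fin _ bb)); congr (_%:E); move: D0; rewrite /D; lra.
Qed.

Let trunc_ge0 (x : \bar K) (n : nat) : 0 <= x -> 0 <= mine x n%:R%:E.
Proof. by move=> x0; rewrite le_min x0 lee_fin/=. Qed.

Let mtrunc (h : K -> \bar K) (n : nat) : measurable_fun [set: K] h ->
  measurable_fun [set: K] (fun t => mine (h t) n%:R%:E).
Proof. by move=> mh; exact: measurable_mine. Qed.

Let mean_trunc (n : nat) : (L <= n%:R)%R -> mean (fun t => mine (f 1 t) n%:R%:E) <= L%:E.
Proof.
move=> Ln; set I := mean _.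
have Ifin : I \is a fin_num.
  rewrite ge0_fin_numE; last by apply: mean_ge0 => t; exact: trunc_ge0.
  apply: (@le_lt_trans _ _ n%:R%:E); last exact: ltry.
  rewrite -[leRHS](@mean_cst K); apply: le_mean => //; first exact: mtrunc.
    by move=> t; exact: trunc_ge0.
  by move=> t; rewrite ge_min lexx orbT.
suff : I + I <= I + L%:E by rewrite leeD2lE.
have Eg : mean (fun t => mine (g 1 t) n%:R%:E) = I.
  rewrite /I -(@mean_shift K (fun t => mine (f 1 t) n%:R%:E) pi).
  - by apply: eq_mean => t; rewrite f_half.
  - exact: mtrunc.
  - by move=> t; exact: trunc_ge0.
  - by move=> t; rewrite f_turn.
have E2 : mean (fun t => mine (f 1 (2 * t)%R) n%:R%:E) = I.
  rewrite (@mean_double K (fun t => mine (f 1 t) n%:R%:E)) => //.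
  - exact: mtrunc.
  - by move=> t; exact: trunc_ge0.
  - by move=> t; rewrite f_turn.
have m1 := mtrunc n (mf 1); have m2 := mtrunc n (mg 1); have m3 := mtrunc n (mf2 1).
have t1 t : 0 <= mine (f 1 t) n%:R%:E by exact: trunc_ge0.
have t2 t : 0 <= mine (g 1 t) n%:R%:E by exact: trunc_ge0.
have t3 t : 0 <= mine (f 1 (2 * t)%R) n%:R%:E by exact: trunc_ge0.
rewrite -[X in _ + X <= _]Eg {1}/I -(meanD m1 m2 t1 t2).
rewrite -[in leRHS]E2 -[X in _ <= _ + X]mean_cst -(meanD m3 (measurable_cst _) t3); last first.
  by move=> t; rewrite lee_fin.
apply: le_mean.
- exact: emeasurable_funD m1 m2.
- exact: emeasurable_funD m3 (measurable_cst _).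
- by move=> t; exact: adde_ge0.
move=> t; apply: trunc_add => //.
by have := @f_prod 1%R t; rewrite expr1n ler01 lexx; apply.
Qed.

(** The mean of a function of [(b, t)] that reproduces itself under the
    substitution [(b, t) |-> (b^2, 2 t)], as [ln 2 - ln |1 - b expi t|] does.
    For [b < 1] the defect [D] from [L] is bounded and satisfies
    [2 D(b) = D(b^2)], hence vanishes.  At [b = 1] the function is unbounded;
    truncation at height [n >= L] preserves one inequality of the doubling
    identity, as [f 1 t] and [g 1 t] never both exceed [L].  This gives
    integrability, and the doubling identity then determines the mean. *)
Lemma mean_doubling b : (0 <= b <= 1)%R -> mean (f b) = L%:E.
Proof.
move=> /andP[b0]; rewrite le_eqVlt => /predU1P[->|b1]; last first.
  by apply: mean_f_lt1; rewrite b0.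
have Ile : mean (f 1) <= L%:E.
  have -> : mean (f 1) = mean (fun t => limn_einf (fun n => mine (f 1 t) n%:R%:E)).
    by apply: eq_mean => t; have [-> _] := cvg_limn_einf_sup (@cvg_trunc K (f 1%R t)).
  apply: le_trans (mean_fatou (h := fun n t => mine (f 1 t) n%:R%:E) _ _) _.
  - by move=> n; exact: mtrunc.
  - by move=> n t; exact: trunc_ge0.
  apply: limn_einf_le => n0; exists (maxn n0 (Num.truncn L).+1).
    exact: leq_maxl.
  apply: mean_trunc; apply: le_trans (ltW (truncnS_gt _)) _.
  by rewrite ler_nat leq_maxr.
have Ifin : mean (f 1) \is a fin_num.
  by rewrite ge0_fin_numE ?(le_lt_trans Ile) ?ltry//; exact: mean_ge0.
have := @mean_double_f 1%R; rewrite ler01 lexx expr1n => /(_ isT)/eqP.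
by rewrite -(fineK Ifin) -!EFinD eqe => /eqP/addrI ->.
Qed.

End doubling.

Section log_mean.
Context {K : realType}.
Local Open Scope complex_scope.

Let dist1 (b t : K) := modulus (1 - b%:C * expi t).

Let cmeas_dist1 (b : K) : cmeas (fun t : K => 1 - b%:C * expi t).
Proof.
apply: cmeasB; first exact: cmeas_cst.
by apply: cmeasM; [exact: cmeas_cst|exact: cmeas_expi].
Qed.

Let dist1_itv b t : 0 <= b -> 1 - b <= dist1 b t <= 1 + b.
Proof.
move=> b0; apply/andP; split.
  apply: le_trans (modulusBl _ _).
  by rewrite modulus1 modulusM modulus_real modulus_expi mulr1 ger0_norm.
apply: le_trans (modulusD _ _) _.
by rewrite modulus1 modulusN modulusM modulus_real modulus_expi mulr1 ger0_norm.
Qed.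

Local Open Scope ereal_scope.

Let logd (b t : K) := logp 2 (dist1 b t).

Let mlogd b : measurable_fun [set: K] (logd b).
Proof. by apply: measurable_logp_modulus; exact: cmeas_dist1. Qed.

Let mlogd_half b : measurable_fun [set: K]
  (fun t => logp 2 (modulus (1 + b%:C * expi t))).
Proof.
apply: measurable_logp_modulus; apply: cmeasD; first exact: cmeas_cst.
by apply: cmeasM; [exact: cmeas_cst|exact: cmeas_expi].
Qed.

Let logd_prod b t : (0 <= b <= 1)%R ->
  logd b t + logp 2 (modulus (1 + b%:C * expi t)) = logd (b ^+ 2) (2 * t)%R + (ln 2)%:E.
Proof.
move=> /andP[b0 b1]; have /andP[_ d2] := dist1_itv t b0.
have e2 : dist1 (b ^+ 2) (2 * t) = (dist1 b t * modulus (1 + b%:C * expi t))%R.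
  rewrite /dist1 -modulusM; congr modulus.
  rewrite (_ : 2 * t = t + t)%R; last by ring.
  by rewrite expiD rmorphXn/=; ring.
have m2 : (modulus (1 + b%:C * expi t) <= 1 + b)%R.
  apply: le_trans (modulusD _ _) _.
  by rewrite modulus1 modulusM modulus_real modulus_expi mulr1 ger0_norm.
have b12 : (1 + b <= 2)%R by lra.
have [m0|mN0] := eqVneq (modulus (1 + b%:C * expi t)) 0%R.
  rewrite /logd e2 m0 mulr0 !logp_pole addey ?addye//.
  by rewrite gt_eqF// (lt_le_trans _ (logp_ge0 _ _))// ltNyr.
rewrite logp_mul ?modulus_ge0// ?lt_neqAle ?(eq_sym 0%R) ?mN0 ?modulus_ge0 ?(le_trans m2)//; last first.
  exact: le_trans b12.
have b2 : (b ^+ 2 <= 1)%R by rewrite expr_le1.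
rewrite /logd e2 (@logp_scale _ 2%R (2 * 2)%R)//.
- by rewrite mulfK.
- by rewrite mulr_ge0// modulus_ge0.
- by lra.
- have /andP[_] := dist1_itv (2 * t) (sqr_ge0 b); rewrite -e2 => /le_trans; apply.
  by lra.
Qed.

Let mean_logd b : (0 <= b <= 1)%R -> mean (logd b) = (ln 2)%:E.
Proof.
apply: (@mean_doubling K logd (fun b t => logp 2 (modulus (1 + b%:C * expi t))) (ln 2)
  (fun b => ln 2 - ln (1 - b))%R).
- by rewrite ln_ge0// ler1n.
- exact: mlogd.
- exact: mlogd_half.
- by move=> *; exact: logp_ge0.
- by move=> *; exact: logp_ge0.
- by move=> x t; rewrite /logd /dist1 expi_turn.
- by move=> x t; rewrite /logd /dist1 expi_half mulrN opprK.
- exact: logd_prod.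
- move=> y x t y1 /andP[x0 xy].
  have /andP[d1 d2] := dist1_itv t x0.
  have dp : (0 < dist1 x t)%R by apply: lt_le_trans d1; rewrite subr_gt0 (le_lt_trans xy).
  rewrite /logd logpE ?dp/=; last by apply: le_trans d2 _; move: xy y1; lra.
  rewrite lee_fin ln_div ?posrE// lerD2l lerN2 ler_ln ?posrE// ?subr_gt0//.
  by apply: le_trans d1; rewrite lerD2l lerN2.
move=> t; have [d1|d1] := leP 1%R (dist1 1 t); [left|right].
  rewrite /logd logpE; last by have := dist1_itv t (@ler01 K); rewrite (lt_le_trans ltr01 d1) => /andP[_].
  rewrite lee_fin ler_ln ?posrE ?divr_gt0 ?(lt_le_trans _ d1)//.
  by rewrite ler_pdivrMr ?(lt_le_trans _ d1)// ler_peMr.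
have d2 : (1 < modulus (1 + 1%:C * expi t))%R.
  have := modulusD (1 - 1%:C * expi t) (1 + 1%:C * expi t).
  rewrite (_ : _ + _ = (1 + 1)%:C)%R; last by rewrite rmorphD/=; ring.
  by rewrite modulus_real ger0_norm ?addr_ge0//; move: d1; rewrite /dist1; lra.
rewrite logpE.
  rewrite lee_fin ler_ln ?posrE ?divr_gt0 ?(lt_trans _ d2)//.
  by rewrite ler_pdivrMr ?(lt_trans _ d2)// ler_peMr// ltW.
rewrite (lt_trans _ d2)//=; apply: le_trans (modulusD _ _) _.
by rewrite modulus1 modulusM modulus_real modulus_expi mulr1 normr1.
Qed.

Let modulus_swap (a b : Cplx K) t :
  modulus (a - b * expi t) = modulus (b^*%C - a^*%C * expi t).
Proof.
rewrite -(modulus_conj (b^*%C - _)) rmorphB rmorphM/= !conjcK.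
rewrite expi_conj expiN modulusB -[LHS]mulr1 -(@modulus_expi K (- t)) -modulusM expiN.
by congr modulus; rewrite mulrBl -mulrA mulfV ?mulr1// expi_neq0.
Qed.

(** Jensen's formula for one zero.  Homogeneity, a rotation and the symmetry
    between [a] and [b] reduce it to [a = 1] and real [b] in [[0, 1]], where the
    identity [(1 - b e) (1 + b e) = 1 - b^2 e^2] on the circle makes
    [ln (2 / |1 - b e|)] a self-reproducing family for [mean_doubling]. *)
Lemma mean_logp (a b : Cplx K) (C : K) :
  (0 < Num.max (modulus a) (modulus b))%R -> (modulus a + modulus b <= C)%R ->
  mean (fun t => logp C (modulus (a - b * expi t))) =
  (ln (C / Num.max (modulus a) (modulus b)))%:E.
Proof.
wlog ab : a b / (modulus b <= modulus a)%R => [wl|].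
  move=> m0 abC; have [ab|ba] := leP (modulus b) (modulus a).
    by rewrite wl ?(max_idPl ab)//; move: m0; rewrite (max_idPl ab).
  rewrite (@eq_mean _ _ (fun t => logp C (modulus (b^*%C - a^*%C * expi t)))).
    have ba' := ltW ba.
    rewrite wl ?modulus_conj ?(max_idPl ba')//.
      by move: m0; rewrite (max_idPr ba').
    by rewrite addrC.
  by move=> t; rewrite modulus_swap.
rewrite (max_idPl ab) => a0 abC.
have C0 : (0 < C)%R by apply: lt_le_trans abC; rewrite ltr_wpDr ?modulus_ge0.
have aN0 : (a != 0)%R by rewrite -modulus_gt0.
have [th bth] := polar_form (b / a); set x := modulus (b / a) in bth.
have x01 : (0 <= x <= 1)%R.
  by rewrite modulus_ge0/= /x modulusM modulusV ler_pdivrMr// mul1r.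
have bE : b = (a * (x%:C * expi th))%R by rewrite -bth mulrCA divff// mulr1.
have distE t : modulus (a - b * expi t) = (modulus a * dist1 x (t + th))%R.
  rewrite /dist1 -modulusM; congr modulus.
  by rewrite bE expiD; ring.
rewrite (@mean_add_cst _ _ (fun t => logd x (t + th)%R) (ln (C / (2 * modulus a)))).
- rewrite (@mean_shift _ (logd x))//; first rewrite mean_logd// -EFinD.
  + rewrite -lnM ?posrE ?divr_gt0 ?mulr_gt0//.
    by congr (ln _)%:E; field; rewrite gt_eqF.
  + by move=> t; exact: logp_ge0.
  + by move=> t; rewrite /logd /dist1 expi_turn.
- apply: measurable_logp_modulus; apply: cmeasB; first exact: cmeas_cst.
  by apply: cmeasM; [exact: cmeas_cst|exact: cmeas_expi].
- apply: (measurableT_comp (mlogd x) (g := fun t : K => (t + th)%R)).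
  exact: measurable_funD.
- by move=> t; exact: logp_ge0.
- by move=> t; exact: logp_ge0.
move=> t; rewrite distE.
have d2 : (dist1 x (t + th) <= 2)%R.
  by have /andP[x0 x1] := x01; have /andP[_ /le_trans->//] := dist1_itv (t + th) x0; lra.
rewrite /logd; set d := dist1 _ _ in d2 *.
have [d0|dN0] := eqVneq d 0%R; first by rewrite d0 mulr0 !logp_pole addye.
have dp : (0 < d)%R by rewrite lt_neqAle eq_sym dN0/= modulus_ge0.
rewrite !logpE ?dp ?mulr_gt0//.
  rewrite -EFinD -lnM ?posrE ?divr_gt0 ?mulr_gt0//.
  by congr (ln _)%:E; field; rewrite !gt_eqF.
rewrite /= -distE (le_trans (modulusD _ _))// modulusN modulusM modulus_expi.
by rewrite mulr1.
Qed.

End log_mean.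

(** * Open sets of the plane are measurable *)

Section plane_measurability.
Context {K : realType}.
Local Open Scope complex_scope.

Definition cplx (p : K * K) : Cplx K := p.1 +i* p.2.

(** The Borel sets of the plane contain the open sets: such a set is the union
    of the countably many squares with rational centre and half-side that it
    contains. *)
Lemma measurable_open_plane (A : set (K * K)) :
  (forall p, A p -> exists2 e : K, 0 < e &
    forall q, `|q.1 - p.1| < e -> `|q.2 - p.2| < e -> A q) ->
  measurable A.
Proof.
move=> Aopen.
pose box (c : rat * rat * rat) : set (K * K) :=
  ball (ratr c.1.1 : K) (ratr c.2 : K) `*` ball (ratr c.1.2 : K) (ratr c.2 : K).
pose F n := if unpickle n is Some c then
  (if `[< box c `<=` A >] then box c else set0) else set0.
have -> : A = \bigcup_n F n.
  apply/seteqP; split => [p Ap|p [n _]]; last first.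
    by rewrite /F; case: unpickle => // c; case: asboolP => // cA /cA.
  have [e e0 eA] := Aopen p Ap.
  have e2 : 0 < e / 2 by rewrite divr_gt0.
  have [q] := rat_in_itvoo e2; rewrite in_itv/= => /andP[q0 qe].
  have near_rat (x : K) : exists a : rat, `|ratr a - x| < ratr q.
    have : x < x + ratr q by rewrite ltrDl.
    move=> /rat_in_itvoo[a]; rewrite in_itv/= => /andP[xa ax]; exists a.
    by rewrite ger0_norm ?subr_ge0 ?ltW// ltrBlDr addrC.
  have [a ha] := near_rat p.1; have [b hb] := near_rat p.2.
  have boxA : box (a, b, q) `<=` A.
    move=> -[x y] [/=]; rewrite /ball/= => xa yb; apply: eA => /=.
      rewrite (le_lt_trans (ler_distD (ratr a) _ _))//.
      by rewrite (distrC x) (splitr e) ltrD ?(lt_trans ha)// (lt_trans xa).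
    rewrite (le_lt_trans (ler_distD (ratr b) _ _))//.
    by rewrite (distrC y) (splitr e) ltrD ?(lt_trans hb)// (lt_trans yb).
  exists (pickle ((a, b), q)); first exact: I.
  rewrite /F; have -> := pickleK (a, b, q); rewrite (asboolT boxA).
  by split; rewrite /ball/=.
apply: bigcupT_measurable => n; rewrite /F; case: unpickle => // c.
by case: ifP => // _; apply: measurableX; exact: measurable_ball.
Qed.

End plane_measurability.

(** * Nonnegative superharmonic functions *)

Section superharmonic.
Context {K : realType}.
Local Open Scope complex_scope.
Local Open Scope ereal_scope.

(** Nonnegative superharmonic functions on the open unit disc, extended by [0]
    to the plane so that they can be integrated over it. *)
Definition pos_superharmonic (V : Cplx K -> \bar K) : Prop :=
  [/\ forall z, 0 <= V z,
      forall z, (1 <= modulus z)%R -> V z = 0,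
      forall z (a : K), (modulus z < 1)%R -> a%:E < V z ->
        exists2 e : K, (0 < e)%R & forall w, (modulus (w - z) < e)%R -> a%:E < V w
    & forall z (rho : K), (0 < rho)%R -> (modulus z + rho < 1)%R ->
        mean (fun t => V (z + rho%:C * expi t)%R) <= V z].

Lemma cplxE (z : Cplx K) : cplx (complex.Re z, complex.Im z) = z.
Proof. by case: z. Qed.

Lemma cmeas_cplx : cmeas (@cplx K).
Proof. by split; [exact: measurable_fst|exact: measurable_snd]. Qed.

Lemma measurable_cplx_comp (d : measure_display) (T : measurableType d)
    (F : Cplx K -> \bar K) (f : T -> Cplx K) :
  measurable_fun [set: K * K] (F \o @cplx K) -> cmeas f ->
  measurable_fun [set: T] (F \o f).
Proof.
move=> mF [f1 f2].
rewrite (_ : F \o f = (F \o @cplx K) \o (fun x => (complex.Re (f x), complex.Im (f x)))).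
  by apply: measurableT_comp => //; exact: measurable_fun_pair.
by apply/funext => x /=; rewrite cplxE.
Qed.

Lemma integral_area_cplx_translate (b : Cplx K) (F : Cplx K -> \bar K) :
  measurable_fun [set: K * K] (F \o @cplx K) -> (forall z, 0 <= F z) ->
  \int[area K]_p F (cplx p + b)%R = \int[area K]_p F (cplx p).
Proof.
move=> mF F0.
rewrite -(@integral_area_translate K (complex.Re b) (complex.Im b) (F \o @cplx K))//;
  last by move=> p; exact: F0.
by apply: eq_integral => -[x y] _ /=; congr F; case: b.
Qed.

Lemma integral_area_cplx_rotate (s : K) (F : Cplx K -> \bar K) :
  measurable_fun [set: K * K] (F \o @cplx K) -> (forall z, 0 <= F z) ->
  \int[area K]_p F (expi s * cplx p)%R = \int[area K]_p F (cplx p).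
Proof.
move=> mF F0.
rewrite -(@integral_area_rotate K (cos s) (sin s) (F \o @cplx K))//; last 2 first.
- exact: cos2Dsin2.
- by move=> p; exact: F0.
apply: eq_integral => -[x y] _ /=; congr F.
rewrite -[expi s]cplxE Re_expi Im_expi /cplx /=; simpc.
by congr (_ +i* _); rewrite addrC.
Qed.

Lemma measurable_lsc (V : Cplx K -> \bar K) : (forall z, 0 <= V z) ->
  (forall z, (1 <= modulus z)%R -> V z = 0) ->
  (forall z (a : K), (modulus z < 1)%R -> a%:E < V z ->
    exists2 e : K, (0 < e)%R & forall w, (modulus (w - z) < e)%R -> a%:E < V w) ->
  measurable_fun [set: K * K] (V \o @cplx K).
Proof.
move=> V0 Vout Vlsc.
apply: (measurability _ (ErealGenOInfty.measurableE K)).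
move=> /= _ [_ [a ->]] <-; apply: measurableI => //.
have [a0|a0] := ltP a 0%R.
  rewrite (_ : _ @^-1` _ = setT) //; apply/seteqP; split => // p _ /=.
  by rewrite in_itv/= andbT (lt_le_trans _ (V0 _))// lte_fin.
apply: measurable_open_plane => p /=; rewrite in_itv/= andbT => aV.
have p1 : (modulus (cplx p) < 1)%R.
  by rewrite ltNge; apply/negP => /Vout V0'; move: aV; rewrite V0' lte_fin ltNge a0.
have [e e0 eV] := Vlsc _ _ p1 aV.
exists (e / 2)%R; first by rewrite divr_gt0.
move=> q q1 q2; rewrite in_itv/= andbT; apply: eV.
apply: le_lt_trans (modulus_le_ReIm _) _.
by rewrite (splitr e) ltrD.
Qed.

Section theory.
Variable V : Cplx K -> \bar K.
Hypothesis Vsup : pos_superharmonic V.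

Lemma superharmonic_ge0 z : 0 <= V z. Proof. by case: Vsup. Qed.

Lemma measurable_superharmonic : measurable_fun [set: K * K] (V \o @cplx K).
Proof. by have [V0 Vout Vlsc _] := Vsup; exact: measurable_lsc. Qed.

Lemma measurable_superharmonic_comp (d : measure_display) (T : measurableType d)
    (f : T -> Cplx K) : cmeas f -> measurable_fun [set: T] (fun x => V (f x)).
Proof. exact: (measurable_cplx_comp measurable_superharmonic). Qed.

Let mean_radius (x w : Cplx K) : (modulus x + modulus w < 1)%R ->
  mean (fun s => V (x + expi s * w)%R) <= V x.
Proof.
have [V0 _ _ Vmean] := Vsup => xw1.
have [->|w0] := eqVneq w 0%R.
  by rewrite (@eq_mean _ _ (fun=> V x)) ?mean_cst// => s; rewrite mulr0 addr0.
have [th wE] := polar_form w.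
rewrite (@eq_mean _ _ (fun s => V (x + (modulus w)%:C * expi (s + th))%R)); last first.
  by move=> s; congr (V (_ + _)%R); rewrite {1}wE expiD; ring.
rewrite (@mean_shift _ (fun s => V (x + (modulus w)%:C * expi s)%R))//.
- by apply: Vmean => //; rewrite modulus_gt0.
- apply: measurable_superharmonic_comp; apply: cmeasD; first exact: cmeas_cst.
  by apply: cmeasM; [exact: cmeas_cst|exact: cmeas_expi].
- by move=> t; rewrite expi_turn.
Qed.

(** A radial average about [x] is an average of circle means, because the area
    is invariant under rotation; so it does not exceed the value at [x]. *)
Lemma radial_superharmonic (k : K -> \bar K) (x : Cplx K) (rho : K) :
  measurable_fun [set: K] k -> (forall m, 0 <= k m) ->
  (forall m, (rho <= m)%R -> k m = 0) -> (modulus x + rho <= 1)%R ->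
  \int[area K]_p (k (modulus (cplx p)) * V (cplx p + x)%R) <=
  (\int[area K]_p k (modulus (cplx p))) * V x.
Proof.
have V0 := superharmonic_ge0 => mk k0 kout xrho.
have mkm (d : measure_display) (T : measurableType d) (f : T -> Cplx K) :
    cmeas f -> measurable_fun [set: T] (fun p => k (modulus (f p))).
  by move=> mf; apply: (measurableT_comp mk); exact: measurable_modulus.
pose F (s : K) (p : K * K) := k (modulus (cplx p)) * V (x + expi s * cplx p)%R.
have cm2 : cmeas (fun q : K * (K * K) => cplx q.2).
  by split => /=; apply: measurableT_comp => //; exact: measurable_snd.
have cmx : cmeas (fun q : K * (K * K) => x + expi q.1 * cplx q.2)%R.
  apply: cmeasD; first exact: cmeas_cst.
  by apply: cmeasM => //; apply: cmeas_expi; exact: measurable_fst.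
have mF : measurable_fun [set: K * (K * K)] (fun q => F q.1 q.2).
  by apply: emeasurable_funM; [exact: mkm|exact: measurable_superharmonic_comp].
have F0 s p : 0 <= F s p by exact: mule_ge0.
have intF s : \int[area K]_p F s p = \int[area K]_p (k (modulus (cplx p)) * V (cplx p + x)%R).
  rewrite -[RHS](@integral_area_cplx_rotate s (fun z => k (modulus z) * V (z + x)%R)).
  - apply: eq_integral => p _; rewrite /F modulusM modulus_expi mul1r.
    by rewrite (addrC x).
  - apply: emeasurable_funM; first exact: (mkm _ _ _ cmeas_cplx).
    apply: measurable_superharmonic_comp; apply: cmeasD; first exact: cmeas_cplx.
    exact: cmeas_cst.
  - by move=> z; exact: mule_ge0.
rewrite -[leLHS](@mean_cst K) -(eq_mean intF) (mean_area mF F0).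
rewrite -ge0_integralZr//; last exact: (mkm _ _ _ cmeas_cplx).
apply: ge0_le_integral => //.
- by move=> p _; apply: mean_ge0 => t; exact: F0.
- exact: (measurable_mean mF F0).
- by apply: emeasurable_funM => //; exact: (mkm _ _ _ cmeas_cplx).
move=> p _; rewrite /F meanZe//; last first.
  apply: measurable_superharmonic_comp; apply: cmeasD; first exact: cmeas_cst.
  by apply: cmeasM; [exact: cmeas_expi|exact: cmeas_cst].
have [rp|pr] := leP rho (modulus (cplx p)); first by rewrite kout// !mul0e.
by rewrite lee_wpmul2l// mean_radius// (lt_le_trans _ xrho)// ltrD2l.
Qed.

End theory.

End superharmonic.

(** * Mass of the truncated kernel *)

Section limn_einf_theory.
Context {K : realType}.
Local Open Scope ereal_scope.

Lemma limn_einfD_ge (u v : (\bar K)^nat) : (forall n, 0 <= u n) -> (forall n, 0 <= v n) ->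
  limn_einf u + limn_einf v <= limn_einf (fun n => u n + v n).
Proof.
move=> u0 v0.
have einfs0 w n : (forall n, 0 <= w n) -> 0 <= @einfs K w n.
  by move=> w0; apply: le_ereal_inf_tmp => _ [m _ <-].
have lim0 w : (forall n, 0 <= w n) -> 0 <= limn (@einfs K w).
  move=> w0; apply: lime_ge; first exact: is_cvg_einfs.
  by apply: nearW => n; exact: einfs0.
rewrite !limn_einf_lim -limeD; [|exact: is_cvg_einfs|exact: is_cvg_einfs|]; last first.
  by rewrite ge0_adde_def// inE lim0.
apply: lee_lim; [|exact: is_cvg_einfs|].
  apply: is_cvgeD; [|exact: is_cvg_einfs|exact: is_cvg_einfs].
  by rewrite ge0_adde_def// inE lim0.
apply: nearW => n; apply: le_ereal_inf_tmp => _ [m /= nm <-].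
by apply: leeD; apply: ereal_inf_lbound; exists m.
Qed.

Lemma limn_einfZ_ge (a : K) (u : (\bar K)^nat) : (0 <= a)%R -> (forall n, 0 <= u n) ->
  a%:E * limn_einf u <= limn_einf (fun n => a%:E * u n).
Proof.
move=> a0 u0; rewrite !limn_einf_lim -limeMl//; last exact: is_cvg_einfs.
apply: lee_lim; [|exact: is_cvg_einfs|].
  by apply: is_cvgeMl => //; exact: is_cvg_einfs.
apply: nearW => n; apply: le_ereal_inf_tmp => _ [m /= nm <-].
by apply: lee_wpmul2l => //; apply: ereal_inf_lbound; exists m.
Qed.

Lemma measurable_limn_einf (d : measure_display) (T : measurableType d)
    (f : (T -> \bar K)^nat) : (forall n, measurable_fun [set: T] (f n)) ->
  measurable_fun [set: T] (fun x => limn_einf (f^~ x)).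
Proof.
move=> mf; under eq_fun do rewrite limn_einf_lim.
apply: (emeasurable_fun_cvg (fun n x => einfs (f^~ x) n)) => //.
  by move=> n; exact: measurable_fun_einfs.
by move=> x _; exact: is_cvg_einfs.
Qed.

Lemma limn_einf_sum_ge (I : Type) (s : seq I) (u : I -> (\bar K)^nat) :
  (forall i n, 0 <= u i n) ->
  \sum_(i <- s) limn_einf (u i) <= limn_einf (fun n => \sum_(i <- s) u i n).
Proof.
move=> u0; elim: s => [|i s IHs].
  rewrite big_nil; apply: limn_einf_ge; apply: nearW => n.
  by rewrite big_nil.
under [X in _ <= limn_einf X]eq_fun do rewrite big_cons.
rewrite big_cons; apply: le_trans (limn_einfD_ge _ _) => //; first exact: leeD2l.
by move=> n; exact: sume_ge0.
Qed.

End limn_einf_theory.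

Section kernel_mass.
Context {K : realType}.
Local Open Scope ereal_scope.
Local Notation mu := (@lebesgue_measure K).

Lemma area_box (c b : K) : (c <= b)%R ->
  \int[area K]_p (\1_(`[c, b] `*` `[c, b]) p)%:E = ((b - c) ^+ 2)%:E.
Proof.
move=> cb.
have mbox : measurable (`[c, b]%classic `*` `[c, b]%classic : set (K * K)).
  exact: measurableX.
rewrite integral_areaE; last 2 first.
- exact/measurable_EFinP/measurable_indic.
- by move=> p; rewrite lee_fin.
transitivity (\int[mu]_x ((\1_(`[c, b]%classic) x)%:E * (b - c)%:E)).
  apply: eq_integral => x _.
  have -> : (fun y => (\1_(`[c, b]%classic `*` `[c, b]%classic) (x, y))%:E) =
      (fun y => (\1_(`[c, b]%classic) x : K)%:E * (\1_(`[c, b]%classic) y : K)%:E).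
    by apply/funext => y; rewrite -EFinM !indicE in_setX/= -natrM mulnb.
  rewrite ge0_integralZl_EFin//.
    rewrite integral_indic//= setIT [mu _]lebesgue_measure_itv/= lte_fin.
    move: cb; rewrite le_eqVlt => /predU1P[->|->]; last by rewrite EFinB.
    by rewrite ltxx subrr.
  exact/measurable_EFinP/measurable_indic.
rewrite ge0_integralZr//; last by rewrite lee_fin subr_ge0.
  rewrite integral_indic//= setIT [mu _]lebesgue_measure_itv/= lte_fin.
  rewrite expr2 EFinM; move: cb; rewrite le_eqVlt => /predU1P[->|->].
    by rewrite ltxx subrr mul0e.
  by rewrite EFinB.
exact/measurable_EFinP/measurable_indic.
Qed.

Lemma measurable_box (c b : K) :
  measurable_fun [set: K * K] (fun p => (\1_(`[c, b] `*` `[c, b]) p : K)%:E).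
Proof. by apply/measurable_EFinP/measurable_indic; exact: measurableX. Qed.

Lemma modulus_lt_box (p : K * K) (t : K) : (modulus (cplx p) < t)%R ->
  (`[(- t)%R, t] `*` `[(- t)%R, t]) p.
Proof.
move=> pt; split => /=; rewrite in_itv/= -ler_norml.
  exact: le_trans (Re_le_modulus (cplx p)) (ltW pt).
exact: le_trans (Im_le_modulus (cplx p)) (ltW pt).
Qed.

Definition disc_fun (c t m : K) : \bar K := if (m < t)%R then c%:E else 0.

Lemma measurable_disc_fun c t : measurable_fun [set: K] (disc_fun c t).
Proof.
by apply: measurable_fun_if => //; exact: measurable_fun_ltr.
Qed.

Lemma integral_disc_lty (c t : K) : (0 <= c)%R ->
  \int[area K]_p disc_fun c t (modulus (cplx p)) < +oo.
Proof.
move=> c0; have [t0|t0] := leP t 0%R.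
  rewrite (eq_integral (fun=> 0)) ?integral0 ?ltry// => p _.
  by rewrite /disc_fun ltNge (le_trans t0)// modulus_ge0.
apply: (@le_lt_trans _ _ (\int[area K]_p (c%:E * (\1_(`[(- t)%R, t] `*` `[(- t)%R, t]) p)%:E))).
  apply: ge0_le_integral => //.
  - by move=> p _; rewrite /disc_fun; case: ifP.
  - apply: (measurableT_comp (measurable_disc_fun c t)).
    by apply: measurable_modulus; exact: cmeas_cplx.
  - by apply: emeasurable_funM => //; exact: measurable_box.
  move=> p _; rewrite /disc_fun; case: ifPn => [pt|_].
    by rewrite indicE mem_set ?mule1//; exact: modulus_lt_box.
  by rewrite mule_ge0// lee_fin.
rewrite ge0_integralZl_EFin//; last exact: measurable_box.
rewrite area_box ?ltry//; lra.
Qed.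

Definition log_mass (rho : K) : \bar K := \int[area K]_p logp rho (modulus (cplx p)).

Lemma log_massE rho : log_mass rho = \int[area K]_p logp rho (modulus (cplx p)).
Proof. by []. Qed.

Lemma log_mass_gt0 (rho : K) : (0 < rho)%R -> 0 < log_mass rho.
Proof.
move=> rho0.
apply: (@lt_le_trans _ _ (\int[area K]_p ((ln 2)%:E *
   (\1_(`[0%R, (rho / 4)%R] `*` `[0%R, (rho / 4)%R]) p)%:E))).
  have l2 : (0 < ln 2 :> K)%R by rewrite ln_gt0// ltr1n.
  rewrite ge0_integralZl_EFin//; last 2 first.
  - exact: measurable_box.
  - exact: ltW.
  rewrite area_box; last by rewrite divr_ge0// ltW.
  by rewrite -EFinM lte_fin mulr_gt0// subr0 exprn_gt0// divr_gt0.
apply: ge0_le_integral => //.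
- by move=> p _; rewrite mule_ge0// lee_fin// ln_ge0// ler1n.
- by apply: emeasurable_funM => //; exact: measurable_box.
- by apply: measurable_logp_modulus; exact: cmeas_cplx.
move=> p _; rewrite indicE; have [|pN] := boolP (p \in _); last by rewrite mule0 logp_ge0.
rewrite inE => -[/=]; rewrite !in_itv/= => /andP[p10 p1] /andP[p20 p2].
have pm : (modulus (cplx p) <= rho / 2)%R.
  apply: le_trans (modulus_le_ReIm _) _; rewrite /= !ger0_norm//; lra.
rewrite mule1; have [->|m0] := eqVneq (modulus (cplx p)) 0%R; first by rewrite logp_pole leey.
have {m0} m0 : (0 < modulus (cplx p))%R by rewrite lt_neqAle eq_sym m0 modulus_ge0.
rewrite logpE ?m0/=; last lra.
rewrite lee_fin ler_ln ?posrE ?divr_gt0//.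
by rewrite ler_pdivlMr// -ler_pdivlMl// mulrC.
Qed.

(** The kernel has finite mass although it has a pole: averaging its translates
    along a circle of radius [rho] does not change the mass, and by [mean_logp]
    the average is bounded. *)
Lemma log_mass_lty (rho : K) : (0 < rho)%R -> log_mass rho < +oo.
Proof.
move=> rho0.
have cm : cmeas (fun q : K * (K * K) => cplx q.2 + - (rho%:C%C * expi q.1))%R.
  apply: cmeasB.
    by split => /=; apply: measurableT_comp => //; exact: measurable_snd.
  by apply: cmeasM; [exact: cmeas_cst|apply: cmeas_expi; exact: measurable_fst].
have cm1 p : cmeas (fun t => cplx p - rho%:C%C * expi t)%R.
  apply: cmeasB; first exact: cmeas_cst.
  by apply: cmeasM; [exact: cmeas_cst|exact: cmeas_expi].
pose F t p := logp rho (modulus (cplx p + - (rho%:C%C * expi t))%R).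
have mF : measurable_fun [set: K * (K * K)] (fun q => F q.1 q.2).
  exact: measurable_logp_modulus.
have F0 t p : 0 <= F t p by exact: logp_ge0.
have intF t : \int[area K]_p F t p = log_mass rho.
  rewrite /F (@integral_area_cplx_translate K (- (rho%:C%C * expi t))%R
    (fun z => logp rho (modulus z)))//.
  - by apply: measurable_logp_modulus; exact: cmeas_cplx.
  - by move=> z; exact: logp_ge0.
rewrite -[ltLHS](@mean_cst K) -(eq_mean intF) mean_area//.
apply: (@le_lt_trans _ _ (\int[area K]_p disc_fun (ln 4) (2 * rho)%R (modulus (cplx p)))).
  apply: ge0_le_integral => //.
  - by move=> p _; exact: mean_ge0.
  - exact: measurable_mean.
  - apply: (measurableT_comp (measurable_disc_fun _ _)).
    by apply: measurable_modulus; exact: cmeas_cplx.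
  move=> p _; rewrite /disc_fun; case: ifPn => [p2|]; last first.
    rewrite -leNgt => p2; rewrite (@eq_mean _ _ (fun=> 0)) ?mean_cst// => t.
    rewrite /F logp_eq0// rho0/=; apply: le_trans (modulusBl _ _).
    rewrite modulusM modulus_real modulus_expi mulr1 gtr0_norm//; lra.
  have max0 : (0 < Num.max (modulus (cplx p)) (modulus (rho%:C%C : Cplx K)))%R.
    by rewrite lt_max modulus_real normr_gt0 gt_eqF// orbT.
  apply: (@le_trans _ _ (mean (fun t => logp (4 * rho) (modulus (cplx p - rho%:C%C * expi t))))).
    apply: le_mean.
    - exact: measurable_logp_modulus.
    - exact: measurable_logp_modulus.
    - by move=> t; exact: logp_ge0.
    move=> t; apply: logp_le => //; [exact: modulus_ge0|]; lra.
  rewrite mean_logp//; last first.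
    rewrite modulus_real gtr0_norm//; lra.
  rewrite lee_fin ler_ln ?posrE ?divr_gt0 ?mulr_gt0//.
  rewrite ler_pdivrMr// ler_pM2l// le_max modulus_real.
  by rewrite (gtr0_norm rho0) lexx orbT.
by apply: integral_disc_lty; rewrite ln_ge0// ler1n.
Qed.

End kernel_mass.

#[global] Opaque log_mass.

(** * Smoothing by the truncated kernel *)

Section smoothing.
Context {K : realType}.
Local Open Scope complex_scope.
Local Open Scope ereal_scope.

Lemma ge0_lt_between (a b : \bar K) : 0 <= a -> a < b ->
  exists r : K, a < r%:E /\ r%:E < b.
Proof.
case: a b => [a| |] [b| |]// a0 ab.
- exists ((a + b) / 2)%R; move: ab; rewrite !lte_fin => ab; split; lra.
- by exists (a + 1)%R; rewrite ltry lte_fin ltrDl.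
Qed.

Variable V : Cplx K -> \bar K.
Hypothesis Vsup : pos_superharmonic V.

Let V0 z : 0 <= V z. Proof. exact: superharmonic_ge0. Qed.

Definition smooth (rho : K) (x : Cplx K) : \bar K :=
  \int[area K]_p (logp rho (modulus (cplx p)) * V (cplx p + x)%R).

Lemma smooth_ge0 rho x : 0 <= smooth rho x.
Proof. by apply: integral_ge0 => p _; rewrite mule_ge0// logp_ge0. Qed.

Lemma measurable_smooth_comp rho (g : K -> Cplx K) : cmeas g ->
  measurable_fun [set: K] (fun t => smooth rho (g t)).
Proof.
move=> [g1 g2].
have c2 : cmeas (fun q : K * (K * K) => cplx q.2).
  by split => /=; apply: measurableT_comp => //; exact: measurable_snd.
have cg : cmeas (fun q : K * (K * K) => g q.1).
  by split => /=; [apply: (measurableT_comp g1)|apply: (measurableT_comp g2)]; exact: measurable_fst.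
apply: (measurable_area_integral (F := fun t p => logp rho (modulus (cplx p)) * V (cplx p + g t)%R)).
  apply: emeasurable_funM; first exact: measurable_logp_modulus.
  by apply: (measurable_superharmonic_comp Vsup); exact: cmeasD.
by move=> t p; rewrite mule_ge0// logp_ge0.
Qed.

(** This is where superharmonicity enters the smoothing. *)
Lemma smooth_le (rho : K) (x : Cplx K) : (0 < rho)%R -> (modulus x + rho <= 1)%R ->
  smooth rho x <= log_mass rho * V x.
Proof.
move=> rho0 xrho; apply: (radial_superharmonic Vsup) xrho.
- exact: measurable_logp.
- by move=> m; exact: logp_ge0.
- by move=> m rm; rewrite logp_eq0// rho0.
Qed.

Lemma smooth_ge (rho y : K) (x : Cplx K) : (0 < rho)%R -> (0 <= y)%R ->
  (forall w, (modulus (w - x) < rho)%R -> y%:E <= V w) ->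
  log_mass rho * y%:E <= smooth rho x.
Proof.
move=> rho0 y0 Vy.
have ml : measurable_fun [set: K * K] (fun p => logp rho (modulus (cplx p))).
  by apply: measurable_logp_modulus; exact: cmeas_cplx.
have l0 p : 0 <= logp rho (modulus (@cplx K p)) by exact: logp_ge0.
rewrite log_massE -ge0_integralZr//.
apply: ge0_le_integral => //.
- by move=> p _; rewrite mule_ge0// lee_fin.
- exact: emeasurable_funM.
- apply: emeasurable_funM => //; apply: (measurable_superharmonic_comp Vsup).
  by apply: cmeasD; [exact: cmeas_cplx|exact: cmeas_cst].
move=> p _; have [rp|pr] := leP rho (modulus (cplx p)).
  by rewrite logp_eq0 ?rho0// !mul0e.
by apply: lee_wpmul2l => //; apply: Vy; rewrite addrK.
Qed.

(** Lower semicontinuity bounds [V] from below on small discs, hence also its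
    averages there. *)
Lemma smooth_liminf (rho : K^nat) (x : Cplx K) : (forall n, (0 < rho n)%R) ->
  (forall e : K, (0 < e)%R -> \forall n \near \oo, (rho n < e)%R) -> (modulus x < 1)%R ->
  V x <= limn_einf (fun n => (fine (log_mass (rho n)))^-1%:E * smooth (rho n) x).
Proof.
move=> rho0 rho_small x1; rewrite leNgt; apply/negP => lt.
set u := fun n => _ in lt.
have c0 n : (0 < fine (log_mass (rho n)))%R.
  by rewrite fine_gt0// log_mass_gt0//= log_mass_lty.
have u0 n : 0 <= u n by rewrite mule_ge0 ?smooth_ge0// lee_fin invr_ge0 ltW.
have l0 : 0 <= limn_einf u by apply: limn_einf_ge; apply: nearW => n.
have [y [ly yV]] := ge0_lt_between l0 lt.
have y0 : (0 <= y)%R by rewrite -lee_fin ltW// (le_lt_trans l0).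
have [_ _ Vlsc _] := Vsup.
have [e e0 eV] := Vlsc _ _ x1 yV.
move: ly; apply/negP; rewrite -leNgt; apply: limn_einf_ge.
apply: filterS (rho_small e e0) => n rn.
have cE : log_mass (rho n) = (fine (log_mass (rho n)))%:E.
  by rewrite fineK// ge0_fin_numE ?log_mass_lty// ltW// log_mass_gt0.
rewrite /u muleC lee_pdivlMr// muleC -cE.
apply: smooth_ge => // w wx; apply/ltW/eV; exact: lt_trans rn.
Qed.

End smoothing.

(** * Comparison of means through potentials *)

Section comparison.
Context {K : realType}.
Local Open Scope complex_scope.
Local Open Scope ereal_scope.

Lemma lee_sub_compare (x y A B : \bar K) : x + B = y + A -> x <= y -> y < +oo -> 0 <= x ->
  A <= B.
Proof.
move=> e xy yoo x0; have y0 : 0 <= y by exact: le_trans xy.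
have yfin : y \is a fin_num by rewrite ge0_fin_numE.
by rewrite -(@leeD2lE _ y)// -e leeD2r.
Qed.

Section key.
Variable V : Cplx K -> \bar K.
Hypothesis Vsup : pos_superharmonic V.
Hypothesis V0_fin : V 0 < +oo.
Variables (I : finType) (a b : I -> K) (gam : I -> K -> Cplx K) (l : I -> Cplx K -> K).
Variables (psi : Cplx K -> K) (T C : K).
Hypothesis a0 : forall i, (0 <= a i)%R.
Hypothesis b0 : forall i, (0 <= b i)%R.
Hypothesis T1 : (0 < T < 1)%R.
Hypothesis mgam : forall i, cmeas (gam i).
Hypothesis gamT : forall i t, (modulus (gam i t) <= T)%R.
Hypothesis lE : forall i w, (modulus w <= 2)%R ->
  mean (fun t => logp 4 (modulus (w - gam i t))) = (l i w)%:E.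
Hypothesis psiE : forall w, (modulus w <= 2)%R ->
  (psi w + \sum_i a i * l i w = \sum_i b i * l i w)%R.
Hypothesis psi_bnd : forall w, (0 <= psi w <= C)%R.
Hypothesis psi_out : forall w, (T <= modulus w)%R -> psi w = 0%R.
Hypothesis mpsi : measurable_fun [set: K * K] (psi \o @cplx K).

Let V0 z : 0 <= V z. Proof. exact: superharmonic_ge0. Qed.

Let kap (rho : K) i w := mean (fun t => logp rho (modulus (w - gam i t))).

Let kap_ge0 rho i w : 0 <= kap rho i w.
Proof. by apply: mean_ge0 => t; exact: logp_ge0. Qed.

Let l_ge0 i w : (modulus w <= 2)%R -> (0 <= l i w)%R.
Proof. by move=> w2; rewrite -lee_fin -lE// mean_ge0// => t; exact: logp_ge0. Qed.

Let shift (rho : K) (w : Cplx K) (s : K) : Cplx K := (w - rho%:C * expi s)%R.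

Let cmeas_shift rho w : cmeas (shift rho w).
Proof.
apply: cmeasB; first exact: cmeas_cst.
by apply: cmeasM; [exact: cmeas_cst|exact: cmeas_expi].
Qed.

Let modulus_shift (rho : K) w s : (0 <= rho)%R -> (modulus (shift rho w s) <= modulus w + rho)%R.
Proof.
move=> r0; apply: le_trans (modulusD _ _) _.
by rewrite modulusN modulusM modulus_real modulus_expi mulr1 ger0_norm.
Qed.

Let measurable_l rho i w : (0 < rho <= 1)%R -> (modulus w < 1)%R ->
  measurable_fun [set: K] (fun s => (l i (shift rho w s))%:E).
Proof.
move=> /andP[r0 r1] w1.
rewrite (_ : (fun _ => _) = fun s => mean (fun t => logp 4 (modulus (shift rho w s - gam i t)))); last first.
  apply/funext => s; rewrite lE//.
  by apply: le_trans (modulus_shift _ _ (ltW r0)) _; lra.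
apply: (measurable_mean2 (F := fun s t => logp 4 (modulus (shift rho w s - gam i t)))).
  apply: measurable_logp_modulus; apply: cmeasB.
    have [m1 m2] := cmeas_shift rho w.
    by split; [apply: (measurableT_comp m1)|apply: (measurableT_comp m2)]; exact: measurable_fst.
  have [m1 m2] := mgam i.
  by split; [apply: (measurableT_comp m1)|apply: (measurableT_comp m2)]; exact: measurable_snd.
by move=> s t; exact: logp_ge0.
Qed.

(** The circle means of a logarithmic potential fall short of its value by the
    same potential of the truncated kernel. *)
Let l_split (rho : K) i w : (0 < rho <= 1)%R -> (modulus w < 1)%R ->
  mean (fun s => (l i (shift rho w s))%:E) + kap rho i w = (l i w)%:E.
Proof.
move=> /andP[r0 r1] w1; have /andP[T0 T1'] := T1.
have s2 s : (modulus (shift rho w s) <= 2)%R.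
  by apply: le_trans (modulus_shift _ _ (ltW r0)) _; lra.
have wg t : (modulus (w - gam i t) <= 2)%R.
  apply: le_trans (modulusD _ _) _; rewrite modulusN.
  by have := gamT i t; lra.
have cmg : cmeas (fun t => w - gam i t)%R by apply: cmeasB => //; exact: cmeas_cst.
pose g t := ln (4 / Num.max (modulus (w - gam i t)) rho).
have mx0 t : (0 < Num.max (modulus (w - gam i t)) rho)%R by rewrite lt_max r0 orbT.
have mg : measurable_fun [set: K] (fun t => (g t)%:E).
  apply/measurable_EFinP.
  apply: (measurableT_comp (measurable_ln (R:=K)) (g := fun t : K => 4 / Num.max (modulus (w - gam i t)) rho)%R).
  apply: measurable_funM => //; apply: (measurableT_comp (@measurable_invr K)).
  by apply: measurable_maxr => //; exact: measurable_modulus.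
have g0 t : 0 <= (g t)%:E.
  rewrite lee_fin ln_ge0// ler_pdivlMr// mul1r ge_max (le_trans (wg t)) ?ler_nat//=.
  by rewrite (le_trans r1)// ler1n.
have -> : mean (fun s => (l i (shift rho w s))%:E) = mean (fun t => (g t)%:E).
  rewrite (@eq_mean _ _ (fun s => mean (fun t => logp 4 (modulus (shift rho w s - gam i t))))); last first.
    by move=> s; rewrite lE.
  rewrite mean_mean; last 2 first.
  - apply: measurable_logp_modulus; apply: cmeasB.
      have [m1 m2] := cmeas_shift rho w.
      by split; [apply: (measurableT_comp m1)|apply: (measurableT_comp m2)]; exact: measurable_fst.
    have [m1 m2] := mgam i.
    by split; [apply: (measurableT_comp m1)|apply: (measurableT_comp m2)]; exact: measurable_snd.
  - by move=> s t; exact: logp_ge0.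
  apply: eq_mean => t.
  have rE : modulus (rho%:C : Cplx K) = rho by rewrite modulus_real gtr0_norm.
  rewrite (@eq_mean _ _ (fun s => logp 4 (modulus ((w - gam i t) - rho%:C * expi s)))).
    rewrite mean_logp rE//.
    by apply: le_trans (lerD (wg t) r1) _; lra.
  by move=> s; congr (logp _ (modulus _)); rewrite /shift addrAC.
rewrite -lE; last lra.
rewrite /kap -meanD//.
- apply: eq_mean => t; rewrite (@logp_split _ rho 4%R)//.
  + exact: modulus_ge0.
  + by apply: le_trans r1 _; rewrite ler1n.
  + by apply: le_trans (wg t) _; rewrite ler_nat.
- exact: measurable_logp_modulus.
- by move=> t; exact: logp_ge0.
Qed.

Let mean_psi rho w := mean (fun s => (psi (shift rho w s))%:E).

Let measurable_psi_comp (d : measure_display) (U : measurableType d) (f : U -> Cplx K) :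
  cmeas f -> measurable_fun [set: U] (fun x => (psi (f x))%:E).
Proof.
move=> mf; apply: (measurable_cplx_comp (F := fun z => (psi z)%:E)) mf.
exact/measurable_EFinP.
Qed.

Let psi_ge0 w : 0 <= (psi w)%:E. Proof. by rewrite lee_fin; have /andP[] := psi_bnd w. Qed.

Let meanZD (f : K -> \bar K) (c : I -> K) (g : I -> K -> \bar K) :
  measurable_fun [set: K] f -> (forall s, 0 <= f s) -> (forall i, 0 <= c i)%R ->
  (forall i, measurable_fun [set: K] (g i)) -> (forall i s, 0 <= g i s) ->
  mean (fun s => f s + \sum_i (c i)%:E * g i s) = mean f + \sum_i (c i)%:E * mean (g i).
Proof.
move=> mf f0 c0 mg g0.
have mcg i : measurable_fun [set: K] (fun s => (c i)%:E * g i s) by exact: emeasurable_funM.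
have cg0 i s : 0 <= (c i)%:E * g i s by rewrite mule_ge0// lee_fin.
rewrite meanD//.
- congr (_ + _); rewrite mean_sum//; apply: eq_bigr => i _; exact: meanZ.
- exact: emeasurable_sum.
- by move=> s; exact: sume_ge0.
Qed.

Let psi_split (rho : K) w : (0 < rho <= 1)%R -> (modulus w < 1)%R ->
  mean_psi rho w + \sum_i (b i)%:E * kap rho i w = (psi w)%:E + \sum_i (a i)%:E * kap rho i w.
Proof.
move=> rho01 w1; have /andP[r0 r1] := rho01.
have s2 s : (modulus (shift rho w s) <= 2)%R.
  by apply: le_trans (modulus_shift _ _ (ltW r0)) _; lra.
pose m i := mean (fun s => (l i (shift rho w s))%:E).
have m0 i : 0 <= m i by apply: mean_ge0 => s; rewrite lee_fin l_ge0.
have lw i : m i + kap rho i w = (l i w)%:E by exact: l_split.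
have mfin i : m i \is a fin_num.
  by rewrite ge0_fin_numE// (@le_lt_trans _ _ (l i w)%:E) ?ltry// -lw leeDl.
have kfin i : kap rho i w \is a fin_num.
  by rewrite ge0_fin_numE// (@le_lt_trans _ _ (l i w)%:E) ?ltry// -lw leeDr.
have ml i : measurable_fun [set: K] (fun s => (l i (shift rho w s))%:E) by exact: measurable_l.
have l0 i s : 0 <= (l i (shift rho w s))%:E by rewrite lee_fin l_ge0.
have e1 : mean_psi rho w + \sum_i (a i)%:E * m i = \sum_i (b i)%:E * m i.
  rewrite /m -meanZD//; last exact: measurable_psi_comp.
  rewrite -[RHS]add0e -[X in _ = X + _](mean_cst 0) -meanZD//.
  apply: eq_mean => s; rewrite add0e.
  under eq_bigr do rewrite -EFinM; under [in RHS]eq_bigr do rewrite -EFinM.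
  by rewrite !sumEFin -EFinD psiE.
have mpf : mean_psi rho w \is a fin_num.
  rewrite ge0_fin_numE; last exact: mean_ge0.
  apply: (@le_lt_trans _ _ C%:E); last exact: ltry.
  rewrite -[leRHS]mean_cst; apply: le_mean => //; first exact: measurable_psi_comp.
  by move=> s; rewrite lee_fin; have /andP[] := psi_bnd (shift rho w s).
have w2 : (modulus w <= 2)%R by lra.
have e2 := psiE w2.
move: e1 lw; rewrite -(fineK mpf).
have mE i : m i = (fine (m i))%:E by rewrite fineK.
have kE i : kap rho i w = (fine (kap rho i w))%:E by rewrite fineK.
under eq_bigr do rewrite mE -EFinM; under [in RHS]eq_bigr do rewrite mE -EFinM.
rewrite !sumEFin -EFinD => -[e1] lw.
under eq_bigr do rewrite kE -EFinM; under [in RHS]eq_bigr do rewrite kE -EFinM.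
rewrite !sumEFin -!EFinD; congr (_%:E).
have le i : l i w = (fine (m i) + fine (kap rho i w))%R.
  by have := lw i; rewrite mE kE -EFinD => -[<-].
move: e2; under eq_bigr do rewrite le mulrDr; under [in RHS]eq_bigr do rewrite le mulrDr.
by rewrite !big_split/= -e1; lra.
Qed.

Let cmeas_fst1 (g : K -> Cplx K) : cmeas g -> cmeas (fun q : K * (K * K) => g q.1).
Proof.
by move=> [g1 g2]; split; [apply: (measurableT_comp g1)|apply: (measurableT_comp g2)];
  exact: measurable_fst.
Qed.

Let cmeas_snd2 : cmeas (fun q : K * (K * K) => cplx q.2).
Proof. by split => /=; apply: measurableT_comp => //; exact: measurable_snd. Qed.

Let cmeas_circle (rho : K) : cmeas (fun s => rho%:C * expi s)%R.
Proof. by apply: cmeasM; [exact: cmeas_cst|exact: cmeas_expi]. Qed.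

Let mV : measurable_fun [set: K * K] (fun p => V (cplx p)).
Proof. exact: (measurable_superharmonic_comp Vsup (@cmeas_cplx K)). Qed.

Let mlogF rho i : measurable_fun [set: K * (K * K)]
  (fun q => logp rho (modulus (cplx q.2 - gam i q.1))).
Proof. by apply: measurable_logp_modulus; apply: cmeasB => //; exact: cmeas_fst1. Qed.

Let measurable_kap rho i : measurable_fun [set: K * K] (fun p => kap rho i (cplx p)).
Proof.
apply: (measurable_mean (F := fun t p => logp rho (modulus (cplx p - gam i t)))) => //.
by move=> t p; exact: logp_ge0.
Qed.

Let integral_kap rho i :
  \int[area K]_p (kap rho i (cplx p) * V (cplx p)) = mean (fun t => smooth V rho (gam i t)).
Proof.
pose F t p := V (cplx p) * logp rho (modulus (cplx p - gam i t)).
have F0 t p : 0 <= F t p by rewrite mule_ge0// logp_ge0.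
have mF : measurable_fun [set: K * (K * K)] (fun q => F q.1 q.2).
  apply: emeasurable_funM; last exact: mlogF.
  exact: (measurable_superharmonic_comp Vsup cmeas_snd2).
transitivity (\int[area K]_p mean (F^~ p)).
  apply: eq_integral => p _; rewrite muleC /F meanZe.
  - by [].
  - by apply: measurable_logp_modulus; apply: cmeasB => //; exact: cmeas_cst.
  - by move=> t; exact: logp_ge0.
  - exact: V0.
rewrite -(mean_area mF F0); apply: eq_mean => t.
rewrite -(@integral_area_cplx_translate K (gam i t)
  (fun z => V z * logp rho (modulus (z - gam i t))))//.
- by apply: eq_integral => p _; rewrite muleC addrK.
- apply: emeasurable_funM => //; apply: measurable_logp_modulus.
  by apply: cmeasB; [exact: cmeas_cplx|exact: cmeas_cst].
- by move=> z; rewrite mule_ge0// logp_ge0.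
Qed.

Let measurable_mean_psi rho : measurable_fun [set: K * K] (fun p => mean_psi rho (cplx p)).
Proof.
apply: (measurable_mean (F := fun s p => (psi (shift rho (cplx p) s))%:E)) => //.
apply: measurable_psi_comp; apply: cmeasB => //.
exact: (cmeas_fst1 (cmeas_circle rho)).
Qed.

Let Y := \int[area K]_p ((psi (cplx p))%:E * V (cplx p)).

Let Y_lty : Y < +oo.
Proof.
have /andP[T0 T1'] := T1.
have C0 : (0 <= C)%R by have /andP[h1 h2] := psi_bnd 0%R; exact: le_trans h2.
apply: (@le_lt_trans _ _ ((\int[area K]_p disc_fun C T (modulus (cplx p))) * V 0)).
  apply: le_trans (radial_superharmonic (rho := T) Vsup _ _ _ _).
  - apply: ge0_le_integral => //.
    + by move=> p _; exact: mule_ge0.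
    + apply: emeasurable_funM => //; exact: (measurable_psi_comp (@cmeas_cplx K)).
    + apply: emeasurable_funM.
        apply: (measurableT_comp (measurable_disc_fun C T)).
        by apply: measurable_modulus; exact: cmeas_cplx.
      apply: (measurable_superharmonic_comp Vsup).
      by apply: cmeasD; [exact: cmeas_cplx|exact: cmeas_cst].
    move=> p _; rewrite addr0 /disc_fun; case: ltP => pT; last first.
      by rewrite psi_out// !mul0e.
    by rewrite lee_wpmul2r// lee_fin; have /andP[] := psi_bnd (cplx p).
  - exact: measurable_disc_fun.
  - by move=> m; rewrite /disc_fun; case: ifP.
  - by move=> m Tm; rewrite /disc_fun ltNge Tm.
  - by rewrite modulus0 add0r ltW.
apply: lte_mul_pinfty => //.
  by apply: integral_ge0 => p _; rewrite /disc_fun; case: ifP.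
rewrite ge0_fin_numE; first exact: integral_disc_lty.
by apply: integral_ge0 => p _; rewrite /disc_fun; case: ifP.
Qed.

(** The circle average is self-adjoint for the area, so that it can be moved
    from [psi] to [V], where superharmonicity applies. *)
Let mean_psi_le (rho : K) : (0 < rho)%R -> (T + rho < 1)%R ->
  \int[area K]_p (mean_psi rho (cplx p) * V (cplx p)) <= Y.
Proof.
move=> rho0 Trho; have [_ _ _ Vmean] := Vsup.
pose F s p := V (cplx p) * (psi (shift rho (cplx p) s))%:E.
pose G s p := (psi (cplx p))%:E * V (cplx p + rho%:C * expi s)%R.
have F0 s p : 0 <= F s p by exact: mule_ge0.
have G0 s p : 0 <= G s p by exact: mule_ge0.
have cmc := cmeas_fst1 (cmeas_circle rho).
have mF : measurable_fun [set: K * (K * K)] (fun q => F q.1 q.2).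
  apply: emeasurable_funM; first exact: (measurable_superharmonic_comp Vsup cmeas_snd2).
  by apply: measurable_psi_comp; exact: cmeasB.
have mG : measurable_fun [set: K * (K * K)] (fun q => G q.1 q.2).
  apply: emeasurable_funM; first exact: measurable_psi_comp.
  by apply: (measurable_superharmonic_comp Vsup); exact: cmeasD.
have -> : \int[area K]_p (mean_psi rho (cplx p) * V (cplx p)) = \int[area K]_p mean (F^~ p).
  apply: eq_integral => p _; rewrite muleC /F meanZe.
  - by [].
  - exact: measurable_psi_comp.
  - by move=> s; exact: psi_ge0.
  - exact: V0.
rewrite -(mean_area mF F0).
have -> : mean (fun s => \int[area K]_p F s p) = mean (fun s => \int[area K]_p G s p).
  apply: eq_mean => s.
  rewrite -(@integral_area_cplx_translate K (rho%:C * expi s)%R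
    (fun z => V z * (psi (shift rho z s))%:E))//.
  - by apply: eq_integral => p _; rewrite /G muleC /shift addrK.
  - apply: emeasurable_funM => //; apply: measurable_psi_comp.
    by apply: cmeasB; [exact: cmeas_cplx|exact: cmeas_cst].
  - by move=> z; exact: mule_ge0.
rewrite (mean_area mG G0); apply: ge0_le_integral => //.
- by move=> p _; exact: mean_ge0.
- exact: measurable_mean.
- by apply: emeasurable_funM => //; exact: (measurable_psi_comp (@cmeas_cplx K)).
move=> p _; rewrite /G meanZe//; last first.
  by apply: (measurable_superharmonic_comp Vsup); apply: cmeasD => //; exact: cmeas_cst.
have [pT|Tp] := ltP (modulus (cplx p)) T; last by rewrite psi_out// !mul0e.
by apply: lee_wpmul2l => //; apply: Vmean => //; apply: lt_trans Trho; rewrite ltrD2r.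
Qed.

Let integral_splitting (f : K * K -> \bar K) (c : I -> K) (rho : K) :
  measurable_fun [set: K * K] f -> (forall p, 0 <= f p) -> (forall i, 0 <= c i)%R ->
  \int[area K]_p ((f p + \sum_i (c i)%:E * kap rho i (cplx p)) * V (cplx p)) =
  \int[area K]_p (f p * V (cplx p)) +
  \sum_i (c i)%:E * mean (fun t => smooth V rho (gam i t)).
Proof.
move=> mf f0 c0.
have ck0 i p : 0 <= (c i)%:E * kap rho i (cplx p) by rewrite mule_ge0// lee_fin.
have kV0 i p : 0 <= kap rho i (cplx p) * V (cplx p) by exact: mule_ge0.
have mkV i : measurable_fun [set: K * K] (fun p => kap rho i (cplx p) * V (cplx p)).
  exact: emeasurable_funM.
transitivity (\int[area K]_p (f p * V (cplx p) +
    \sum_i (c i)%:E * (kap rho i (cplx p) * V (cplx p)))).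
  apply: eq_integral => p _; rewrite ge0_muleDl//; last exact: sume_ge0.
  rewrite ge0_sume_distrl//; congr (_ + _).
  by apply: eq_bigr => i _; rewrite muleA.
rewrite ge0_integralD//.
- congr (_ + _); rewrite ge0_integral_sum//.
  + apply: eq_bigr => j _; rewrite ge0_integralZl_EFin//.
      by congr (_ * _); exact: integral_kap.
    exact: mkV.
  + by move=> j; exact: (emeasurable_funM (measurable_cst _) (mkV j)).
  + by move=> j p _; rewrite mule_ge0// lee_fin.
- by move=> p _; exact: mule_ge0.
- exact: emeasurable_funM.
- by move=> p _; apply: sume_ge0 => i _; rewrite mule_ge0// lee_fin.
- by apply: emeasurable_sum => i; exact: (emeasurable_funM (measurable_cst _) (mkV i)).
Qed.

Let smooth_compare (rho : K) : (0 < rho)%R -> (T + rho < 1)%R ->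
  \sum_i (a i)%:E * mean (fun t => smooth V rho (gam i t)) <=
  \sum_i (b i)%:E * mean (fun t => smooth V rho (gam i t)).
Proof.
move=> rho0 Trho; have /andP[T0 T1'] := T1.
have rho01 : (0 < rho <= 1)%R by rewrite rho0/=; lra.
apply: (lee_sub_compare _ (mean_psi_le rho0 Trho) Y_lty); last first.
  by apply: integral_ge0 => p _; rewrite mule_ge0//; exact: mean_ge0.
rewrite -integral_splitting//; last by move=> p; exact: mean_ge0.
rewrite -integral_splitting//; last first.
  exact: (measurable_psi_comp (@cmeas_cplx K)).
apply: eq_integral => p _.
have [p1|p1] := ltP (modulus (cplx p)) 1%R; first by rewrite psi_split.
by have [_ -> // _ _] := Vsup; rewrite !mule0.
Qed.

(** Comparison of means of a superharmonic function.  If the difference [psi]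
    of two superpositions of logarithmic potentials is nonnegative and has
    compact support in the disc, then the corresponding means are ordered: this
    is the positivity of the pairing of [psi] with the Riesz measure of [V],
    obtained without constructing that measure.  The circle average of [psi]
    differs from [psi] by averages of the truncated kernel; dividing these by
    the mass of the kernel and letting its radius tend to [0] gives the
    claim. *)
Lemma mean_compare :
  \sum_i (a i)%:E * mean (fun t => V (gam i t)) <=
  \sum_i (b i)%:E * mean (fun t => V (gam i t)).
Proof.
have /andP[T0 T1'] := T1.
pose rho n := ((1 - T) / 2 * n.+1%:R^-1)%R.
have e0 : (0 < (1 - T) / 2)%R by rewrite divr_gt0// subr_gt0.
have rho0 n : (0 < rho n)%R by rewrite mulr_gt0// invr_gt0.
have rho_le n : (rho n <= (1 - T) / 2)%R.
  by apply: ler_piMr; [exact: ltW|rewrite invf_le1// ler1n].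
have Trho n : (T + rho n < 1)%R by have := rho_le n; move: e0; lra.
have rho_small e : (0 < e)%R -> \forall n \near \oo, (rho n < e)%R.
  move=> ep; have ed : (0 < e / ((1 - T) / 2))%R by exact: divr_gt0.
  apply: filterS (near_infty_natSinv_lt (PosNum ed)) => n /=.
  by rewrite ltr_pdivlMr// /rho mulrC.
pose c n := fine (log_mass (rho n)).
have cE n : log_mass (rho n) = (c n)%:E.
  by rewrite fineK// ge0_fin_numE ?log_mass_lty// ltW// log_mass_gt0.
have c0 n : (0 < c n)%R by rewrite -lte_fin -cE log_mass_gt0.
have ci0 n : (0 <= (c n)^-1)%R by rewrite invr_ge0 ltW.
pose g i n t := (c n)^-1%:E * smooth V (rho n) (gam i t).
have ms i n : measurable_fun [set: K] (fun t => smooth V (rho n) (gam i t)).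
  exact: measurable_smooth_comp.
have g0 i n t : 0 <= g i n t by rewrite mule_ge0 ?lee_fin// smooth_ge0.
have mg i n : measurable_fun [set: K] (g i n) by exact: emeasurable_funM.
have mVg i : measurable_fun [set: K] (fun t => V (gam i t)).
  exact: (measurable_superharmonic_comp Vsup (mgam i)).
have gam1 i t : (modulus (gam i t) < 1)%R by exact: le_lt_trans (gamT i t) T1'.
pose B := \sum_i (b i)%:E * mean (fun t => V (gam i t)).
have zero (f : I -> K) (h : I -> K -> \bar K) : (forall i, 0 <= f i)%R ->
    (forall i, measurable_fun [set: K] (h i)) -> (forall i t, 0 <= h i t) ->
    mean (fun t => \sum_i (f i)%:E * h i t) = \sum_i (f i)%:E * mean (h i).
  move=> f0 mh h0; rewrite mean_sum.
  - by apply: eq_bigr => i _; exact: meanZ.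
  - by move=> i; exact: emeasurable_funM.
  - by move=> i t; rewrite mule_ge0// lee_fin.
have step n : mean (fun t => \sum_i (a i)%:E * g i n t) <= B.
  rewrite zero//.
  have gE i : mean (g i n) = (c n)^-1%:E * mean (fun t => smooth V (rho n) (gam i t)).
    by rewrite /g meanZ// => t; exact: smooth_ge0.
  under eq_bigr do rewrite gE muleCA.
  rewrite -ge0_sume_distrr; last first.
    by move=> i _; rewrite mule_ge0 ?lee_fin//; apply: mean_ge0 => t; exact: smooth_ge0.
  rewrite muleC lee_pdivrMr//.
  apply: le_trans (smooth_compare (rho0 n) (Trho n)) _.
  rewrite /B ge0_sume_distrl; last first.
    by move=> i _; rewrite mule_ge0 ?lee_fin//; exact: mean_ge0.
  apply: lee_sum => i _; rewrite -muleA; apply: lee_wpmul2l; first by rewrite lee_fin.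
  rewrite muleC -(meanZ (mVg i) (fun t => V0 (gam i t)) (ltW (c0 n))); apply: le_mean => //.
  - exact: emeasurable_funM.
  - by move=> t; exact: smooth_ge0.
  move=> t; rewrite -cE; apply: smooth_le => //.
  apply: le_trans (ltW (Trho n)); by rewrite lerD2r.
rewrite -zero//.
apply: (@le_trans _ _ (limn_einf (fun n => mean (fun t => \sum_i (a i)%:E * g i n t)))); last first.
  by apply: limn_einf_le => n; exists n; [exact: leqnn|exact: step].
apply: le_trans (mean_fatou _ _); last 2 first.
- move=> n; apply: emeasurable_sum => i; exact: emeasurable_funM.
- by move=> n t; apply: sume_ge0 => i _; rewrite mule_ge0// lee_fin.
apply: le_mean.
- by apply: emeasurable_sum => i; exact: emeasurable_funM.
- apply: measurable_limn_einf => n.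
  by apply: emeasurable_sum => i; exact: emeasurable_funM.
- by move=> t; apply: sume_ge0 => i _; rewrite mule_ge0// lee_fin.
move=> t; apply: le_trans (limn_einf_sum_ge _ _); last first.
  by move=> i n; rewrite mule_ge0// lee_fin.
apply: lee_sum => i _; apply: le_trans (limn_einfZ_ge _ _) => //.
apply: lee_wpmul2l; first by rewrite lee_fin.
exact: smooth_liminf.
Qed.

End key.
End comparison.

(** * Automorphic images of circles and their potentials *)

Section moebius.
Context {K : realType}.
Local Open Scope complex_scope.
Variable R : K.
Hypothesis R0 : 0 < R.
Implicit Types (z w : Cplx K) (tau t : K).

(** The image of the circle of radius [tau] under the automorphism of the disc
    of radius [R] that carries its centre to [z]; for [tau = 1] its uniform
    parameter carries the Poisson measure of [z]. *)
Definition mob z tau t : Cplx K :=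
  R%:C * (R%:C * tau%:C * expi t + z) / (R%:C + z^*%C * tau%:C * expi t).

(** [R] times the pseudo-hyperbolic distance from [z] to [w] is
    [modulus (w - z)] divided by this quantity. *)
Definition codist z w : K := modulus ((R ^+ 2)%:C - z^*%C * w) / R.

(** By [mean_pot], a logarithmic potential of the curve [mob R z tau]. *)
Definition pot z tau w : K := ln (Num.max (modulus (w - z)) (tau * codist z w)).

Definition W (V : Cplx K -> \bar K) z tau : \bar K := mean (fun t => V (mob z tau t)).

Lemma modR : modulus (R%:C : Cplx K) = R.
Proof. by rewrite modulus_real gtr0_norm. Qed.

Lemma mob_den_neq0 z tau t : 0 <= tau -> modulus z * tau < R ->
  R%:C + z^*%C * tau%:C * expi t != 0 :> Cplx K.
Proof.
move=> t0 zt; apply/eqP => e0.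
have : modulus (R%:C : Cplx K) = modulus (- (z^*%C * tau%:C * expi t)).
  by congr modulus; apply/eqP; rewrite -addr_eq0; apply/eqP.
rewrite modR modulusN !modulusM modulus_expi modulus_conj modulus_real mulr1 ger0_norm// => Re.
by move: zt; rewrite -Re ltxx.
Qed.

Lemma mob_sub z tau t w : 0 <= tau -> modulus z * tau < R ->
  w - mob z tau t = (R%:C * (w - z) - tau%:C * ((R ^+ 2)%:C - z^*%C * w) * expi t) /
    (R%:C + z^*%C * tau%:C * expi t).
Proof.
move=> t0 zt; have D0 := mob_den_neq0 t t0 zt.
rewrite /mob -[X in X - _](mulfK D0) -mulrBl; congr (_ / _).
by rewrite rmorphXn/=; ring.
Qed.

Lemma cmeas_mob z tau : cmeas (mob z tau).
Proof.
have ce : cmeas (@expi K) by exact: cmeas_expi.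
have cc (x : Cplx K) : cmeas (fun _ : K => x) by exact: cmeas_cst.
apply: cmeasM.
  by apply: cmeasM => //; apply: cmeasD => //; exact: cmeasM.
by apply: cmeasV; apply: cmeasD => //; exact: cmeasM.
Qed.

Lemma modulus_mob z tau t : modulus z < R -> 0 <= tau <= 1 -> modulus (mob z tau t) <= R.
Proof.
move=> zR /andP[t0 t1].
have zt : modulus z * tau < R.
  by apply: le_lt_trans zR; rewrite ler_piMr// modulus_ge0.
have D0 := mob_den_neq0 t t0 zt.
rewrite /mob !modulusM modR modulusV -mulrA; apply: ler_piMr; first exact: ltW.
rewrite ler_pdivrMr ?modulus_gt0// mul1r.
rewrite -(@ler_pXn2r _ 2)// ?nnegrE ?modulus_ge0//.
rewrite !sqr_modulus; have cs := cos2Dsin2 t.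
case: z zR {zt D0} => x y zR /=.
have zR2 : x ^+ 2 + y ^+ 2 <= R ^+ 2.
  by have := sqr_modulus (x +i* y : Cplx K) => /= <-; rewrite ler_pXn2r ?nnegrE ?modulus_ge0 ?ltW.
rewrite -[expi t]cplxE Re_expi Im_expi /cplx /=; simpc => /=.
have t2 : tau ^+ 2 <= 1 by rewrite expr_le1.
rewrite -subr_ge0.
suff -> : (R + (x * tau * cos t + y * tau * sin t)) ^+ 2 +
  (x * tau * sin t - y * tau * cos t) ^+ 2 -
  ((R * tau * cos t + x) ^+ 2 + (R * tau * sin t + y) ^+ 2) =
  (R ^+ 2 - (x ^+ 2 + y ^+ 2)) * (1 - tau ^+ 2).
  by rewrite mulr_ge0// subr_ge0.
transitivity (R ^+ 2 + tau ^+ 2 * (x ^+ 2 + y ^+ 2) * (cos t ^+ 2 + sin t ^+ 2)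
  - R ^+ 2 * tau ^+ 2 * (cos t ^+ 2 + sin t ^+ 2) - (x ^+ 2 + y ^+ 2)); first by ring.
by rewrite cs; ring.
Qed.

Lemma mob0 tau t : mob 0 tau t = (R * tau)%:C * expi t.
Proof.
rewrite /mob rmorph0 !mul0r addr0 addr0 rmorphM/= mulrAC mulfV ?mul1r//.
by rewrite -modulus_eq0 modR gt_eqF.
Qed.

Lemma codist_gt0 z w : modulus z < R -> modulus (w - z) = 0 -> 0 < codist z w.
Proof.
move=> zR /eqP; rewrite modulus_eq0 subr_eq0 => /eqP ->.
rewrite divr_gt0// modulus_gt0 subr_eq0; apply/eqP => e.
have : modulus ((R ^+ 2)%:C : Cplx K) = modulus (z^*%C * z) by rewrite e.
rewrite modulus_real modulusM modulus_conj ger0_norm ?sqr_ge0// -expr2 => /eqP.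
by rewrite eqrXn2 ?modulus_ge0 ?ltW// => /eqP Rz; move: zR; rewrite -Rz ltxx.
Qed.

Lemma pot_arg_gt0 z tau w : modulus z < R -> 0 < tau ->
  0 < Num.max (modulus (w - z)) (tau * codist z w).
Proof.
move=> zR t0; rewrite lt_max.
have [/codist_gt0 c0|m0] := eqVneq (modulus (w - z)) 0.
  by rewrite orbC mulr_gt0// c0.
by rewrite lt_neqAle eq_sym m0 modulus_ge0.
Qed.

Local Open Scope ereal_scope.

(** The distance from [w] to [mob z tau t] is a quotient of two moduli of affine
    functions of [expi t], so [mean_logp] gives both means. *)
Lemma mean_pot z tau w : (modulus z < R)%R -> (0 < tau)%R -> (modulus z * tau < R)%R ->
  (forall t, modulus (w - mob z tau t) <= 4)%R ->
  mean (fun t => logp 4 (modulus (w - mob z tau t))) = (ln 4 - pot z tau w)%:E.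
Proof.
move=> zR t0 zt w4.
pose a : Cplx K := (R%:C * (w - z))%R.
pose b : Cplx K := (tau%:C * ((R ^+ 2)%:C - z^*%C * w))%R.
pose d : Cplx K := (- (z^*%C * tau%:C))%R.
have md : (modulus d = modulus z * tau)%R.
  by rewrite modulusN modulusM modulus_conj modulus_real gtr0_norm.
have maxE : (Num.max (modulus a) (modulus b) = R * Num.max (modulus (w - z)) (tau * codist z w))%R.
  rewrite maxr_pMr ?ltW// /a /b !modulusM modR modulus_real gtr0_norm//.
  by congr (Num.max _ _); rewrite /codist; field; rewrite gt_eqF.
have max0 := pot_arg_gt0 w zR t0.
have maxd : (Num.max (modulus (R%:C : Cplx K)) (modulus d) = R)%R.
  by rewrite modR md; apply/max_idPl/ltW.
pose C2 := (R + modulus d + (modulus a + modulus b))%R.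
have C20 : (0 < C2)%R by rewrite ltr_wpDr ?addr_ge0 ?modulus_ge0// ltr_wpDr ?modulus_ge0.
have E1 : mean (fun t => logp C2 (modulus (R%:C - d * expi t))) = (ln (C2 / R))%:E.
  rewrite mean_logp ?maxd//.
  by rewrite modR lerDl addr_ge0// modulus_ge0.
have E2 : mean (fun t => logp (4 * C2) (modulus (a - b * expi t))) =
    (ln (4 * C2 / (R * Num.max (modulus (w - z)) (tau * codist z w))))%:E.
  rewrite mean_logp ?maxE ?mulr_gt0//.
  apply: (@le_trans _ _ C2); first by rewrite lerDr addr_ge0 ?modulus_ge0 ?ltW.
  by rewrite ler_peMl ?ltW// ltr1n.
have cmd : cmeas (fun t => R%:C - d * expi t)%R.
  apply: cmeasB; first exact: cmeas_cst.
  by apply: cmeasM; [exact: cmeas_cst|exact: cmeas_expi].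
have : mean (fun t => logp 4 (modulus (w - mob z tau t))) + (ln (C2 / R))%:E =
    (ln (4 * C2 / (R * Num.max (modulus (w - z)) (tau * codist z w))))%:E.
  rewrite -E1 -E2 -meanD.
  - apply: eq_mean => t.
    have dE : (R%:C - d * expi t = R%:C + z^*%C * tau%:C * expi t)%R.
      by rewrite /d mulNr opprK.
    have D0 := mob_den_neq0 t (ltW t0) zt.
    have -> : (a - b * expi t = (w - mob z tau t) * (R%:C - d * expi t))%R.
      by rewrite mob_sub ?ltW// dE divfK.
    rewrite modulusM logp_mul ?modulus_ge0// dE modulus_gt0 D0/= -dE.
    apply: le_trans (modulusD _ _) _; rewrite modulusN modulusM modulus_expi modR mulr1.
    by rewrite lerDl addr_ge0 ?modulus_ge0.
  - by apply: measurable_logp_modulus; apply: cmeasB; [exact: cmeas_cst|exact: cmeas_mob].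
  - exact: measurable_logp_modulus.
  - by move=> t; exact: logp_ge0.
  - by move=> t; exact: logp_ge0.
set m := mean _ => mE.
have mfin : m \is a fin_num.
  have m0 : 0 <= m by apply: mean_ge0 => t; exact: logp_ge0.
  rewrite ge0_fin_numE// ltNge leye_eq; apply/eqP => my.
  by move: mE; rewrite my.
move: mE; rewrite -(fineK mfin) -EFinD => -[mE]; congr (_%:E).
have -> : fine m = (ln (4 * C2 / (R * Num.max (modulus (w - z)) (tau * codist z w))) - ln (C2 / R))%R.
  by rewrite -mE addrK.
rewrite /pot -!ln_div ?posrE ?divr_gt0 ?mulr_gt0//.
congr ln; field.
by rewrite !gt_eqF.
Qed.

End moebius.

(** * Families of curves with bounded overlap *)

Section potential_differences.
Context {K : realType}.
Local Open Scope complex_scope.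
Variable R : K.
Hypothesis R0 : 0 < R.
Implicit Types (z w : Cplx K) (tau : K).

Lemma codist_ge0 z w : 0 <= codist R z w.
Proof. by rewrite divr_ge0 ?modulus_ge0 ?ltW. Qed.

Lemma le_pot z w tau tau' : modulus z < R -> 0 < tau' -> tau' <= tau ->
  pot R z tau' w <= pot R z tau w.
Proof.
move=> zR t0 tt; have t0' := lt_le_trans t0 tt.
rewrite ler_ln ?posrE ?pot_arg_gt0// ge_max !le_max lexx/=.
by rewrite ler_wpM2r ?codist_ge0// orbT.
Qed.

Lemma pot_sub_le z w tau tau' : modulus z < R -> 0 < tau' -> tau' <= tau ->
  pot R z tau w - pot R z tau' w <= ln (tau / tau').
Proof.
move=> zR t0 tt; have t0' := lt_le_trans t0 tt.
have p1 := pot_arg_gt0 R0 w zR t0; have p2 := pot_arg_gt0 R0 w zR t0'.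
rewrite -ln_div ?posrE// ler_ln ?posrE ?divr_gt0//.
have tt0 : 0 <= tau / tau' by rewrite divr_ge0// ltW.
rewrite ler_pdivrMr// maxr_pMr// ge_max !le_max.
rewrite mulrA divfK ?gt_eqF// lexx orbT andbT.
by rewrite ler_peMl ?modulus_ge0// ler_pdivlMr// mul1r.
Qed.

Lemma sqr_codist z w : (R * codist R z w) ^+ 2 =
  R ^+ 2 * modulus (w - z) ^+ 2 - (R ^+ 2 - modulus z ^+ 2) * (modulus w ^+ 2 - R ^+ 2).
Proof.
rewrite /codist mulrC divfK ?gt_eqF// !sqr_modulus.
by case: z => a b; case: w => c d /=; simpc => /=; ring.
Qed.

Lemma codist_le_out z w : modulus z < R -> R <= modulus w -> codist R z w <= modulus (w - z).
Proof.
move=> zR Rw.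
have h : (R * codist R z w) ^+ 2 <= (R * modulus (w - z)) ^+ 2.
  rewrite sqr_codist exprMn lerBlDr lerDl mulr_ge0// subr_ge0.
    by rewrite ler_pXn2r ?nnegrE ?modulus_ge0 ?ltW.
  by rewrite ler_pXn2r ?nnegrE ?modulus_ge0 ?(ltW R0).
have p1 : 0 <= R * codist R z w by rewrite mulr_ge0 ?codist_ge0 ?ltW.
have p2 : 0 <= R * modulus (w - z) by rewrite mulr_ge0 ?modulus_ge0 ?ltW.
by move: h; rewrite ler_pXn2r// ler_pM2l.
Qed.

Lemma codist_le_in z w : modulus z < R -> modulus w <= R -> codist R z w <= 2 * R.
Proof.
move=> zR wR; rewrite ler_pdivrMr//; apply: le_trans (modulusD _ _) _.
rewrite modulusN modulusM modulus_conj modulus_real ger0_norm ?sqr_ge0//.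
have : modulus z * modulus w <= R * R by apply: ler_pM; rewrite ?modulus_ge0// ltW.
by rewrite expr2; lra.
Qed.

(** The difference of the potentials of two concentric pseudo-hyperbolic
    circles vanishes outside the disc of radius [R] and outside a Euclidean disc
    about their centre. *)
Lemma pot_sub_eq0 z w tau tau' : modulus z < R -> 0 < tau' -> tau' <= tau -> tau <= 1 ->
  (R <= modulus w) || (2 * R * tau <= modulus (w - z)) ->
  pot R z tau w = pot R z tau' w.
Proof.
move=> zR t0 tt t1 out; have t0' := lt_le_trans t0 tt.
suff h : tau * codist R z w <= modulus (w - z).
  rewrite /pot (max_idPl h) (max_idPl _)// (le_trans _ h)//.
  by rewrite ler_wpM2r ?codist_ge0.
have [Rw|wR] := leP R (modulus w).
  by rewrite (le_trans _ (codist_le_out zR Rw))// ler_piMl// codist_ge0.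
move: out; rewrite leNgt wR/=; apply: le_trans.
rewrite mulrC; apply: ler_wpM2r; first exact: ltW.
by apply: codist_le_in => //; exact: ltW.
Qed.

Lemma pot0 tau w : pot R 0 tau w = ln (Num.max (modulus w) (R * tau)).
Proof.
rewrite /pot subr0 /codist rmorph0 mul0r subr0 modulus_real ger0_norm ?sqr_ge0//.
by congr (ln (Num.max _ _)); field; rewrite gt_eqF.
Qed.

Lemma measurable_pot z tau : measurable_fun [set: K * K] (fun p => pot R z tau (cplx p)).
Proof.
have cmc := @cmeas_cplx K.
have cc (x : Cplx K) : cmeas (fun _ : K * K => x) by exact: cmeas_cst.
apply: (measurableT_comp (measurable_ln (R := K))
  (g := fun p => Num.max (modulus (cplx p - z)) (tau * codist R z (cplx p)))).
apply: measurable_maxr; first by apply: measurable_modulus; exact: cmeasB.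
apply: measurable_funM => //; apply: measurable_funM => //.
apply: measurable_modulus; apply: cmeasB => //.
exact: cmeasM.
Qed.

End potential_differences.

Lemma big_option (U : Type) (idx : U) (op : Monoid.com_law idx) (J : finType)
    (f : option J -> U) :
  \big[op/idx]_o f o = op (f None) (\big[op/idx]_j f (Some j)).
Proof.
rewrite (bigD1 None)//=; congr (op _ _).
rewrite (reindex_omap Some id) => [|[]//].
by apply: eq_bigl => j; rewrite /= eqxx.
Qed.

Section family.
Context {K : realType}.
Local Open Scope complex_scope.
Local Open Scope ereal_scope.
Variables (V : Cplx K -> \bar K) (R T : K).
Hypothesis Vsup : pos_superharmonic V.
Hypothesis V0_fin : V 0 < +oo.
Hypothesis RT : (0 < R < T)%R.
Hypothesis T1 : (T < 1)%R.

Let R0 : (0 < R)%R. Proof. by case/andP: RT. Qed.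
Let L := ln (T / R)%R.
Let L0 : (0 < L)%R.
Proof. by have /andP[_ RT'] := RT; rewrite ln_gt0// ltr_pdivlMr// mul1r. Qed.

Lemma W_ge0 z tau : 0 <= W R V z tau.
Proof. by apply: mean_ge0 => t; exact: superharmonic_ge0. Qed.

Lemma W_center_le : W R V 0 1 <= V 0.
Proof.
have [_ _ _ Vmean] := Vsup; have /andP[_ RT'] := RT.
rewrite /W (@eq_mean _ _ (fun t => V (0 + R%:C * expi t)%R)).
  by apply: Vmean => //; rewrite modulus0 add0r (lt_trans RT').
by move=> t; rewrite mob0// mulr1 add0r.
Qed.

(** If the Euclidean discs carrying the potential differences have overlap at
    most [m], then a multiple of the difference of potentials of the circles
    of radii [R] and [T] about [0] dominates the sum of these differences. *)
Lemma family_bound (n : nat) (m : K) (z : 'I_n -> Cplx K) (t1 t2 : 'I_n -> K) :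
  (0 <= m)%R ->
  (forall j, modulus (z j) < R)%R -> (forall j, 0 < t1 j < t2 j)%R -> (forall j, t2 j <= 1)%R ->
  (forall w, \sum_(j < n) (modulus (w - z j) < 2 * R * t2 j)%R%:R <= m)%R ->
  \sum_(j < n) (ln (t2 j / t1 j))^-1%:E * W R V (z j) (t1 j) <=
  \sum_(j < n) (ln (t2 j / t1 j))^-1%:E * W R V (z j) (t2 j) + (m / L)%:E * V 0.
Proof.
move=> m0 zR t12 t21 overlap; have /andP[_ RT'] := RT; have T0 : (0 < T)%R by exact: lt_trans RT'.
have t1p j : (0 < t1 j)%R by have /andP[] := t12 j.
have t2p j : (0 < t2 j)%R by have /andP[h1 h2] := t12 j; exact: lt_trans h2.
have t12' j : (t1 j <= t2 j)%R by have /andP[_ /ltW] := t12 j.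
pose beta j := ((ln (t2 j / t1 j))^-1)%R.
have beta0 j : (0 <= beta j)%R.
  by rewrite invr_ge0 ln_ge0// ler_pdivlMr// mul1r.
have lnp j : (0 < ln (t2 j / t1 j))%R.
  by rewrite ln_gt0// ltr_pdivlMr// mul1r; have /andP[] := t12 j.
have mL0 : (0 <= m / L)%R by rewrite divr_ge0// ltW.
(* [true] marks the outer curve of a pair and [false] the inner one; [None]
   is the pair of circles of radii [T] and [R] about [0], on which the roles of
   the outer and the inner curve are exchanged. *)
pose I := (bool * option 'I_n)%type.
pose zi (i : I) : Cplx K := if i.2 is Some j then z j else 0%R.
pose ti (i : I) : K := if i.2 is Some j then (if i.1 then t2 j else t1 j)
  else (if i.1 then 1 else T / R)%R.
pose a (i : I) : K := if i.1 then 0%R else if i.2 is Some j then beta j else (m / L)%R.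
pose b (i : I) : K := if i.1 then (if i.2 is Some j then beta j else (m / L)%R) else 0%R.
have zi_lt i : (modulus (zi i) < R)%R by rewrite /zi; case: i => -[] [j|] //=; rewrite modulus0.
have ti_gt0 i : (0 < ti i)%R by rewrite /ti; case: i => -[] [j|] //=; rewrite divr_gt0.
have ziti i : (modulus (zi i) * ti i < R)%R.
  case: i => c [j|]; rewrite /zi/=; last by rewrite modulus0 mul0r.
  apply: le_lt_trans (zR j); rewrite ler_piMr ?modulus_ge0// /ti/=.
  by case: c => //; exact: le_trans (t12' j) (t21 j).
have mobT i t : (modulus (mob R (zi i) (ti i) t) <= T)%R.
  have tle1 c j : (0 <= ti (c, Some j) <= 1)%R.
    rewrite ltW ?ti_gt0//= /ti/=.
    by case: c => //; exact: le_trans (t12' j) (t21 j).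
  case: i => c [j|].
    by apply: le_trans (ltW RT'); apply: modulus_mob => //; exact: zR.
  rewrite /zi/= mob0// modulusM modulus_expi mulr1 modulus_real ger0_norm; last first.
    by rewrite mulr_ge0 ?ltW// ti_gt0.
  case: c; rewrite /ti/=; first by rewrite mulr1 ltW.
  by rewrite mulrCA divff ?mulr1// gt_eqF.
pose l i w := (ln 4 - pot R (zi i) (ti i) w)%R.
pose psi w := ((m / L) * (pot R 0 (T / R)%R w - pot R 0 1 w) -
  \sum_(j < n) beta j * (pot R (z j) (t2 j) w - pot R (z j) (t1 j) w))%R.
have sumI (f : I -> K) : (\sum_i f i = f (false, None) + \sum_(j < n) f (false, Some j) +
    (f (true, None) + \sum_(j < n) f (true, Some j)))%R.
  transitivity (\sum_p f (p.1, p.2))%R; first by apply: eq_bigr => -[].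
  rewrite -(pair_bigA _ (fun c o => f (c, o)))/= big_bool/= addrC.
  by congr (_ + _)%R; rewrite big_option.
have sumIe (f : I -> \bar K) : \sum_i f i = f (false, None) + \sum_(j < n) f (false, Some j) +
    (f (true, None) + \sum_(j < n) f (true, Some j)).
  transitivity (\sum_p f (p.1, p.2)); first by apply: eq_bigr => -[].
  rewrite -(pair_bigA _ (fun c o => f (c, o)))/= big_bool/= addeC.
  by congr (_ + _); rewrite big_option.
have L_in w : (modulus w <= R)%R -> (pot R 0 (T / R)%R w - pot R 0 1 w = L)%R.
  move=> wR; rewrite !pot0// mulr1 mulrCA divff ?gt_eqF// mulr1.
  rewrite (max_idPr wR) (max_idPr (le_trans wR (ltW RT'))).
  by rewrite -ln_div ?posrE.
have L_ge w : (0 <= pot R 0 (T / R)%R w - pot R 0 1 w <= L)%R.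
  rewrite subr_ge0 le_pot//= ?modulus0//; last by rewrite ler_pdivlMr// mul1r ltW.
  apply: le_trans (pot_sub_le _ _ _ _ _) _; rewrite ?modulus0//.
    by rewrite ler_pdivlMr// mul1r ltW.
  by rewrite divr1.
have d_ge0 j w : (0 <= pot R (z j) (t2 j) w - pot R (z j) (t1 j) w)%R.
  by rewrite subr_ge0 le_pot.
have sum_le w : (modulus w < R)%R ->
    (\sum_(j < n) beta j * (pot R (z j) (t2 j) w - pot R (z j) (t1 j) w) <= m)%R.
  move=> wR; apply: le_trans (overlap w); apply: ler_sum => j _.
  have [h|h] := ltP (modulus (w - z j)) (2 * R * t2 j)%R.
    by rewrite mulrC ler_pdivrMr// mul1r pot_sub_le.
  by rewrite (pot_sub_eq0 R0 (zR j) (t1p j) (t12' j) (t21 j)) ?h ?orbT// subrr mulr0.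
have sum_out w : (R <= modulus w)%R ->
    (\sum_(j < n) beta j * (pot R (z j) (t2 j) w - pot R (z j) (t1 j) w) = 0)%R.
  move=> wR; rewrite big1// => j _.
  by rewrite (pot_sub_eq0 R0 (zR j) (t1p j) (t12' j) (t21 j)) ?wR// subrr mulr0.
have psi_bnd w : (0 <= psi w <= m)%R.
  have /andP[h1 h2] := L_ge w.
  have e : (m = m / L * L)%R by rewrite divfK// gt_eqF.
  apply/andP; split.
    rewrite subr_ge0; have [wR|Rw] := ltP (modulus w) R; last first.
      by rewrite sum_out// mulr_ge0.
    by rewrite (L_in _ (ltW wR)) -e sum_le.
  rewrite lerBlDr [leRHS]addrC; apply: (@le_trans _ _ m).
    by rewrite [leRHS]e ler_wpM2l.
  by rewrite lerDr sumr_ge0// => j _; rewrite mulr_ge0.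
have := @mean_compare K V Vsup V0_fin I a b (fun i => mob R (zi i) (ti i)) l psi T m.
have a0 i : (0 <= a i)%R by rewrite /a; case: i => -[] [j|] //=.
have b0 i : (0 <= b i)%R by rewrite /b; case: i => -[] [j|] //=.
move=> /(_ a0 b0).
rewrite T0 T1 => /(_ isT) /(_ (fun i => cmeas_mob _ _ _) mobT).
have lE i w : (modulus w <= 2)%R ->
    mean (fun t => logp 4 (modulus (w - mob R (zi i) (ti i) t))) = (l i w)%:E.
  move=> w2; rewrite mean_pot// => t; apply: le_trans (modulusD _ _) _; rewrite modulusN.
  by apply: le_trans (lerD w2 (mobT i t)) _; move: T1; lra.
move=> /(_ lE).
have psiE w : (modulus w <= 2)%R -> (psi w + \sum_i a i * l i w = \sum_i b i * l i w)%R.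
  move=> _; rewrite !sumI /a /b /l /zi /ti /=.
  have S0 (g : 'I_n -> K) : (\sum_j 0 * g j = 0)%R by rewrite big1// => j _; rewrite mul0r.
  rewrite !S0 !mul0r !addr0 !add0r /psi.
  have -> : (\sum_(j < n) beta j * (pot R (z j) (t2 j) w - pot R (z j) (t1 j) w) =
      \sum_j beta j * (ln 4 - pot R (z j) (t1 j) w) -
      \sum_j beta j * (ln 4 - pot R (z j) (t2 j) w))%R.
    by rewrite -sumrB; apply: eq_bigr => j _; ring.
  by ring.
move=> /(_ psiE psi_bnd).
have psi_out w : (T <= modulus w)%R -> psi w = 0%R.
  move=> Tw; rewrite /psi sum_out; last exact: le_trans (ltW RT') Tw.
  rewrite !pot0// mulr1 mulrCA divff ?gt_eqF// mulr1.
  by rewrite (max_idPl Tw) (max_idPl (le_trans (ltW RT') Tw)) subrr mulr0 subr0.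
move=> /(_ psi_out).
have mpsi : measurable_fun [set: K * K] (psi \o @cplx K).
  apply: measurable_funB.
    by apply: measurable_funM => //; apply: measurable_funB; exact: measurable_pot.
  apply: measurable_sum => j; apply: measurable_funM => //.
  by apply: measurable_funB; exact: measurable_pot.
move=> /(_ mpsi).
have S0 (g : 'I_n -> \bar K) : \sum_j 0%:E * g j = 0.
  by rewrite big1// => j _; rewrite mul0e.
rewrite !sumIe /a /b /zi /ti /= !S0 !mul0e !add0e !adde0.
move=> h; apply: le_trans (le_trans _ h) _.
  by rewrite leeDr// mule_ge0 ?lee_fin// W_ge0.
rewrite addeC leeD2l//; apply: lee_wpmul2l; first by rewrite lee_fin.
exact: W_center_le.
Qed.

End family.

(** * Harnack's inequality *)

Section expanding.
Context {K : realType}.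
Local Notation mu := (@lebesgue_measure K).
Local Open Scope ereal_scope.

Lemma lebesgue_measure_le_diam (A : set K) (d : K) : measurable A -> (0 <= d)%R ->
  (forall x y, A x -> A y -> (x <= y)%R -> (y - x <= d)%R) -> mu A <= d%:E.
Proof.
move=> mA d0 Ad; have [->|/set0P[a Aa]] := eqVneq A set0; first by rewrite measure0.
have lbA : has_lbound A.
  exists (a - d)%R => x Ax; have [ax|/ltW xa] := leP a x.
    by apply: le_trans ax; rewrite gerBl.
  by rewrite lerBlDr addrC -lerBlDr; exact: Ad.
have infA : has_inf A by split => //; exists a.
apply: (@le_trans _ _ (mu `[inf A, (inf A + d)%R]%classic)).
  apply: le_measure; rewrite ?inE// => x Ax /=; rewrite in_itv/= ge_inf//=.
  rewrite -lerBlDr; apply: lb_le_inf; first by exists a.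
  move=> y Ay; rewrite lerBlDr addrC -lerBlDr.
  have [yx|/ltW xy] := leP y x; first exact: Ad.
  by rewrite (le_trans _ d0)// subr_le0.
rewrite lebesgue_measure_itv/= lte_fin; case: ifPn => _; last by rewrite lee_fin.
by rewrite -EFinD lee_fin addrAC subrr add0r.
Qed.

(** A map that expands lengths by a factor at least [k] can decrease integrals
    only by the factor [k]: preimages of intervals shrink accordingly, hence so
    do preimages of Borel sets, whose measure is computed by interval covers. *)
Lemma integral_expanding (H : K -> K) (k : K) (f : K -> \bar K) : (0 < k)%R ->
  measurable_fun [set: K] H ->
  (forall x y, (x <= y)%R -> (k * (y - x) <= H y - H x)%R) ->
  measurable_fun [set: K] f -> (forall x, 0 <= f x) ->
  k%:E * \int[mu]_x f (H x) <= \int[mu]_x f x.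
Proof.
move=> k0 mH expH mf f0.
pose kn : {nonneg K} := NngNum (ltW k0).
have mHA (A : set K) : measurable A -> measurable (H @^-1` A).
  by move=> mA; rewrite -[X in measurable X]setTI; exact: (mH measurableT _ mA).
have le_itv (u v : K) : k%:E * mu (H @^-1` `]u, v]) <= wlength idfun `]u, v]%classic.
  have [uv|vu] := ltP u v; last first.
    by rewrite set_itv_ge ?bnd_simp -?leNgt// preimage_set0 measure0 mule0 wlength0.
  rewrite wlength_itv/= lte_fin uv -EFinD.
  rewrite -lee_pdivlMl// -EFinM; apply: lebesgue_measure_le_diam.
  - exact: mHA.
  - by rewrite mulr_ge0 ?invr_ge0 ?subr_ge0 ?ltW.
  move=> x y /=; rewrite !in_itv/= => /andP[ux xv] /andP[uy yv] xy.
  rewrite ler_pdivlMl//; apply: le_trans (expH _ _ xy) _.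
  by apply: lerB => //; exact: ltW.
have le_meas (A : set K) : measurable A -> k%:E * mu (H @^-1` A) <= mu A.
  move=> mA.
  rewrite [leRHS](_ : _ = (mu_ext (wlength idfun) A)) //.
  apply: le_ereal_inf_tmp => _ [F [mF AF] <-].
  have mF' n : measurable (F n : set K).
    by have := mF n; case/ocitvP => [->|[[u v] _ ->]]//; exact: measurable_itv.
  apply: (@le_trans _ _ (k%:E * \sum_(0 <= n <oo) mu (H @^-1` F n))).
    apply: lee_wpmul2l; first by rewrite lee_fin ltW.
    apply: (measure_sigma_subadditive mu).
    - by move=> n; exact: mHA.
    - exact: mHA.
    - by rewrite -preimage_bigcup; exact: preimage_subset.
  rewrite -nneseriesZl//; apply: lee_nneseries => n _.
    by rewrite mule_ge0// lee_fin ltW.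
  by have := mF n; case/ocitvP => [->|[[u v] _ ->]]; [rewrite preimage_set0 measure0 mule0; exact: measure_ge0|exact: le_itv].
have mHm : measurable_fun setT (H : measurableTypeR K -> measurableTypeR K) by exact: mH.
have hm (m : measurable_fun setT (H : measurableTypeR K -> measurableTypeR K)) :
    \int[mscale kn (pushforward mu (H : measurableTypeR K -> measurableTypeR K))]_x f x <= \int[mu]_x f x.
  refine (ge0_le_measure_integral _ _ _ _) => //.
move: (hm mHm); rewrite ge0_integral_mscale//.
by rewrite (ge0_integral_pushforward mHm)//; apply.
Qed.

End expanding.

Section harnack.
Context {K : realType}.
Local Open Scope complex_scope.
Variable s : K.
Hypothesis s01 : 0 <= s < 1.

Let den (x : K) := 1 + s * cos x.

Let den_gt0 x : 0 < den x.
Proof.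
have /andP[s0 s1] := s01; have := cos_geN1 x => c.
by rewrite /den; apply: (@lt_le_trans _ _ (1 - s)); [lra|nra].
Qed.

(** The argument of the automorphism [(e + s) / (1 + s e)] of the circle. *)
Definition poisson_arg (x : K) : K := x - 2 * atan (s * sin x / (1 + s * cos x)).

Lemma expi_poisson_arg x : expi (poisson_arg x) =
  (expi x + s%:C) / (1 + s%:C * expi x).
Proof.
have d0 := den_gt0 x.
rewrite /poisson_arg -/(den x); set q := _ / _; pose c := cos (atan q).
have c0 : 0 < c by rewrite /c cos_atan invr_gt0 sqrtr_gt0 ltr_wpDr ?sqr_ge0.
have sinE : sin (atan q) = q * c.
  have e : sin (atan q) / c = q by have := atanK q; rewrite /tan.
  by rewrite -[X in X * c]e divfK// gt_eqF.
have DE : 1 + s%:C * expi x = (den x / c)%:C * expi (atan q).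
  rewrite -[expi x]cplxE -[expi (atan q)]cplxE !Re_expi !Im_expi /cplx sinE -/c /=.
  simpc; congr (_ +i* _).
    by rewrite divfK ?gt_eqF.
  by rewrite mulrCA divfK ?gt_eqF// /q divfK// gt_eqF.
have conjM (u v : Cplx K) : (u * v)^*%C = u^*%C * v^*%C by exact: rmorphM.
have conjD (u v : Cplx K) : (u + v)^*%C = u^*%C + v^*%C by exact: rmorphD.
have conjR (u : K) : (u%:C : Cplx K)^*%C = u%:C by simpc.
have NE : expi x + s%:C = expi x * ((den x / c)%:C * expi (- atan q)).
  have -> : (den x / c)%:C * expi (- atan q) = (1 + s%:C * expi x)^*%C.
    by rewrite DE conjM conjR expi_conj.
  rewrite conjD conjM conjR expi_conj conjc1 mulrDr mulr1; congr (_ + _).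
  by rewrite mulrCA expiN mulfV ?expi_neq0// mulr1.
have r0 : (den x / c)%:C != 0 :> Cplx K.
  by rewrite -modulus_eq0 modulus_real normr_eq0 mulf_neq0 ?invr_eq0 ?gt_eqF.
rewrite NE DE (_ : x - 2 * atan q = x + (- atan q + - atan q)); last by ring.
rewrite !expiD expiN -!mulrA; congr (_ * _).
rewrite invfM [RHS]mulrCA; congr (_ * _).
by rewrite mulrA mulfV// mul1r.
Qed.

Lemma is_derive_poisson_arg (x : K) : is_derive x 1 poisson_arg
  ((1 - s ^+ 2) / (1 + 2 * s * cos x + s ^+ 2)).
Proof.
have d0 := den_gt0 x; have dN0 : den x != 0 by rewrite gt_eqF.
have cs := cos2Dsin2 x.
have dsin : is_derive x 1 (fun x => s * sin x) (s * cos x).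
  exact: is_derive_eq.
have dden : is_derive x 1 den (- (s * sin x)).
  apply: is_derive_eq.
  by rewrite /GRing.scale/=; ring.
have dinv : is_derive x 1 (fun x => (den x)^-1) (s * sin x / den x ^+ 2).
  have h := is_deriveV dN0 dden; apply: (is_derive_eq h).
  by rewrite /GRing.scale/=; field.
have dq : is_derive x 1 (fun x => s * sin x / (1 + s * cos x)) ((s * cos x + s ^+ 2) / den x ^+ 2).
  have h := is_deriveM dsin dinv; apply: (is_derive_eq h).
  rewrite /GRing.scale/=.
  have -> : s * cos x + s ^+ 2 = s * cos x * den x + s ^+ 2 * (sin x ^+ 2).
    rewrite -{1}[s ^+ 2]mulr1 -[X in s ^+ 2 * X]cs /den; ring.
  by rewrite -/(den x); field.
have dN : 1 + 2 * s * cos x + s ^+ 2 = den x ^+ 2 + (s * sin x) ^+ 2.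
  have -> : s ^+ 2 = s ^+ 2 * (cos x ^+ 2 + sin x ^+ 2) by rewrite cs mulr1.
  by rewrite /den; ring.
have dp : 0 < 1 + 2 * s * cos x + s ^+ 2.
  by rewrite dN ltr_wpDr ?sqr_ge0// exprn_gt0.
have datan := @is_derive1_comp _ atan (fun x => s * sin x / (1 + s * cos x)) x _ _ (is_derive1_atan _) dq.
have h := is_deriveB (is_derive_id x 1) (is_deriveZ 2 datan); apply: (is_derive_eq h).
rewrite /GRing.scale/= -/(den x).
have -> : 1 + (s * sin x / den x) ^+ 2 = (1 + 2 * s * cos x + s ^+ 2) / den x ^+ 2.
  by rewrite dN expr_div_n mulrDl divff ?expf_neq0.
have e1 : 1 - s ^+ 2 = 1 + 2 * s * cos x + s ^+ 2 - 2 * (s * cos x + s ^+ 2) by ring.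
by rewrite e1; field; rewrite dN0 gt_eqF.
Qed.

(** The derivative is the Poisson kernel [(1 - s^2) / |1 + s e|^2], whose minimum
    is [(1 - s) / (1 + s)]. *)
Lemma poisson_arg_expand (x y : K) : x <= y ->
  (1 - s) / (1 + s) * (y - x) <= poisson_arg y - poisson_arg x.
Proof.
have /andP[s0 s1] := s01.
rewrite le_eqVlt => /predU1P[->|xy]; first by rewrite !subrr mulr0.
have cont : {within `[x, y], continuous poisson_arg}.
  apply: continuous_subspaceT => t; apply: differentiable_continuous.
  by apply/derivable1_diffP; have [] := is_derive_poisson_arg t.
have [c _ ->] := MVT xy (fun t _ => is_derive_poisson_arg t) cont.
rewrite ler_pM2r ?subr_gt0//.
have c1 := cos_le1 c; have c2 := cos_geN1 c.
have p1 : 0 < 1 + 2 * s * cos c + s ^+ 2 by nra.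
rewrite ler_pdivrMr ?ltr_wpDr// mulrAC ler_pdivlMr//.
rewrite -subr_ge0 (_ : _ - _ = 2 * s * (1 - s) * (1 - cos c)); last by ring.
by rewrite !mulr_ge0// subr_ge0// ltW.
Qed.

Lemma measurable_poisson_arg : measurable_fun [set: K] poisson_arg.
Proof.
apply: continuous_measurable_fun => t; apply: differentiable_continuous.
by apply/derivable1_diffP; have [] := is_derive_poisson_arg t.
Qed.

End harnack.

Section harnack_inequality.
Context {K : realType}.
Local Open Scope complex_scope.
Variable V : Cplx K -> \bar K.
Hypothesis Vs : pos_superharmonic V.

Lemma mob_polar (R m th t : K) : 0 < R -> 0 <= m < R ->
  mob R (m%:C * expi th) 1 (t + th) = R%:C * expi (poisson_arg (m / R) t + th).
Proof.
move=> R0 /andP[m0 mR].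
have s01 : 0 <= m / R < 1 by rewrite divr_ge0 ?(ltW R0)//= ltr_pdivrMr// mul1r.
have D0 : R%:C + m%:C * expi t != 0 :> Cplx K.
  have := @mob_den_neq0 K R R0 (m%:C : Cplx K) 1 t ler01.
  rewrite modulus_real ger0_norm// mulr1 => /(_ mR).
  by rewrite (_ : (m%:C : Cplx K)^*%C = m%:C) ?mulr1//; simpc.
have RN0 : R%:C != 0 :> Cplx K by rewrite -modulus_eq0 modulus_real normr_eq0 gt_eqF.
have sE : (m / R)%:C = m%:C / R%:C :> Cplx K by rewrite rmorphM/= fmorphV.
have conjM (u v : Cplx K) : (u * v)^*%C = u^*%C * v^*%C by exact: rmorphM.
have conjR (x : K) : (x%:C : Cplx K)^*%C = x%:C by simpc.
have e0 := expi_neq0 th.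
have D1 : R%:C * (R%:C + m%:C * expi t) != 0 :> Cplx K by exact: mulf_neq0.
rewrite expiD (expi_poisson_arg s01) /mob conjM conjR expi_conj expiN expiD sE.
have -> : R%:C + m%:C * (expi th)^-1 * 1%:C * (expi t * expi th) = R%:C + m%:C * expi t :> Cplx K.
  by field.
have -> : 1 + m%:C / R%:C * expi t = (R%:C + m%:C * expi t) / R%:C :> Cplx K by field.
by field; rewrite RN0 D0.
Qed.

Local Open Scope ereal_scope.

(** Along the boundary circle the Poisson kernel of [z] is at most
    [(R + modulus z) / (R - modulus z)], and it is the density of the curve
    [mob R z 1] because that curve runs through the circle at the rate
    [poisson_arg]. *)
Lemma harnack (R : K) (z : Cplx K) : (0 < R)%R -> (R < 1)%R -> (modulus z < R)%R ->
  W R V z 1 <= ((R + modulus z) / (R - modulus z))%:E * W R V 0 1.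
Proof.
move=> R0 R1 zR.
have [th zE] := polar_form z; set m := modulus z in zR zE *.
have m0 : (0 <= m)%R by exact: modulus_ge0.
pose s := (m / R)%R; have s01 : (0 <= s < 1)%R.
  by rewrite divr_ge0 ?(ltW R0)//= ltr_pdivrMr// mul1r.
have /andP[s0 s1] := s01.
pose f (y : K) := V (R%:C * expi (y + th))%R.
have mf : measurable_fun [set: K] f.
  apply: (measurable_superharmonic_comp Vs); apply: cmeasM; first exact: cmeas_cst.
  by apply: cmeas_expi; exact: measurable_funD.
have f0 y : 0 <= f y by exact: superharmonic_ge0.
have mG : measurable_fun [set: K] (fun t => V (mob R z 1 t)).
  by apply: (measurable_superharmonic_comp Vs); exact: cmeas_mob.
have -> : W R V 0 1 = mean f.
  rewrite /W /f; under eq_mean => t do rewrite mob0// mulr1.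
  apply/esym; apply: (@mean_shift _ (fun t => V (R%:C * expi t)%R)) => [|t|t].
  - apply: (measurable_superharmonic_comp Vs); apply: cmeasM; first exact: cmeas_cst.
    exact: cmeas_expi.
  - exact: superharmonic_ge0.
  - by rewrite expi_turn.
have -> : W R V z 1 = mean (fun t => f (poisson_arg s t)).
  rewrite /W -(@mean_shift _ _ th mG).
  - by apply: eq_mean => t; rewrite zE mob_polar ?m0.
  - by move=> t; exact: superharmonic_ge0.
  - by move=> t; rewrite /mob expi_turn.
have mH := measurable_poisson_arg s01.
rewrite !meanE//; last exact: measurableT_comp.
pose k := ((1 - s) / (1 + s))%R.
have k0 : (0 < k)%R by rewrite divr_gt0 ?subr_gt0 ?ltr_pwDl.
have kE : ((R + m) / (R - m) = k^-1)%R.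
  rewrite /k /s invf_div; field.
  by rewrite !gt_eqF// ?subr_gt0// mulrBl ?mul1r ?divfK ?gt_eqF// ?subr_gt0.
rewrite kE muleCA; apply: lee_wpmul2l.
  by rewrite lee_fin invr_ge0 ltW// turn_gt0.
rewrite lee_pdivlMl//.
pose D := `[0%R, (2 * pi)%R]%classic : set K.
rewrite [in leLHS]integral_mkcond [leRHS]integral_mkcond.
have H0 : poisson_arg s 0 = 0%R by rewrite /poisson_arg sin0 mulr0 mul0r atan0 mulr0 subr0.
have H2 : poisson_arg s (2 * pi) = (2 * pi)%R.
  by rewrite /poisson_arg mulr_natl sin2pi mulr0 mul0r atan0 mulr0 subr0.
have expand := poisson_arg_expand s01.
have mono x y : (x <= y)%R -> (poisson_arg s x <= poisson_arg s y)%R.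
  move=> xy; rewrite -subr_ge0; apply: le_trans (expand _ _ xy).
  by rewrite mulr_ge0 ?subr_ge0// ltW.
have smono x y : (x < y)%R -> (poisson_arg s x < poisson_arg s y)%R.
  move=> xy; rewrite -subr_gt0; apply: lt_le_trans (expand _ _ (ltW xy)).
  by rewrite mulr_gt0 ?subr_gt0.
have le_H x y : (poisson_arg s x <= poisson_arg s y)%R = (x <= y)%R.
  apply/idP/idP; last exact: mono.
  by apply: contraTT; rewrite -!ltNge; exact: smono.
have -> : (fun t => f (poisson_arg s t)) \_ `[0%R, (2 * pi)%R] =
    (fun t => (f \_ `[0%R, (2 * pi)%R]) (poisson_arg s t)).
  apply/funext => t; rewrite !patchE.
  suff -> : (poisson_arg s t \in `[0%R, (2 * pi)%R]%classic) = (t \in `[0%R, (2 * pi)%R]%classic) by [].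
  by rewrite !mem_setE !in_itv/= -{1}H0 -{1}H2 !le_H.
apply: (integral_expanding k0 mH expand).
  exact/(measurable_restrictT _ _).1/measurable_funTS.
by move=> x; rewrite patchE; case: ifP.
Qed.

End harnack_inequality.

(** * A covering theorem of Besicovitch type *)

Section covering.
Context {K : realType}.
Implicit Types (z w : Cplx K) (t : K).

(** Two vectors lie in the same closed octant of the plane when the signs of
    their coordinates and the order of the absolute values agree; their angle
    is then at most 45 degrees. *)
Definition octant z : bool * bool * bool :=
  (0 <= complex.Re z, 0 <= complex.Im z, `|complex.Re z| <= `|complex.Im z|).

(** By Lagrange's identity [|a|^2 |b|^2 = (a . b)^2 + (a x b)^2]: on a common
    octant the cross product is at most the dot product. *)
Lemma octant_dot (x1 y1 x2 y2 : K) :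
  octant (x1 +i* y1)%C = octant (x2 +i* y2)%C ->
  0 <= x1 * x2 + y1 * y2 /\
  (x1 ^+ 2 + y1 ^+ 2) * (x2 ^+ 2 + y2 ^+ 2) <= 2 * (x1 * x2 + y1 * y2) ^+ 2.
Proof.
move=> [/= ex ey exy].
wlog x1p : x1 x2 ex exy / 0 <= x1.
  move=> ind; have [|x1n] := leP 0 x1; first exact: ind.
  have x2n : x2 < 0 by rewrite ltNge -ex -ltNge.
  have := ind (- x1) (- x2); rewrite !mulrNN !sqrrN !normrN; apply => //.
    by rewrite !oppr_ge0 !ltW.
  by rewrite oppr_ge0 ltW.
wlog y1p : y1 y2 ey exy / 0 <= y1.
  move=> ind; have [|y1n] := leP 0 y1; first exact: ind.
  have y2n : y2 < 0 by rewrite ltNge -ey -ltNge.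
  have := ind (- y1) (- y2); rewrite !mulrNN !sqrrN !normrN; apply => //.
    by rewrite !oppr_ge0 !ltW.
  by rewrite oppr_ge0 ltW.
have x2p : 0 <= x2 by rewrite -ex.
have y2p : 0 <= y2 by rewrite -ey.
move: exy; rewrite !ger0_norm// => exy.
have xx : 0 <= x1 * x2 by rewrite mulr_ge0.
have yy : 0 <= y1 * y2 by rewrite mulr_ge0.
split; first exact: addr_ge0.
rewrite -subr_ge0 (_ : _ - _ = (x1 * x2 + y1 * y2 - x1 * y2 + x2 * y1) *
  (x1 * x2 + y1 * y2 + x1 * y2 - x2 * y1)); last by ring.
have a1 : 0 <= x1 * y2 by rewrite mulr_ge0.
have a2 : 0 <= x2 * y1 by rewrite mulr_ge0.
have [h|h] := leP x1 y1.
  have h2 : x2 <= y2 by rewrite -exy.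
  have b1 : x1 * y2 <= y1 * y2 by rewrite ler_wpM2r.
  have b2 : x2 * y1 <= y1 * y2 by rewrite [leRHS]mulrC ler_wpM2r.
  by rewrite mulr_ge0//; lra.
have h2 : y2 < x2 by rewrite ltNge -exy -ltNge.
have b1 : x1 * y2 <= x1 * x2 by rewrite ler_wpM2l// ltW.
have b2 : x2 * y1 <= x1 * x2 by rewrite [leRHS]mulrC ler_wpM2l// ltW.
by rewrite mulr_ge0//; lra.
Qed.

(** With [p = |a| / t], [q = |b| / t] and [cos 45 > 7/10] this says that
    [p^2 + q^2 - 7/5 p q <= 1] for [2/5 <= p <= 1] and [0 <= q <= 6/5]; the left
    side is convex in each variable, so the corners decide. *)
Lemma octant_dist (a b : Cplx K) t : octant a = octant b ->
  2 / 5 * t <= modulus a -> modulus a <= t -> modulus b <= 6 / 5 * t ->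
  modulus (a - b) <= t.
Proof.
case: a => x1 y1; case: b => x2 y2 o near at_ bt.
have [d0 d2] := octant_dot o.
set a := (x1 +i* y1)%C in near at_ *; set b := (x2 +i* y2)%C in bt *.
have p0 : 0 <= modulus a by exact: modulus_ge0.
have q0 : 0 <= modulus b by exact: modulus_ge0.
have t0 : 0 <= t by exact: le_trans at_.
have pE : modulus a ^+ 2 = x1 ^+ 2 + y1 ^+ 2 by rewrite sqr_modulus.
have qE : modulus b ^+ 2 = x2 ^+ 2 + y2 ^+ 2 by rewrite sqr_modulus.
rewrite -(@ler_pXn2r _ 2)// ?nnegrE ?modulus_ge0//.
rewrite sqr_modulus /=.
move: pE qE d2 p0 q0 near at_ bt; move: (modulus a) (modulus b) => p q pE qE d2 p0 q0 near pt qt.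
rewrite -pE -qE in d2.
set d := x1 * x2 + y1 * y2 in d0 d2.
have dpq : 7 / 10 * (p * q) <= d.
  rewrite -(@ler_pXn2r _ 2)// ?nnegrE; last by rewrite !mulr_ge0.
  have d20 : 0 <= d ^+ 2 by exact: sqr_ge0.
  by rewrite exprMn exprMn; lra.
have -> : (x1 - x2) ^+ 2 + (y1 - y2) ^+ 2 = p ^+ 2 + q ^+ 2 - 2 * d.
  by rewrite pE qE /d; ring.
have h1 : 0 <= q * (6 / 5 * t - q) by rewrite mulr_ge0// subr_ge0.
have h2 : 0 <= (p - 2 / 5 * t) * (t - p) by rewrite mulr_ge0// subr_ge0.
have [h|h] := leP (6 / 5 * t) (7 / 5 * p).
  have h3 : 0 <= q * (7 / 5 * p - 6 / 5 * t) by rewrite mulr_ge0// subr_ge0.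
  have h4 : p ^+ 2 <= t ^+ 2 by rewrite ler_pXn2r.
  by lra.
have h3 : 0 <= (6 / 5 * t - q) * (6 / 5 * t - 7 / 5 * p) by rewrite mulr_ge0 ?subr_ge0// ltW.
have h4 : 0 <= t * (p - 2 / 5 * t) by rewrite mulr_ge0// subr_ge0.
have h5 : 0 <= t ^+ 2 by exact: sqr_ge0.
lra.
Qed.

(** One disc of a greedy selection is chosen before another: the later centre
    was not covered, and the later radius was not much larger. *)
Definition precedes (z1 : Cplx K) t1 (z2 : Cplx K) t2 :=
  t1 < modulus (z2 - z1) /\ t2 <= 6 / 5 * t1.

(** Seen from a common point of the discs, two centres cannot lie in the same
    octant unless the first is very near, and only one centre can be near. *)
Lemma precedes_overlap (I : finType) (z : I -> Cplx K) (t : I -> K) w :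
  (forall i j, i != j -> precedes (z i) (t i) (z j) (t j) \/ precedes (z j) (t j) (z i) (t i)) ->
  (#|[pred j | (modulus (w - z j) < t j)%R]| <= 9)%N.
Proof.
move=> sep; set A := [pred j | _].
pose cell (j : I) : option (bool * bool * bool) :=
  if modulus (z j - w) < 2 / 5 * t j then None else Some (octant (z j - w)).
have clash i j : i \in A -> j \in A -> precedes (z i) (t i) (z j) (t j) -> cell i <> cell j.
  rewrite !inE ![modulus (w - _)]modulusB => iA jA [far tj].
  have ti0 : 0 < t i by exact: le_lt_trans (modulus_ge0 _) iA.
  have jA' : modulus (z j - w) <= 6 / 5 * t i by rewrite (le_trans (ltW jA)).
  have e : z j - z i = (z j - w) - (z i - w) by rewrite opprB addrA subrK.
  have := modulusD (z j - w) (- (z i - w)); rewrite modulusN -e => tri.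
  rewrite /cell; case: ifPn => ni; case: ifPn => nj //; last move=> /Some_inj o.
    have : modulus (z j - w) < 2 / 5 * (6 / 5 * t i).
      by apply: lt_le_trans nj _; rewrite ler_wpM2l.
    by move=> nj' _; move: far; rewrite ltNge => /negP; apply; lra.
  rewrite -leNgt in ni.
  have := octant_dist o ni (ltW iA) jA'.
  by rewrite modulusB -e leNgt far.
have cell_inj : {in A &, injective cell}.
  move=> i j iA jA ce; apply: contrapT => /eqP ij.
  have [p|p] := sep _ _ ij; first exact: (clash _ _ iA jA p).
  exact: (clash _ _ jA iA p).
rewrite -(card_in_image cell_inj); apply: leq_trans (max_card _) _.
by rewrite card_option !card_prod !card_bool.
Qed.

End covering.

Section greedy.
Context {K : realType}.
Implicit Types (z w : Cplx K).

(** Squares of side [d / 2] have diameter less than [d], and finitely many of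
    them cover the disc of radius [R]. *)
Lemma separated_unbounded (x : nat -> Cplx K) (R d : K) : 0 < d ->
  (forall n, modulus (x n) < R) ->
  (forall i j, (i < j)%N -> d < modulus (x j - x i)) -> False.
Proof.
move=> d0 xR sep.
pose cell (y : K) := Num.truncn ((y + R) * (2 / d)).
have d2 : 0 < 2 / d by rewrite divr_gt0.
pose B := (Num.truncn (2 * R * (2 / d))).
have arg0 y : `|y| < R -> 0 <= (y + R) * (2 / d).
  by rewrite ltr_norml => /andP[yR _]; rewrite mulr_ge0 ?(ltW d2)//; lra.
have cellB y : `|y| < R -> (cell y < B.+1)%N.
  move=> yR; rewrite ltnS; apply: le_truncn; rewrite ler_wpM2r ?(ltW d2)//.
  by move: yR; rewrite ltr_norml => /andP[]; lra.
have cell_close y y' : `|y| < R -> `|y'| < R -> cell y = cell y' -> `|y - y'| < d / 2.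
  move=> /arg0 /truncn_itv/andP[a1 a2] /arg0 /truncn_itv/andP[b1 b2] e.
  rewrite -/(cell y) -/(cell y') -e in a1 a2 b1 b2.
  rewrite -(ltr_pM2r d2) (_ : d / 2 * (2 / d) = 1); last by field; rewrite gt_eqF.
  rewrite -[X in _ * X](gtr0_norm d2) -normrM ltr_norml mulrBl.
  rewrite -natr1 in a2 b2.
  by move: a1 a2 b1 b2; rewrite !mulrDl => *; lra.
pose I := 'I_(B.+1 * B.+1).+1.
pose F (i : I) : 'I_B.+1 * 'I_B.+1 :=
  (inord (cell (complex.Re (x i))), inord (cell (complex.Im (x i)))).
have /injectivePn[i [j ij]] : ~~ injectiveb F.
  apply/negP => /injectiveP /leq_card.
  by rewrite card_prod !card_ord ltnn.
have bd n : `|complex.Re (x n)| < R /\ `|complex.Im (x n)| < R.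
  by split; apply: le_lt_trans (xR n); [exact: Re_le_modulus|exact: Im_le_modulus].
wlog ltij : i j ij / (i < j)%N.
  move=> ind Fij; have [h|h|h] := ltngtP i j.
  - exact: (ind i j).
  - by apply: (ind j i) => //; rewrite eq_sym.
  - by move: ij; rewrite (val_inj h) eqxx.
case=> /(congr1 val)/= e1 /(congr1 val)/= e2.
have [ri ii] := bd i; have [rj ij'] := bd j.
rewrite !inordK ?cellB// in e1 e2.
have c1 := cell_close _ _ rj ri (esym e1); have c2 := cell_close _ _ ij' ii (esym e2).
have := sep _ _ ltij; rewrite ltNge => /negP; apply.
apply: le_trans (modulus_le_ReIm _) _; rewrite !raddfB/=; lra.
Qed.

(** Besicovitch's greedy selection: each new centre is not covered so far and
    its radius nearly exhausts the supremum of the radii still available. A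
    point that stayed uncovered would bound all radii from below, so that the
    centres would be infinitely many separated points of a bounded set. *)
Lemma greedy_cover (E : set (Cplx K)) (R r : K) (rad : Cplx K -> K) :
  (forall z, E z -> modulus z < R) -> (forall z, E z -> 0 < rad z <= r) ->
  exists (N : set nat) (x : nat -> Cplx K),
  [/\ forall j, N j -> E (x j),
      E `<=` \bigcup_(j in N) closed_disc (x j) (rad (x j))
    & forall i j, N i -> N j -> (i < j)%N -> precedes (x i) (rad (x i)) (x j) (rad (x j))].
Proof.
move=> ER Erad.
pose left_ (s : seq (Cplx K)) : set (Cplx K) :=
  [set z | E z /\ forall y, y \in s -> rad y < modulus (z - y)].
pose good s : set (Cplx K) :=
  [set z | left_ s z /\ forall w, left_ s w -> rad w <= 6 / 5 * rad z].
pose st := fix st n := if n is n'.+1 then xget 0 (good (st n')) :: st n' else [::].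
pose x n : Cplx K := xget 0 (good (st n)).
pose N : set nat := [set n | exists z, good (st n) z].
have stP y n : y \in st n -> exists2 i, (i < n)%N & y = x i.
  elim: n => // n ih /=; rewrite inE => /predU1P[->|/ih[i ilt ->]]; first by exists n.
  by exists i => //; rewrite ltnW.
have stM i n : (i < n)%N -> x i \in st n.
  elim: n => // n ih; rewrite ltnS leq_eqVlt inE => /predU1P[->|/ih ->].
    by rewrite eqxx.
  by rewrite orbT.
have xP n : N n -> good (st n) (x n).
  by move=> [z gz]; exact: (xgetPex 0 (ex_intro _ z gz)).
have left_anti m n : (m <= n)%N -> left_ (st n) `<=` left_ (st m).
  move=> mn z [Ez zn]; split => // y /stP[i im ->]; apply: zn; apply: stM.
  exact: leq_trans mn.
(* a point left over gives a positive supremum of radii, so that some radius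
   exceeds five sixths of it *)
have left_good n z : left_ (st n) z -> N n.
  move=> lz; have [Ez _] := lz.
  pose A := [set rad w | w in left_ (st n)].
  have supA : has_sup A.
    split; first by exists (rad z); exists z.
    by exists r => _ [w [Ew _] <-]; have /andP[] := Erad _ Ew.
  have rz : rad z <= sup A by apply: sup_upper_bound => //; exists z.
  have /andP[rz0 _] := Erad _ Ez.
  have e0 : 0 < sup A / 6 by rewrite divr_gt0//; exact: lt_le_trans rz.
  have [_ [w lw <-] ws] := sup_adherent e0 supA.
  exists w; split => // v lv.
  have : rad v <= sup A by apply: sup_upper_bound => //; exists v.
  by move: ws; lra.
exists N, x; split.
- by move=> j /xP[[]].
- move=> z Ez; apply: contrapT => unc.
  have lz n : left_ (st n) z.
    elim: n => [|n ih]; first by split.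
    have Nn := left_good _ _ ih.
    split => // y; rewrite inE => /predU1P[->|]; last by case: ih => _; apply.
    rewrite ltNge; apply/negP => h; apply: unc; exists n => //.
  have NT n : N n by exact: left_good (lz n).
  have /andP[rz0 _] := Erad _ Ez.
  apply: (@separated_unbounded x R (5 / 6 * rad z)).
  + by rewrite mulr_gt0.
  + by move=> n; have [[/ER]] := xP _ (NT n).
  move=> i j ij.
  have h : rad z <= 6 / 5 * rad (x i) by have [_ /(_ _ (lz i))] := xP _ (NT i).
  have : rad (x i) < modulus (x j - x i).
    by have [[_ lj] _] := xP _ (NT j); exact: lj (stM _ _ ij).
  lra.
move=> i j Ni Nj ij; have [_ hi] := xP _ Ni; have [lj _] := xP _ Nj.
split; first by case: lj => _; apply; exact: stM.
by apply: hi; exact: (left_anti _ _ (ltnW ij)).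
Qed.

End greedy.

(** * The maximum principle *)

Section closed_unit_disc.
Context {K : realType}.

Lemma closure_modulusP (A : set (Cplx K)) (z : Cplx K) :
  closure A z <-> forall e : K, 0 < e -> exists2 w, A w & modulus (w - z) < e.
Proof.
split=> [clz e e0|h B].
  have /clz[w [Aw we]] : nbhs z [set w | modulus (w - z) < e].
    by apply/nbhs_modulusP; exists e.
  by exists w.
by move=> /nbhs_modulusP[e e0 eB]; have [w Aw we] := h _ e0; exists w; split=> //; exact: eB.
Qed.

Lemma closure_unit_disc : closure (disc 1) = [set z : Cplx K | modulus z <= 1].
Proof.
apply/seteqP; split => z.
  move=> /closure_modulusP h /=; rewrite leNgt; apply/negP => z1.
  have z10 : 0 < modulus z - 1 by rewrite subr_gt0.
  have [w /= w1] := h _ z10; rewrite modulusB.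
  by rewrite /disc/= in w1; have := modulusBl z w; lra.
move=> /= z1; apply/closure_modulusP => e e0.
pose d := Num.min (e / 2) (1 / 2).
have d0 : 0 < d by rewrite lt_min !divr_gt0.
have de : d < e by rewrite gt_min; apply/orP; left; lra.
have d1 : d < 1 by rewrite gt_min; apply/orP; right; lra.
exists ((1 - d)%:C%C * z).
  rewrite /disc/= modulusM modulus_real ger0_norm ?subr_ge0 ?(ltW d1)//.
  by apply: (@le_lt_trans _ _ (1 - d)); [rewrite ler_piMr// subr_ge0 ltW|lra].
rewrite (_ : _ - z = - (d%:C%C * z)); last by rewrite rmorphB/=; ring.
rewrite modulusN modulusM modulus_real gtr0_norm//.
by apply: le_lt_trans de; rewrite ler_piMr// ltW.
Qed.

Lemma boundary_unit_disc : boundary (disc 1) = [set z : Cplx K | modulus z = 1].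
Proof.
rewrite /boundary closure_unit_disc; apply/seteqP; split => z /=.
  move=> [z1 ni]; apply/eqP; rewrite eq_le z1/= leNgt; apply/negP => lt1.
  apply: ni; apply/nbhs_modulusP; exists (1 - modulus z); first by rewrite subr_gt0.
  move=> w wz; rewrite /disc/=; have := modulusBl w z.
  by move: wz; lra.
move=> z1; rewrite z1; split=> // /interior_subset; rewrite /disc/= z1 ltxx.
by [].
Qed.

Lemma compact_unit_disc : compact [set z : Cplx K | modulus z <= 1].
Proof.
have cl : closed [set z : Cplx K | modulus z <= 1].
  by rewrite -closure_unit_disc; exact: closed_closure.
have cc : continuous (@cplx K).
  move=> p B /nbhs_modulusP[e e0 eB].
  have : nbhs p (ball p (e / 2)) by apply: nbhsx_ballx; rewrite divr_gt0.
  apply: filterS => q [q1 q2]; apply: eB.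
  apply: le_lt_trans (modulus_le_ReIm _) _; rewrite (splitr e) ltrD//.
    by rewrite distrC.
  by rewrite distrC.
apply: (subclosed_compact cl (B := @cplx K @` (`[-1, 1] `*` `[-1, 1]))).
  apply: continuous_compact; first exact: continuous_subspaceT.
  by apply: compact_setX; exact: segment_compact.
move=> z z1; exists (complex.Re z, complex.Im z); last exact: cplxE.
by split; rewrite /= in_itv/= -ler_norml; apply: le_trans z1;
  [exact: Re_le_modulus|exact: Im_le_modulus].
Qed.

Local Open Scope ereal_scope.

Lemma lt_between (x y : \bar K) : x < y -> x < +oo ->
  exists2 a : K, x < a%:E & a%:E < y.
Proof.
case: x y => [x| |] [y| |]// xy _.
- by exists ((x + y) / 2)%R; move: xy; rewrite !lte_fin; lra.
- by exists (x + 1)%R; rewrite ?ltry// lte_fin ltrDl.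
- by exists (y - 1)%R; rewrite ?ltNyr// lte_fin gtrBl.
- by exists 0%R; rewrite ?ltNyr ?ltry.
Qed.

(** If the supremum were not attained, the superlevel sets would generate a
    filter with a cluster point in [C], where semicontinuity fails. *)
Lemma usc_max (T : topologicalType) (C : set T) (g : T -> \bar K) :
  compact C -> C !=set0 -> (forall z, C z -> g z < +oo) ->
  (forall z (a : K), C z -> g z < a%:E -> \forall w \near z, g w < a%:E) ->
  exists2 z, C z & forall w, C w -> g w <= g z.
Proof.
move=> cptC [c Cc] g_lty g_usc; apply: contrapT => nomax.
have above z : C z -> exists2 w, C w & g z < g w.
  move=> Cz; apply: contrapT => h; apply: nomax; exists z => // w Cw.
  by rewrite leNgt; apply/negP => gzw; apply: h; exists w.
pose D := [set a : K | exists2 z, C z & a%:E < g z].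
pose B (a : K) := [set z | C z /\ a%:E < g z].
have FB : Filter (filter_from D B).
  apply: filter_from_filter.
    have [w Cw gw] := above _ Cc; have [a _ aw] := lt_between gw (g_lty _ Cc).
    by exists a; exists w.
  move=> a b [z Cz az] [w Cw bw]; exists (Num.max a b).
    by have [h|h] := leP a b; [exists w|exists z].
  by move=> x [Cx]; rewrite EFin_max gt_max => /andP[]; split.
have PF : ProperFilter (filter_from D B).
  by apply: filter_from_proper => // a [z Cz az]; exists z.
have FC : filter_from D B C.
  have [w Cw gw] := above _ Cc; have [a _ aw] := lt_between gw (g_lty _ Cc).
  by exists a; [exists w|move=> x []].
have [p [Cp clp]] := cptC _ PF FC.
have [w Cw pw] := above _ Cp; have [a pa aw] := lt_between pw (g_lty _ Cp).
have [x [[_ ax] xa]] := clp _ _ (ex_intro2 _ _ a (ex_intro2 _ _ w Cw aw) (fun x h => h)) (g_usc _ _ Cp pa).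
by move: ax; rewrite ltNge (ltW xa).
Qed.

End closed_unit_disc.

Section integral_order.
Local Open Scope ereal_scope.
Context (d : measure_display) (T : measurableType d) (K : realType).

(** The integral of a nonnegative function is by definition a supremum over the
    simple functions below it, so it is monotone without any measurability. *)
Lemma ge0_le_integral_any (mu : {measure set T -> \bar K}) (D : set T) (f g : T -> \bar K) :
  (forall x, D x -> 0 <= f x) -> (forall x, D x -> f x <= g x) ->
  \int[mu]_(x in D) f x <= \int[mu]_(x in D) g x.
Proof.
move=> f0 fg; rewrite !ge0_integralE//; last first.
  by move=> x Dx; apply: le_trans (f0 x Dx) (fg x Dx).
apply: ereal_sup_le => _ [h hf <-]; exists h => // x; apply: le_trans (hf x) _.
by rewrite !patchE; case: ifPn => // /set_mem; exact: fg.
Qed.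

End integral_order.

Section maximum.
Context {K : realType}.
Local Open Scope complex_scope.
Local Open Scope ereal_scope.

Definition flip (M : K) (v : Cplx K -> \bar K) (z : Cplx K) : \bar K :=
  if (modulus z < 1)%R then M%:E - v z else 0.

Variables (U : set (Cplx K)) (v : Cplx K -> \bar K).
Hypothesis DU : closure (disc 1) `<=` U.
Hypothesis v_sub : subharmonic_open U v.
Hypothesis v0 : v 0%R = 0.

Let inU z : (modulus z <= 1)%R -> U z.
Proof. by move=> z1; apply: DU; rewrite closure_unit_disc. Qed.

Let v_lty z : (modulus z <= 1)%R -> v z < +oo.
Proof. by move=> /inU; case: v_sub => + _ _; exact. Qed.

Let v_usc z (a : K) : (modulus z <= 1)%R -> v z < a%:E -> \forall w \near z, v w < a%:E.
Proof. by move=> /inU Uz; case: v_sub => _ + _; exact. Qed.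

(** The mean of [M - v] is [M] minus the mean of [v], also when the latter is
    [-oo]; this is read off from the positive and negative parts of [v], whose
    means cannot both be infinite as [v <= M]. *)
Lemma flip_superharmonic (M : K) : (forall w, (modulus w <= 1)%R -> v w <= M%:E) ->
  pos_superharmonic (flip M v).
Proof.
move=> vM.
have M0 : (0 <= M)%R by have := vM 0%R; rewrite modulus0 v0 lee_fin; apply.
have V0 z : 0 <= flip M v z.
  by rewrite /flip; case: ifPn => // /ltW/vM; rewrite sube_ge0 ?orbT//.
have Vout z : (1 <= modulus z)%R -> flip M v z = 0 by rewrite /flip leNgt => /negbTE ->.
have Vlsc z (a : K) : (modulus z < 1)%R -> a%:E < flip M v z ->
    exists2 e : K, (0 < e)%R & forall w, (modulus (w - z) < e)%R -> a%:E < flip M v w.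
  have flip_lt w : v w < +oo -> (a%:E < M%:E - v w) = (v w < (M - a)%:E).
    case: (v w) => [x| |]//= _; last by rewrite ltry ltNyr.
    by rewrite -EFinB !lte_fin ltrBrDr addrC -ltrBrDr.
  move=> z1; rewrite /flip z1 flip_lt ?v_lty ?ltW// => va.
  have /nbhs_modulusP[e e0 ev] := v_usc (ltW z1) va.
  exists (Num.min e (1 - modulus z)%R); first by rewrite lt_min e0 subr_gt0.
  move=> w; rewrite lt_min => /andP[we w1].
  have w1' : (modulus w < 1)%R by have := modulusBl w z; move: w1; lra.
  by rewrite w1' flip_lt ?ev// v_lty// ltW.
split=> // z rho rho0 zrho.
have zU : closed_disc z rho `<=` U.
  move=> w; rewrite /closed_disc/= => wz; apply: inU.
  by have := modulusBl w z; lra.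
have in1 t : (modulus (z + rho%:C * expi t)%R < 1)%R.
  apply: le_lt_trans zrho; apply: le_trans (modulusD _ _) _.
  by rewrite modulusM modulus_expi mulr1 modulus_real gtr0_norm.
have vz_le : v z <= circle_mean v z rho by case: v_sub => _ _ /(_ z rho rho0 zU).
have z1 : (modulus z < 1)%R by lra.
pose y t := flip M v (z + rho%:C * expi t)%R.
have my : measurable_fun [set: K] y.
  apply: (measurable_cplx_comp (measurable_lsc V0 Vout Vlsc)).
  apply: cmeasD; first exact: cmeas_cst.
  by apply: cmeasM; [exact: cmeas_cst|apply: cmeas_expi].
pose phi t : \bar K := M%:E - y t.
have y0 t : 0 <= y t by exact: V0.
have mphi : measurable_fun [set: K] phi by apply: emeasurable_funB.
have phiE t : v (circle_point z rho t) = phi t.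
  rewrite circle_pointE /phi /y /flip in1; have := v_lty (ltW (in1 t)).
  by case: (v _) => [x| |]// _; rewrite -!EFinB opprB addrC subrK.
have phiM t : phi t <= M%:E by rewrite -phiE vM// circle_pointE ltW.
have mean_phi : circle_mean v z rho = mean (phi ^\+) - mean (phi ^\-).
  rewrite /circle_mean; under eq_integral => t _ do rewrite phiE.
  rewrite integralE !meanE//; last 2 first.
  - exact: measurable_funeneg.
  - exact: measurable_funepos.
  rewrite muleBr//.
  have : \int[lebesgue_measure]_(x in `[0%R, (2 * pi)%R]) phi^\+ x <= (M * (2 * pi))%:E.
    apply: (@le_trans _ _ (\int[lebesgue_measure]_(x in `[0%R, (2 * pi)%R]) M%:E)).
      by apply: ge0_le_integral_any => // t _; rewrite funeposE ge_max lee_fin M0 phiM.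
    rewrite integral_cst//= lebesgue_measure_itv/= lte_fin turn_gt0 -EFinD subr0.
    by rewrite -EFinM.
  have : 0 <= \int[lebesgue_measure]_(x in `[0%R, (2 * pi)%R]) phi^\+ x.
    by apply: integral_ge0 => x _; exact: funepos_ge0.
  move: (\int[lebesgue_measure]_(x in `[0%R, (2 * pi)%R]) phi^\+ x) => P P0 PM.
  rewrite fin_num_adde_defr// ge0_fin_numE//; exact: le_lt_trans PM (ltry _).
have split_mean : mean (phi ^\+) + mean y = M%:E + mean (phi ^\-).
  rewrite -(mean_cst M%:E) -!meanD//; last 2 first.
  - exact: measurable_funeneg.
  - exact: measurable_funepos.
  apply: eq_mean => t; rewrite funeposE funenegE /phi.
  have := y0 t; case: (y t) => [x| |]//= _; last by rewrite addeNy maxNye maxye add0e.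
  rewrite -!EFin_max -!EFinD; congr EFin.
  have [h|h] := leP (M - x)%R 0%R.
    by rewrite max_l ?oppr_ge0//; lra.
  by rewrite max_r ?oppr_le0 ?(ltW h)//; lra.
have pos_le : mean (phi ^\+) <= M%:E.
  rewrite -[leRHS](mean_cst M%:E); apply: le_mean => //; first exact: measurable_funepos.
  by move=> t; rewrite funeposE ge_max lee_fin M0 phiM.
have pos0 : 0 <= mean (phi ^\+) by exact: mean_ge0.
have neg0 : 0 <= mean (phi ^\-) by exact: mean_ge0.
rewrite -/y /flip z1.
move: vz_le split_mean pos_le pos0 neg0 (mean_ge0 y0); rewrite mean_phi -/y.
have := v_lty (ltW z1).
case: (v z) (mean (phi ^\+)) (mean (phi ^\-)) (mean y) => [c| |] [p| |] [q| |] [Y| |]//=.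
all: rewrite ?leey// -?EFinB -?EFinD ?lee_fin => _ h; case=> e; lra.
Qed.

Let sqr_modulus_mean z (rho : K) :
  mean (fun t => (modulus (z + rho%:C * expi t) ^+ 2)%:E) = (modulus z ^+ 2 + rho ^+ 2)%:E.
Proof.
pose q : Cplx K := rho%:C; pose f (w : Cplx K) t : \bar K := (modulus (z + w * expi t) ^+ 2)%:E.
have mf w : measurable_fun [set: K] (f w).
  apply/measurable_EFinP; apply: measurable_funX; apply: measurable_modulus.
  apply: cmeasD; first exact: cmeas_cst.
  by apply: cmeasM; [exact: cmeas_cst|apply: cmeas_expi].
have f0 w t : 0 <= f w t by rewrite lee_fin sqr_ge0.
have sym : mean (f (- q)%R) = mean (f q).
  rewrite -(@mean_shift _ (f q) pi)//; last by move=> t; rewrite /f expi_turn.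
  by apply: eq_mean => t; rewrite /f expi_half mulrN mulNr.
have sum : mean (f q) + mean (f (- q)%R) = (2 * (modulus z ^+ 2 + rho ^+ 2))%:E.
  rewrite -meanD// -[RHS]mean_cst; apply: eq_mean => t.
  rewrite /f -EFinD; congr EFin; rewrite mulNr.
  have : (modulus (q * expi t) ^+ 2 = rho ^+ 2)%R.
    by rewrite modulusM modulus_expi mulr1 modulus_real real_normK ?num_real.
  rewrite !sqr_modulus !raddfD !raddfN/= => <-; ring.
move: sum; rewrite sym -/(f _); case: (mean (f q)) => // m.
by rewrite -EFinD => -[e]; congr EFin; lra.
Qed.

(** Adding [e * modulus w ^+ 2] makes the sub-mean inequality strict, so that
    the maximum over the compact disc is attained on the circle only. *)
Lemma maximum_principle (M : K) : (forall w, modulus w = 1%R -> v w <= M%:E) ->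
  forall w, (modulus w <= 1)%R -> v w <= M%:E.
Proof.
move=> vM w w1; apply/lee_addgt0Pr => e e0.
pose g x := v x + (e * modulus x ^+ 2)%:E.
have vg x : v x <= g x by rewrite leeDl// lee_fin mulr_ge0 ?sqr_ge0// ltW.
have [] := @usc_max K (Cplx K) [set z : Cplx K | (modulus z <= 1)%R] g compact_unit_disc.
- by exists 0%R; rewrite /= modulus0.
- by move=> z /v_lty vz; rewrite lte_add_pinfty// ltry.
- move=> z a z1; rewrite -lteBrDr// -EFinB => va.
  have [b vb] := lt_between va (v_lty z1); rewrite lte_fin => ba.
  have /nbhs_modulusP[d d0 dv] := v_usc z1 vb.
  pose k := ((a - e * modulus z ^+ 2 - b) / (e * (2 * modulus z + 1)))%R.
  have m0 : (0 <= modulus z)%R by exact: modulus_ge0.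
  have D0 : (0 < e * (2 * modulus z + 1))%R by rewrite mulr_gt0// ltr_wpDl ?mulr_ge0.
  have k0 : (0 < k)%R by rewrite divr_gt0// subr_gt0.
  apply/nbhs_modulusP; exists (Num.min d (Num.min 1 k))%R; first by rewrite !lt_min d0 ltr01.
  move=> x; rewrite !lt_min => /and3P[xd x1 xk].
  rewrite -lteBrDr// -EFinB; apply: (lt_le_trans (dv _ xd)); rewrite lee_fin.
  have := modulusBl x z; have := modulus_ge0 (x - z)%R.
  move: (modulus (x - z)) x1 xk {xd} => y y1 yk y0 xz.
  have xx : (modulus x ^+ 2 <= (modulus z + y) ^+ 2)%R.
    by rewrite ler_pXn2r ?nnegrE ?addr_ge0 ?modulus_ge0//; lra.
  have yy : (y ^+ 2 <= y)%R by rewrite expr2 ler_piMr// ltW.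
  have : (e * (2 * modulus z + 1) * y <= a - e * modulus z ^+ 2 - b)%R.
    by rewrite mulrC -ler_pdivlMr// ltW.
  have : (e * modulus x ^+ 2 <= e * ((2 * modulus z + 1) * y + modulus z ^+ 2))%R.
    by apply: ler_wpM2l; [exact: ltW|rewrite sqrrD in xx; lra].
  by rewrite !mulrDr !mulrDl !mulrA; lra.
move=> z z1 gz; have [zE|zN1] := eqVneq (modulus z) 1%R.
  apply: le_trans (vg w) _; apply: le_trans (gz w w1) _.
  by rewrite /g zE expr1n mulr1 leeD2r// vM.
have {zN1} z_lt1 : (modulus z < 1)%R by rewrite lt_neqAle zN1.
have gle x : (modulus x <= 1)%R -> v x <= g z.
  by move=> x1; exact: le_trans (vg x) (gz x x1).
move: gle; rewrite /g; have := v_lty (ltW z_lt1).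
case vz : (v z) => [c| |]// _ gle; last first.
  by apply: le_trans (gle w w1) _; rewrite addNye leNye.
exfalso; rewrite -EFinD in gle.
have [_ _ _ super] := flip_superharmonic gle.
pose rho := ((1 - modulus z) / 2)%R.
have rho0 : (0 < rho)%R by rewrite divr_gt0// subr_gt0.
have zrho : (modulus z + rho < 1)%R by rewrite /rho; lra.
have in1 t : (modulus (z + rho%:C * expi t)%R < 1)%R.
  apply: le_lt_trans zrho; apply: le_trans (modulusD _ _) _.
  by rewrite modulusM modulus_expi mulr1 modulus_real gtr0_norm.
have := super z rho rho0 zrho.
have -> : flip (c + e * modulus z ^+ 2) v z = (e * modulus z ^+ 2)%:E.
  by rewrite /flip z_lt1 vz -EFinB addrAC subrr add0r.
have le_flip : (e%:E * (modulus z ^+ 2 + rho ^+ 2)%:E <=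
    mean (fun t => flip (c + e * modulus z ^+ 2) v (z + rho%:C * expi t)%R)).
  rewrite -sqr_modulus_mean -meanZ ?(ltW e0)//; last 2 first.
  - apply/measurable_EFinP; apply: measurable_funX; apply: measurable_modulus.
    apply: cmeasD; first exact: cmeas_cst.
    by apply: cmeasM; [exact: cmeas_cst|apply: cmeas_expi].
  - by move=> t; rewrite lee_fin sqr_ge0.
  apply: le_mean.
  - apply/measurable_EFinP; apply: measurable_funM => //; apply: measurable_funX; apply: measurable_modulus.
    apply: cmeasD; first exact: cmeas_cst.
    by apply: cmeasM; [exact: cmeas_cst|apply: cmeas_expi].
  - apply: (measurable_superharmonic_comp (flip_superharmonic gle)).
    apply: cmeasD; first exact: cmeas_cst.
    by apply: cmeasM; [exact: cmeas_cst|apply: cmeas_expi].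
  - by move=> t; rewrite -EFinM lee_fin mulr_ge0 ?sqr_ge0// ltW.
  move=> t; rewrite /flip in1 -EFinM.
  have := gz _ (ltW (in1 t)); rewrite /g vz -EFinD.
  have := v_lty (ltW (in1 t)); case: (v _) => [x| |]//= _.
    by rewrite -EFinD -EFinB !lee_fin; lra.
  by rewrite leey.
move=> /(le_trans le_flip); rewrite -EFinM lee_fin leNgt => /negP; apply.
by rewrite ltr_pM2l// ltrDl exprn_gt0.
Qed.

(** The boundary supremum [M] is finite because [v] is bounded above on the
    compact disc, and it is nonnegative by the maximum principle. *)
Lemma boundary_sup_flip : exists M : K,
  [/\ (0 <= M)%R, ereal_sup [set v z | z in boundary (disc 1)] = M%:E
    & pos_superharmonic (flip M v)].
Proof.
set A := ereal_sup _.
have vA w : modulus w = 1%R -> v w <= A.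
  by move=> w1; apply: ereal_sup_ubound; exists w => //; rewrite boundary_unit_disc.
have A_lty : A < +oo.
  have [] := @usc_max K (Cplx K) [set z : Cplx K | (modulus z <= 1)%R] v compact_unit_disc.
  - by exists 0%R; rewrite /= modulus0.
  - exact: v_lty.
  - exact: v_usc.
  move=> z /v_lty zlt vz; apply: le_lt_trans zlt; apply: ge_ereal_sup => _ [x + <-].
  by rewrite boundary_unit_disc => x1; apply: vz; rewrite /= x1.
have A0 : 0 <= A.
  rewrite leNgt; apply/negP => A0; have [a Aa] := lt_between A0 A_lty; rewrite lte_fin => a0.
  have := @maximum_principle a (fun w w1 => le_trans (vA w w1) (ltW Aa)) 0%R.
  by rewrite modulus0 v0 lee_fin => /(_ ler01); rewrite leNgt a0.
case: A A_lty A0 vA => [M| |]// _ M0 vM; exists M; split => //.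
by apply: flip_superharmonic; exact: maximum_principle.
Qed.

End maximum.

Lemma subharmonic_flip (K : realType) (u : Cplx K -> \bar K) :
  subharmonic_on (closure (disc 1)) u -> u 0 = 0%E ->
  exists (M : K) (V : Cplx K -> \bar K),
  [/\ 0 <= M, ereal_sup [set u z | z in boundary (disc 1)] = M%:E,
      pos_superharmonic V, V 0 = M%:E
    & forall z, modulus z < 1 -> u z = (M%:E - V z)%E].
Proof.
move=> [U [v [_ DU vsub uv]]] u0.
have uvE z : modulus z <= 1 -> u z = v z.
  by move=> z1; apply: uv; rewrite closure_unit_disc inE.
have v0 : v 0 = 0%E by rewrite -uvE// modulus0.
have [M [M0 supE Vsup]] := boundary_sup_flip DU vsub v0.
exists M, (flip M v); split => //.
- rewrite -supE; congr ereal_sup; apply/seteqP; split => _ [z zb <-]; exists z => //.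
    by rewrite uvE//; move: zb; rewrite boundary_unit_disc /= => ->.
  by rewrite uvE//; move: zb; rewrite boundary_unit_disc /= => ->.
- by rewrite /flip modulus0 ltr01 v0 sube0.
move=> z z1; rewrite uvE ?ltW// /flip z1.
have [/(_ z) + _ _] := vsub; have Uz : U z by apply: DU; rewrite closure_unit_disc /= ltW.
move=> /(_ Uz); case: (v z) => [x| |]// _.
by rewrite -!EFinB; congr EFin; ring.
Qed.

(** * Increments of means and the exceptional set *)

Section lower_integral.
Context {K : realType}.
Local Notation mu := (@lebesgue_measure K).
Local Open Scope ereal_scope.

(** A function bounded below by [c k] on each cell of a geometric grid has
    [N0] at least the integral of the step function [c k / (r x ^ k)], which is
    measurable although [h] need not be. *)
Lemma N0_grid (h : K -> K) (r x : K) (c : nat -> K) (n : nat) :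
  (0 < r)%R -> (0 < x < 1)%R -> (forall t, 0 <= t <= r -> 0 <= h t)%R ->
  (forall k, (0 <= c k)%R) ->
  (forall k t, (r * x ^+ k.+1 < t <= r * x ^+ k)%R -> (c k <= h t)%R) ->
  ((\sum_(k < n) c k) * (1 - x))%:E <= N0 h r.
Proof.
move=> r0 /andP[x0 x1] h0 c0 ch.
have xk0 k : (0 < r * x ^+ k)%R by rewrite mulr_gt0 ?exprn_gt0.
have anti k m : (k <= m)%N -> (r * x ^+ m <= r * x ^+ k)%R.
  by move=> km; rewrite ler_pM2l// ler_wiXn2l ?(ltW x0) ?(ltW x1).
pose I k : set K := `](r * x ^+ k.+1)%R, (r * x ^+ k)%R]%classic.
have mI k : measurable (I k) by exact: measurable_itv.
have muI k : mu (I k) = (r * x ^+ k * (1 - x))%:E.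
  have lt_cell : (r * x ^+ k.+1 < r * x ^+ k)%R.
    by rewrite exprS mulrCA gtr_pMl.
  rewrite lebesgue_measure_itv/= lte_fin lt_cell -EFinB; congr EFin.
  by rewrite exprS; ring.
have IsubD k : I k `<=` `]0%R, r]%classic.
  move=> t; rewrite /I/= !in_itv/= => /andP[t1 t2]; apply/andP; split.
    exact: lt_trans (xk0 _) t1.
  by apply: le_trans t2 _; have := anti 0%N k (leq0n k); rewrite expr0 mulr1.
pose s k (t : K) : \bar K := (c k / (r * x ^+ k) * \1_(I k) t)%:E.
have s0 k t : 0 <= s k t.
  by rewrite lee_fin mulr_ge0// divr_ge0// ltW.
have -> : ((\sum_(k < n) c k) * (1 - x))%:E =
    \int[mu]_(t in `]0%R, r]) \sum_(k <- index_enum 'I_n) s k t.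
  rewrite ge0_integral_sum//; last first.
    by move=> k; apply/measurable_EFinP; apply: measurable_funM => //; apply: measurable_funTS; apply/measurable_indicP; exact: mI.
  rewrite mulr_suml -sumEFin; apply: eq_bigr => k _.
  rewrite /s; under eq_integral do rewrite EFinM.
  rewrite ge0_integralZl_EFin//; last 2 first.
  - by apply/measurable_EFinP; apply: measurable_funTS; apply/measurable_indicP; exact: mI.
  - by rewrite divr_ge0// ltW.
  rewrite integral_indic; [|exact: measurable_itv|exact: mI].
  rewrite setIidl; last exact: IsubD.
  rewrite [X in _ = _ * X]muI -EFinM; congr EFin; field.
  by rewrite !gt_eqF ?exprn_gt0.
apply: ge0_le_integral_any => [t _|t]; first exact: sume_ge0.
rewrite /= in_itv/= => /andP[t0 tr].
have [[k tk]|no] := pselect (exists k : 'I_n, I k t); last first.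
  rewrite big1 ?lee_fin ?divr_ge0 ?(ltW t0) ?h0 ?(ltW t0)//.
  move=> k _; rewrite /s indicE memNset ?mulr0// => tk.
  by apply: no; exists k.
rewrite (bigD1 k)//= big1 => [|m mk]; last first.
  rewrite /s indicE memNset ?mulr0// => tm; move/eqP: mk; apply; apply: val_inj => /=.
  move: tk tm; rewrite /I/= !in_itv/= => /andP[k1 k2] /andP[m1 m2].
  have [km|km|//] := ltngtP m k.
    by have := lt_le_trans m1 (le_trans k2 (anti _ _ km)); rewrite ltxx.
  by have := lt_le_trans k1 (le_trans m2 (anti _ _ km)); rewrite ltxx.
rewrite adde0 /s indicE mem_set// mulr1 lee_fin.
move: tk; rewrite /I/= in_itv/= => /[dup] tk /andP[k1 k2].
by apply: ler_pM; rewrite ?invr_ge0 ?(ltW (xk0 _))// ?ch// lef_pV2 ?posrE.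
Qed.

End lower_integral.

Section estimates.
Context {K : realType}.
Variables (V : Cplx K -> \bar K) (M R : K).
Hypotheses (Vs : pos_superharmonic V) (VM : V 0 = M%:E) (M0 : 0 <= M).
Hypothesis R01 : 0 < R < 1.
Implicit Types (z w : Cplx K) (t : K).

Let R0 : 0 < R. Proof. by case/andP: R01. Qed.
Let R1 : R < 1. Proof. by case/andP: R01. Qed.
Let lnR : 0 < - ln R. Proof. by rewrite oppr_gt0 ln_lt0. Qed.

(** The annulus between the radii [R] and [R ^ R] has capacity
    [1 / ln (R ^ R / R)], for which this is an upper bound. *)
Definition capacity : K := (- ln R)^-1 * ((1 + R) / (1 - R)) ^+ 2.

Lemma capacity_gt0 : 0 < capacity.
Proof.
by rewrite mulr_gt0 ?invr_gt0// exprn_gt0// divr_gt0 ?subr_gt0// addr_gt0.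
Qed.

Let T := expR (R * ln R).

Let RT : R < T.
Proof. by rewrite -[X in X < _](@lnK _ R) ?posrE// ltr_expR; have := lnR; have := R1; nra. Qed.

Let T1 : T < 1.
Proof. by rewrite -expR0 ltr_expR; have := lnR; have := R0; nra. Qed.

Let inv_ln_le : (ln (T / R))^-1 <= capacity.
Proof.
have R10 : 0 < 1 - R by rewrite subr_gt0.
have -> : ln (T / R) = (1 - R) * (- ln R).
  by rewrite ln_div ?posrE ?expR_gt0// expRK; ring.
rewrite invfM mulrC; apply: ler_wpM2l; first by rewrite invr_ge0 ltW.
rewrite expr_div_n ler_pdivlMr ?exprn_gt0// expr2 mulrA mulVf ?gt_eqF// mul1r.
by have := R0; nra.
Qed.

Lemma harnack_center z : modulus z < R ->
  (W R V z 1 <= ((R + modulus z) / (R - modulus z) * M)%:E)%E.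
Proof.
move=> zR; apply: le_trans (harnack Vs R0 R1 zR) _; rewrite [leRHS]EFinM.
apply: lee_wpmul2l.
  by rewrite lee_fin divr_ge0 ?subr_ge0 ?(ltW zR)// addr_ge0 ?modulus_ge0// ltW.
by rewrite -VM; apply: (@W_center_le _ _ R T) => //; rewrite R0 RT.
Qed.

(** Scaled so that the potential differences of [W] live in Euclidean discs of
    radius [t]; the values are finite by [profileE]. *)
Definition profile z t : K := fine (W R V z (t / (2 * R))).

Let twoR : 0 < 2 * R. Proof. by rewrite mulr_gt0. Qed.

(** Finiteness propagates inwards from the outer curve, where [harnack] gives
    it, by comparing a single pair of curves. *)
Lemma profileE z t : modulus z < R -> 0 < t <= 2 * R ->
  W R V z (t / (2 * R)) = (profile z t)%:E.
Proof.
move=> zR /andP[t0 tR]; rewrite /profile fineK// ge0_fin_numE; last exact: W_ge0.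
have V0 : (V 0 < +oo)%E by rewrite VM ltry.
have W1 := le_lt_trans (harnack_center zR) (ltry _).
move: tR; rewrite le_eqVlt => /predU1P[->|tR]; first by rewrite divff ?gt_eqF.
have tau0 : 0 < t / (2 * R) by rewrite divr_gt0.
have tau1 : t / (2 * R) < 1 by rewrite ltr_pdivrMr// mul1r.
have RT' : 0 < R < T by rewrite R0 RT.
have := @family_bound K V R T Vs V0 RT' T1 1 1 (fun=> z) (fun=> t / (2 * R)) (fun=> 1) ler01.
rewrite !big_ord1 tau0 tau1 => /(_ (fun=> zR) (fun=> isT) (fun=> lexx _)) fb.
have b0 : 0 < (ln (1 / (t / (2 * R))))^-1.
  by rewrite invr_gt0 ln_gt0// div1r invf_gt1.
have {fb} : (((ln (1 / (t / (2 * R))))^-1)%:E * W R V z (t / (2 * R)) < +oo)%E.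
  apply: le_lt_trans (fb _) _.
    by move=> w; rewrite big_ord1; case: (_ < _).
  rewrite lte_add_pinfty//; last by rewrite VM -EFinM ltry.
  by rewrite lte_mul_pinfty// ?lee_fin ?(ltW b0).
by case: (W R V z (t / (2 * R))) => [x _|h|_]; rewrite ?ltry ?ltNyr//; move: h; rewrite gt0_muley ?lte_fin.
Qed.

Lemma profile_ge0 z t : 0 <= profile z t.
Proof. by apply: fine_ge0; apply: W_ge0. Qed.

Lemma profile_outer z : modulus z < R ->
  profile z (2 * R) <= (R + modulus z) / (R - modulus z) * M.
Proof.
move=> zR; have := harnack_center zR.
have -> : W R V z 1 = (profile z (2 * R))%:E.
  by rewrite -profileE ?twoR ?lexx// divff ?gt_eqF.
by rewrite lee_fin.
Qed.

Lemma profile_family (n : nat) (m : K) (z : 'I_n -> Cplx K) (t1 t2 : 'I_n -> K) :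
  0 <= m -> (forall j, modulus (z j) < R) ->
  (forall j, 0 < t1 j < t2 j) -> (forall j, t2 j <= 2 * R) ->
  (forall w, \sum_(j < n) (modulus (w - z j) < t2 j)%R%:R <= m) ->
  \sum_(j < n) (profile (z j) (t1 j) - profile (z j) (t2 j)) / ln (t2 j / t1 j)
    <= m * (M * capacity).
Proof.
move=> m0 zR t12 t2R overlap.
have V0 : (V 0 < +oo)%E by rewrite VM ltry.
have RT' : 0 < R < T by rewrite R0 RT.
have ratio j : t2 j / (2 * R) / (t1 j / (2 * R)) = t2 j / t1 j.
  by have /andP[? ?] := t12 j; field; rewrite !gt_eqF.
have := @family_bound K V R T Vs V0 RT' T1 n m z (fun j => t1 j / (2 * R))
  (fun j => t2 j / (2 * R)) m0 zR.
have -> : (forall j, 0 < t1 j / (2 * R) < t2 j / (2 * R)) <-> True.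
  split => // _ j; have /andP[h1 h2] := t12 j.
  by rewrite divr_gt0//= ltr_pM2r ?invr_gt0.
have -> : (forall j, t2 j / (2 * R) <= 1) <-> True.
  by split => // _ j; rewrite ler_pdivrMr// mul1r.
have -> : (forall w, \sum_(j < n) (modulus (w - z j) < 2 * R * (t2 j / (2 * R)))%R%:R <= m) <-> True.
  split => // _ w; apply: le_trans (overlap w); apply: ler_sum => j _.
  by rewrite mulrC divfK ?gt_eqF.
move=> /(_ I I I).
under eq_bigr => j _.
  rewrite ratio profileE//; last by have /andP[-> /ltW/le_trans->] := t12 j.
  rewrite -EFinM; over.
under [X in (_ <= X + _)%E]eq_bigr => j _.
  rewrite ratio profileE//; last by have /andP[/lt_trans h /h ->] := t12 j; rewrite t2R.
  rewrite -EFinM; over.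
rewrite VM -EFinM !sumEFin -EFinD lee_fin => h.
apply: (@le_trans _ _ (m / ln (T / R) * M)).
  rewrite -lerBlDl in h; apply: le_trans h; rewrite -sumrB le_eqVlt; apply/orP; left.
  by apply/eqP; apply: eq_bigr => j _; rewrite -mulrBr [RHS]mulrC.
by rewrite mulrAC -mulrA; apply: ler_wpM2l => //; apply: ler_wpM2l.
Qed.

Lemma profile_sub_le z t1 t2 : modulus z < R -> 0 < t1 -> t1 <= t2 -> t2 <= 2 * R ->
  profile z t1 <= profile z t2 + M * capacity * ln (t2 / t1).
Proof.
move=> zR t10; rewrite le_eqVlt => /predU1P[<-|t12] t2R.
  by rewrite divff ?ln1 ?mulr0 ?addr0// gt_eqF.
have l0 : 0 < ln (t2 / t1) by rewrite ln_gt0// ltr_pdivlMr// mul1r.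
have := @profile_family 1 1 (fun=> z) (fun=> t1) (fun=> t2) ler01.
rewrite big_ord1 t10 t12 mul1r => /(_ (fun=> zR) (fun=> isT) (fun=> t2R)).
rewrite ler_pdivrMr// lerBlDl; apply.
by move=> w; rewrite big_ord1; case: (_ < _).
Qed.

End estimates.

Section exceptional.
Context {K : realType}.
Variables (V : Cplx K -> \bar K) (M R r : K) (h : K -> K).
Hypotheses (Vs : pos_superharmonic V) (VM : V 0 = M%:E) (M0 : 0 <= M).
Hypothesis R01 : 0 < R < 1.
Hypothesis r_itv : 0 < r <= 2 * R.
Implicit Types (z w : Cplx K) (t : K).

Let r0 : 0 < r. Proof. by case/andP: r_itv. Qed.
Let rR : r <= 2 * R. Proof. by case/andP: r_itv. Qed.

(** At these points the profile varies, on some scale below [t], faster than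
    the gauge [h] allows. *)
Definition varying z t : Prop := exists t1 t2,
  [/\ 0 < t1 < t2, t2 <= t, t <= r
    & profile V R z t2 + M * h t * ln (t2 / t1) < profile V R z t1].

(** Each disc contributes more than [M h] to a sum of normalized increments of
    the profile that [profile_family] bounds by [M] times overlap times
    capacity; the overlap is [9 <= 5^2]. *)
Lemma varying_family (n : nat) (z : 'I_n -> Cplx K) (t : 'I_n -> K) : 0 < M ->
  (forall j, modulus (z j) < R) -> (forall j, varying (z j) (t j)) ->
  (forall i j, i != j -> precedes (z i) (t i) (z j) (t j) \/ precedes (z j) (t j) (z i) (t i)) ->
  \sum_(j < n) h (t j) <= 5 ^+ 2 * capacity R.
Proof.
move=> Mp zR vary sep.
have [t1 vary1] := choice vary; have [t2 vary2] := choice vary1.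
have t12 j : 0 < t1 j < t2 j by case: (vary2 j).
have t2R j : t2 j <= 2 * R by case: (vary2 j) => _ h1 h2 _; exact: le_trans h1 (le_trans h2 rR).
have overlap w : \sum_(j < n) (modulus (w - z j) < t2 j)%R%:R <= 5 ^+ 2 :> K.
  rewrite -natr_sum (_ : 5 ^+ 2 = 25%:R) ?ler_nat; last by ring.
  apply: (@leq_trans 9) => //; apply: leq_trans (precedes_overlap w sep).
  rewrite -sum1_card [leqRHS]big_mkcond/=; apply: leq_sum => j _.
  rewrite unfold_in/=; case: (ltP (modulus (w - z j)) (t2 j)) => //= lt2.
  by have [_ le2 _ _] := vary2 j; rewrite (lt_le_trans lt2 le2).
have := profile_family Vs VM M0 R01 (_ : 0 <= 5 ^+ 2) zR t12 t2R overlap.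
rewrite sqr_ge0 => /(_ isT) fam.
rewrite -(ler_pM2l Mp) mulrCA; apply: le_trans fam.
rewrite mulr_sumr; apply: ler_sum => j _.
have [/andP[a0 a12] _ _ lt_p] := vary2 j.
by rewrite ler_pdivlMr ?ln_gt0 ?ltr_pdivlMr ?mul1r// lerBrDl ltW.
Qed.

(** A greedy selection among the discs of radius [t] about the varying points
    covers all of them and has bounded overlap. *)
Lemma exceptional_content (S : set (Cplx K)) : (forall z, S z -> modulus z < R) ->
  (hausdorff_content h r [set z | S z /\ exists t, varying z t] <= (5 ^+ 2 * capacity R)%:E)%E.
Proof.
move=> SR; set E := [set z | _].
have cap0 : 0 <= 5 ^+ 2 * capacity R by rewrite mulr_ge0// ltW// capacity_gt0.
(* for [M = 0] the profile does not grow as the scale decreases *)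
move: M0; rewrite le_eqVlt => /predU1P[M0'|Mp].
  apply: ge_ereal_inf; exists 0%E => //; exists set0, (fun=> 0), (fun=> 0); split => //.
  - move=> z [/SR zR [t [t1 [t2 [/andP[t10 t12] t2t tr]]]]].
    have := profile_sub_le Vs VM M0 R01 zR t10 (ltW t12) (le_trans t2t (le_trans tr rR)).
    by rewrite -M0' !mul0r leNgt => /negP.
  - by rewrite esum_set0.
have /choice[rad radP] : forall z, exists t, E z -> varying z t.
  by move=> z; have [[_ [t vt]]|nE] := pselect (E z); [exists t|exists 0].
have rad_itv z : E z -> 0 < rad z <= r.
  move=> /radP[t1 [t2 [/andP[a b] c d _]]]; rewrite d andbT.
  exact: lt_le_trans (lt_trans a b) c.
have [N [x [xE cover sep]]] := greedy_cover (fun z (Ez : E z) => SR z (proj1 Ez)) rad_itv.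
apply: ge_ereal_inf; eexists.
  exists N, x, (rad \o x); split => //= j Nj.
  by have /andP[/ltW -> ->] := rad_itv _ (xE j Nj).
apply: ge_ereal_sup => _ [A [finA AN] <-].
rewrite fsbig_finite//= sumEFin lee_fin.
set s : seq nat := finmap.enum_fset (fset_set A).
have sN j : j \in s -> N j by move=> js; apply: AN; rewrite -(fset_setK finA).
rewrite big_tnth.
pose y (i : 'I_(size s)) := tnth (in_tuple s) i.
have yN i : N (y i) by apply: sN; exact: mem_tnth.
apply: (@varying_family _ (fun i => x (y i)) (fun i => rad (x (y i)))) => //.
- by move=> i; apply: SR; have [] := xE _ (yN i).
- by move=> i; apply: radP; exact: xE.
move=> i j ij; have [lt_ij|lt_ji|eq_ij] := ltngtP (y i) (y j).
- by left; apply: sep.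
- by right; apply: sep.
- move/eqP: ij; case; apply/val_inj/eqP.
  rewrite -(@nth_uniq _ 0%N s) ?ltn_ord ?finmap.fset_uniq//; apply/eqP.
  by move: eq_ij; rewrite /y !(tnth_nth 0%N).
Qed.

End exceptional.

(** * The lower bound off the exceptional set *)

Section lower_bound.
Context {K : realType}.
Variables (V : Cplx K -> \bar K) (M R r : K) (h : K -> K).
Hypotheses (Vs : pos_superharmonic V) (VM : V 0 = M%:E) (M0 : 0 <= M).
Hypothesis R01 : 0 < R < 1.
Hypothesis r_itv : 0 < r <= 2 * R.
Hypothesis h0 : forall t, 0 <= t <= r -> 0 <= h t.
Variable z : Cplx K.
Hypothesis zR : modulus z < R.

Let r0 : 0 < r. Proof. by case/andP: r_itv. Qed.
Let rR : r <= 2 * R. Proof. by case/andP: r_itv. Qed.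
Let R0 : 0 < R. Proof. by case/andP: R01. Qed.
Let R1 : R < 1. Proof. by case/andP: R01. Qed.
Let RzN : 0 < R - modulus z. Proof. by rewrite subr_gt0. Qed.

Let mob_near tau t : 0 <= tau <= 1 ->
  modulus (mob R z tau t - z) <= tau * (2 * R ^+ 2 / (R - modulus z)).
Proof.
move=> /andP[t0 t1]; have mz := modulus_ge0 z.
have zt : modulus z * tau <= modulus z by rewrite ler_piMr.
have zt' : modulus z * tau < R by exact: le_lt_trans zt zR.
have D0 : 0 < modulus (R%:C%C + z^*%C * tau%:C%C * expi t).
  by rewrite modulus_gt0; exact: mob_den_neq0.
rewrite modulusB (mob_sub R0 t z t0 zt') subrr mulr0 sub0r mulNr modulusN.
rewrite !modulusM modulusV modulus_expi mulr1 modulus_real ger0_norm// -mulrA.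
apply: ler_wpM2l => //; apply: ler_pM; rewrite ?modulus_ge0 ?invr_ge0 ?(ltW D0)//.
  apply: le_trans (modulusD _ _) _.
  rewrite modulusN modulusM modulus_conj modulus_real ger0_norm ?sqr_ge0//.
  have : modulus z * modulus z <= R ^+ 2 by rewrite expr2; apply: ler_pM => //; exact: ltW.
  by lra.
rewrite lef_pV2 ?posrE//.
have := modulusBl (R%:C%C : Cplx K) (- (z^*%C * tau%:C%C * expi t)).
rewrite opprK modulusN !modulusM modulus_conj modulus_expi mulr1 !modulus_real !ger0_norm ?(ltW R0)//.
by apply: le_trans; rewrite lerB.
Qed.

(** By lower semicontinuity the profile cannot stay below [V z] on the small
    circles about [z]. *)
Lemma center_le (x B : K) : 0 < x < 1 ->
  (forall n, profile V R z (r * x ^+ n.+1) <= B) -> (V z <= B%:E)%E.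
Proof.
move=> /andP[x0 x1] pB; rewrite leNgt; apply/negP => BV.
have [a Ba aV] := lt_between BV (ltry _).
have [_ _ /(_ z a (lt_trans zR R1) aV) [e e0 ev] _] := Vs.
have B0 : 0 <= B by apply: le_trans (pB 0%N); exact: profile_ge0.
have a0 : 0 <= a by move: Ba; rewrite lte_fin => /ltW; exact: le_trans.
pose D := 2 * R ^+ 2 / (R - modulus z).
have D0 : 0 < D by rewrite divr_gt0// mulr_gt0// exprn_gt0.
have [n xn] : exists n, x ^+ n < e / D.
  have /cvgr0_norm_lt/(_ (e / D)) [] : (fun n => x ^+ n) @ \oo --> (0 : K).
  - by apply: cvg_expr; rewrite ger0_norm// ltW.
  - by rewrite divr_gt0.
  by move=> n _ /(_ n (leqnn n)); rewrite /= ger0_norm ?exprn_ge0 ?(ltW x0)//; exists n.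
pose t := r * x ^+ n.+1.
have t0 : 0 < t by rewrite mulr_gt0 ?exprn_gt0.
have xn1 : x ^+ n.+1 <= 1 by rewrite exprn_ile1 ?(ltW x0) ?(ltW x1).
have tR : t <= 2 * R by apply: le_trans rR; rewrite ler_piMr// ltW.
have twoR : 0 < 2 * R by rewrite mulr_gt0.
have tau_le : t / (2 * R) <= x ^+ n.+1.
  by rewrite ler_pdivrMr// [leRHS]mulrC /t ler_pM2r ?exprn_gt0.
have : (a%:E <= W R V z (t / (2 * R)))%E.
  rewrite -(mean_cst a%:E); apply: le_mean => //.
    by apply: (measurable_superharmonic_comp Vs); exact: cmeas_mob.
  move=> s; apply/ltW/ev; apply: le_lt_trans (mob_near _ _) _.
    by rewrite divr_ge0 ?(ltW t0) ?(ltW twoR)//= ler_pdivrMr// mul1r.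
  rewrite -/D -ltr_pdivlMr//; apply: le_lt_trans tau_le _.
  by apply: le_lt_trans xn; rewrite exprS ler_piMl ?exprn_ge0 ?(ltW x0) ?(ltW x1).
rewrite (profileE Vs VM R01 zR) ?t0// lee_fin => /le_trans/(_ (pB n)).
by rewrite leNgt -lte_fin Ba.
Qed.

Hypothesis steady : ~ exists t, varying V M R r h z t.

Let steady_le t t1 t2 : 0 < t1 -> t1 < t2 -> t2 <= t -> t <= r ->
  profile V R z t1 <= profile V R z t2 + M * h t * ln (t2 / t1).
Proof.
move=> t10 t12 t2t tr; rewrite leNgt; apply/negP => lt_p.
by apply: steady; exists t, t1, t2; rewrite t10.
Qed.

(** Summing the increments over a geometric grid compares the profile with the
    lower integral [N0]; the mesh costs the factor [x^-1]. *)
Lemma profile_grid_le (x N : K) (n : nat) : 0 < x < 1 -> (N0 h r <= N%:E)%E ->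
  profile V R z (r * x ^+ n.+1) <= profile V R z (r * x) + M * (N / x).
Proof.
move=> x01 hN; have /andP[x0 x1] := x01.
pose p k := profile V R z (r * x ^+ k).
have xk0 k : 0 < r * x ^+ k by rewrite mulr_gt0 ?exprn_gt0.
have xkS k : r * x ^+ k.+1 < r * x ^+ k by rewrite exprS mulrCA gtr_pMl.
have xkr k : r * x ^+ k <= r by rewrite ler_piMr ?(ltW r0)// exprn_ile1 ?(ltW x0) ?(ltW x1).
have l0 : 0 < ln x^-1 by rewrite ln_gt0// invf_gt1.
have ratio k : r * x ^+ k / (r * x ^+ k.+1) = x^-1.
  by rewrite exprS; field; rewrite !gt_eqF ?exprn_gt0.
have N_ge0 : 0 <= N.
  rewrite -lee_fin; apply: le_trans hN; apply: integral_ge0 => t.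
  rewrite /= in_itv/= => /andP[t0 tr].
  by rewrite lee_fin divr_ge0 ?h0 ?(ltW t0).
have step k t : r * x ^+ k.+1 < t <= r * x ^+ k -> p k.+2 - p k.+1 <= M * h t * ln x^-1.
  move=> /andP[t1 t2]; rewrite lerBlDl -(ratio k.+1).
  by apply: steady_le => //; [exact: ltW|exact: le_trans t2 _].
move: M0; rewrite le_eqVlt => /predU1P[M0'|Mp].
  rewrite -M0' mul0r addr0 -[X in _ <= profile _ _ _ (r * X)]expr1.
  elim: n => // n ih; apply: le_trans ih.
  have := @step n (r * x ^+ n); rewrite lexx xkS => /(_ isT).
  by rewrite -M0' !mul0r subr_le0.
have Ml0 : 0 < M * ln x^-1 by rewrite mulr_gt0.
(* increments per unit of logarithmic length, normalized by [M] *)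
pose c k := Num.max 0 (p k.+2 - p k.+1) / (M * ln x^-1).
have c0 k : 0 <= c k by rewrite divr_ge0 ?le_max ?lexx// ltW.
have ch k t : r * x ^+ k.+1 < t <= r * x ^+ k -> c k <= h t.
  move=> tk; have /andP[t1 t2] := tk.
  rewrite ler_pdivrMr// mulrCA mulrA ge_max step// andbT.
  rewrite !mulr_ge0 ?(ltW l0) ?(ltW Mp)// h0//.
  by rewrite (ltW (lt_trans (xk0 _) t1)) (le_trans t2).
have := le_trans (N0_grid n r0 x01 h0 c0 ch) hN; rewrite lee_fin => sumN.
have tele m : p m.+1 <= p 1%N + M * ln x^-1 * \sum_(k < m) c k.
  elim: m => [|m ih]; first by rewrite big_ord0 mulr0 addr0.
  rewrite big_ord_recr/= mulrDr addrA -lerBlDr; apply: le_trans ih.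
  rewrite lerBlDr -lerBlDl /c mulrC divfK ?gt_eqF// le_max lexx orbT//.
have l_le : ln x^-1 <= (1 - x) / x.
  have -> : (1 - x) / x = x^-1 - 1 by field; rewrite gt_eqF.
  rewrite -{1}[x^-1](subrK 1) addrC; apply: le_ln1Dx.
  by have : 0 < x^-1 by [rewrite invr_gt0]; lra.
rewrite -[X in _ <= profile _ _ _ (r * X) + _]expr1; apply: le_trans (tele n) _.
rewrite lerD2l -mulrA; apply: ler_wpM2l => //.
have S0 : 0 <= \sum_(k < n) c k by apply: sumr_ge0.
apply: (@le_trans _ _ ((1 - x) / x * \sum_(k < n) c k)); first exact: ler_wpM2r.
by rewrite mulrAC ler_pM2r ?invr_gt0// mulrC.
Qed.

(** Refining the grid makes its cost disappear. *)
Lemma steady_bound (N : K) : N0 h r = N%:E ->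
  (V z <= ((R + modulus z) / (R - modulus z) * M
    + M * capacity R * ln (2 * R / r) + M * N)%:E)%E.
Proof.
move=> hN; have cap0 := capacity_gt0 R01.
have twoR : 0 < 2 * R by rewrite mulr_gt0.
have N_ge0 : 0 <= N.
  rewrite -lee_fin -hN; apply: integral_ge0 => t.
  rewrite /= in_itv/= => /andP[t0 tr].
  by rewrite lee_fin divr_ge0 ?h0 ?(ltW t0).
apply/lee_addgt0Pr => e e0; rewrite -EFinD.
have Mc0 : 0 <= M * capacity R by rewrite mulr_ge0// ltW.
have MN0 : 0 <= M * N by rewrite mulr_ge0.
(* with [x^-1 = 1 + y], the grid costs [y (M capacity + M N)] in all *)
pose y := e / (M * capacity R + M * N + 1).
have D0 : 0 < M * capacity R + M * N + 1 by rewrite ltr_wpDl// addr_ge0.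
have y0 : 0 < y by rewrite divr_gt0.
have ye : M * capacity R * y + M * N * y <= e.
  have -> : e = (M * capacity R + M * N + 1) * y by rewrite mulrC divfK ?gt_eqF.
  by rewrite !mulrDl mul1r lerDl ltW.
have y1 : 0 < 1 + y by rewrite addr_gt0.
pose x := (1 + y)^-1; have x01 : 0 < x < 1 by rewrite invr_gt0 y1 invf_lt1// ltrDl.
have /andP[x0 x1] := x01.
apply: (center_le x01) => n.
have gridP := profile_grid_le n x01 (eq_ind_r (fun X => (X <= N%:E)%E) (lexx _) hN).
have rx : r * x <= 2 * R by apply: le_trans rR; rewrite ler_piMr// ltW.
have := profile_sub_le Vs VM M0 R01 zR (mulr_gt0 r0 x0) rx (lexx _).
have := profile_outer Vs VM R01 zR.
have lnE : ln (2 * R / (r * x)) <= ln (2 * R / r) + y.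
  have -> : 2 * R / (r * x) = 2 * R / r * (1 + y).
    by rewrite invfM /x invrK mulrA.
  rewrite lnM ?posrE ?divr_gt0// lerD2l; apply: le_ln1Dx.
  by move: y0; lra.
have := ler_wpM2l Mc0 lnE; rewrite mulrDr.
move: gridP; rewrite /x invrK mulrDr mulr1 mulrDr -/x [M * (N * y)]mulrA.
by move: ye; lra.
Qed.

End lower_bound.

(** * Power gauges *)

Section gauge_power.
Context {K : realType}.
Local Notation mu := (@lebesgue_measure K).

(** For [p < 1] the integrand is unbounded at [0], so the fundamental theorem of
    calculus is applied on the intervals [[r / 2 ^ n, r]]. *)
Lemma integral_powR (r p : K) : 0 < r -> 0 < p ->
  (\int[mu]_(s in `]0%R, r]) (s `^ (p - 1))%:E = (r `^ p / p)%:E)%E.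
Proof.
move=> r0 p0; pose x : K := 2^-1.
have x0 : 0 < x by rewrite invr_gt0.
have x1 : x < 1 by rewrite invf_lt1// ltr1n.
have cont_powR q (t : K) : 0 < t -> {for t, continuous (fun s : K => s `^ q)}.
  move=> t0; apply: differentiable_continuous; apply/derivable1_diffP.
  by apply: derivable_powR; rewrite in_itv/= t0.
pose F n : set K := `[r * x ^+ n.+1, r]%classic.
have a0 n : 0 < r * x ^+ n by rewrite mulr_gt0// exprn_gt0.
have xn_cvg (y : K) : 0 <= y -> y < 1 -> y ^+ n @[n --> \oo] --> (0 : K).
  by move=> y0 y1; apply: cvg_expr; rewrite ger0_norm.
have DE : `]0, r]%classic = \bigcup_n F n.
  apply/seteqP; split => t; last first.
    by move=> [n _]; rewrite /F/= !in_itv/= => /andP[/(lt_le_trans (a0 _)) ->].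
  rewrite /= in_itv/= => /andP[t0 tr].
  have /cvgr0_norm_lt/(_ (t / r)) [] := xn_cvg x (ltW x0) x1; first by rewrite divr_gt0.
  move=> n _ /(_ n.+1 (leqnSn n)); rewrite /= ger0_norm ?exprn_ge0 ?(ltW x0)// => xn.
  by exists n => //; rewrite /F/= in_itv/= tr andbT mulrC -ler_pdivlMr// ltW.
pose f (s : K) : \bar K := (s `^ (p - 1))%:E.
have f0 s : (0 <= f s)%E by rewrite lee_fin powR_ge0.
have mf D : measurable_fun D f.
  by apply/measurable_EFinP; apply: measurable_funTS; exact: measurable_powR.
have FE n : (\int[mu]_(s in F n) f s = (r `^ p / p - r `^ p / p * x `^ p * (x `^ p) ^+ n)%:E)%E.
  have lt_ar : r * x ^+ n.+1 < r.
    by rewrite gtr_pMr// exprn_ilt1// ltW.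
  pose G (s : K) := s `^ p / p.
  have dG (s : K) : 0 < s -> is_derive s 1 G (s `^ (p - 1)).
    move=> s0; have h := is_deriveM (@is_derive1_powR K p s s0) (is_derive_cst (p^-1) s 1).
    apply: (is_derive_eq h).
    by rewrite /GRing.scale/=; field; rewrite gt_eqF.
  have cG (s : K) : 0 < s -> {for s, continuous G}.
    move=> s0; apply: differentiable_continuous; apply/derivable1_diffP.
    by have [] := dG _ s0.
  rewrite (@continuous_FTC2 _ _ G)//.
  - rewrite -EFinB; congr EFin; rewrite /G; congr (_ - _).
    rewrite powRM ?(ltW r0) ?exprn_ge0 ?(ltW x0)//.
    rewrite -powR_mulrn ?(ltW x0)// powRAC powR_mulrn ?powR_ge0// exprS.
    by ring.
  - apply: continuous_in_subspaceT => s; rewrite inE/= in_itv/= => /andP[as_ _].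
    by apply: cont_powR; exact: lt_le_trans (a0 _) as_.
  - split.
    + move=> s; rewrite in_itv/= => /andP[as_ _].
      by have [] := dG _ (lt_trans (a0 _) as_).
    + by apply: cvg_at_right_filter; exact: cG.
    + by apply: cvg_at_left_filter; exact: cG.
  move=> s; rewrite in_itv/= => /andP[as_ _].
  by rewrite derive1E; have [] := dG _ (lt_trans (a0 _) as_).
have nnd : nondecreasing_seq F.
  move=> m n mn; apply/subsetPset => s; rewrite /F/= !in_itv/= => /andP[ms ->].
  by rewrite andbT (le_trans _ ms)// ler_pM2l// ler_wiXn2l ?(ltW x0) ?(ltW x1).
have : (\int[mu]_(s in F n) f s @[n --> \oo] --> \int[mu]_(s in \bigcup_n F n) f s)%E.
  apply: ge0_nondecreasing_set_cvg_integral => // [n|n]; last exact: mf.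
  exact: measurable_itv.
rewrite -DE => /cvg_unique; apply => //.
rewrite (_ : (fun _ => _) = EFin \o
  (fun n => r `^ p / p - r `^ p / p * x `^ p * (x `^ p) ^+ n)); last first.
  by apply/funext => n /=; rewrite FE.
apply: cvg_EFin; first exact: nearW.
rewrite -[X in _ --> X]subr0; apply: cvgB; first exact: cvg_cst.
rewrite -[X in _ --> X](mulr0 (r `^ p / p * x `^ p)); apply: cvgMr; apply: xn_cvg.
  exact: powR_ge0.
have -> : 1 = 1 `^ p :> K by rewrite powR1.
by apply: gt0_ltr_powR; rewrite ?nnegrE ?(ltW x0).
Qed.

Lemma Gamma_ge0 (x : K) : 0 <= Gamma x.
Proof.
by apply: Rintegral_ge0 => t _; rewrite mulr_ge0 ?powR_ge0 ?expR_ge0.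
Qed.

Lemma c_ge0 (p : K) : 0 <= c_ p.
Proof. by rewrite divr_ge0 ?powR_ge0 ?Gamma_ge0. Qed.

Lemma h_ge0 (p t : K) : 0 <= h_ p t.
Proof. by rewrite mulr_ge0 ?c_ge0 ?powR_ge0. Qed.

Lemma N0_power (B p r : K) : 0 < r -> 0 < p -> 0 <= B ->
  N0 (fun t => B * h_ p t) r = (B * (c_ p / p) * r `^ p)%:E.
Proof.
move=> r0 p0 B0; transitivity (\int[mu]_(s in `]0%R, r]) ((B * c_ p)%:E * (s `^ (p - 1))%:E))%E.
  apply: eq_integral => s; rewrite inE/= in_itv/= => /andP[s0 _].
  rewrite -EFinM; congr EFin; rewrite powRB ?powRr1 ?(ltW s0)//; last by apply/implyP => _; rewrite gt_eqF.
  by rewrite /h_; ring.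
rewrite ge0_integralZl_EFin; [|exact: measurable_itv| | |exact: mulr_ge0 B0 (c_ge0 p)]; last 2 first.
- by move=> s _; rewrite lee_fin powR_ge0.
- by apply/measurable_EFinP; apply: measurable_funTS; exact: measurable_powR.
by rewrite integral_powR// -EFinM; congr EFin; ring.
Qed.

Lemma hausdorff_content_scale (g : K -> K) (B r y : K) (E : set (Cplx K)) : 0 < B ->
  (hausdorff_content (fun t => B * g t)%R r E <= y%:E)%E ->
  (hausdorff_content g r E <= (1 / B * y)%:E)%E.
Proof.
move=> B0 le_y; apply/lee_addgt0Pr => e e0.
have : (hausdorff_content (fun t => B * g t)%R r E < (y + B * e)%:E)%E.
  by apply: le_lt_trans le_y _; rewrite lte_fin ltrDl mulr_gt0.
move=> /ereal_inf_lt[_ [N [x [rad [radr cover ->]]]] lt_y].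
apply: ge_ereal_inf; eexists; first by exists N, x, rad; split.
rewrite -EFinD; apply: ge_ereal_sup => _ [A [finA AN] <-].
rewrite fsbig_finite//= sumEFin lee_fin.
have : (\sum_(i \in A) (B * g (rad i))%:E <= (y + B * e)%:E)%E.
  apply: le_trans (ltW lt_y); apply: ereal_sup_ubound; exists A => //; split.
rewrite fsbig_finite//= sumEFin lee_fin -mulr_sumr mulrC -ler_pdivlMr// => /le_trans; apply.
by rewrite mulrDl [B * e]mulrC mulfK ?gt_eqF// div1r mulrC.
Qed.

End gauge_power.

(** * The theorem *)

Section exceptional_set.
Context {K : realType}.

Lemma capacity_le (R : K) : 0 < R < 1 ->
  5 ^+ 2 / (- ln R) * ((1 + R) / (1 - R)) ^+ 2 <= 100 / ((1 - R) ^+ 2 * ln (1 / R)).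
Proof.
move=> /andP[R0 R1].
have lnR : 0 < - ln R by rewrite oppr_gt0 ln_lt0// R0.
have R1' : 0 < (1 - R) ^+ 2 by rewrite exprn_gt0// subr_gt0.
rewrite div1r lnV ?posrE// expr_div_n mulf_div.
rewrite [X in _ <= _ / X]mulrC ler_pM2r ?invr_gt0 ?mulr_gt0//.
- by nra.
- by rewrite subr_gt0.
- by rewrite subr_gt0.
Qed.

Lemma exceptional_set (R : K) (S : set (Cplx K)) (u : Cplx K -> \bar K) (r s0 : K)
    (h : K -> K) :
  0 < R < 1 -> closure S `<=` disc R -> s0 = sup_modulus S -> s0 < R ->
  subharmonic_on (closure (disc 1)) u -> u 0 = 0%:E -> 0 < r <= 2 * R ->
  (forall t, 0 <= t <= r -> 0 <= h t) -> (N0 h r < +oo)%E ->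
  exists E : set (Cplx K),
  [/\ E `<=` S,
      (- (((2 * s0 / (R - s0)
            + ln (2 * R / r) / (- ln R) * ((1 + R) / (1 - R)) ^+ 2)%:E
           + N0 h r)
          * ereal_sup [set u z | z in boundary (disc 1)])
       <= ereal_inf [set u z | z in S `\` E])%E
    & (hausdorff_content h r E
       <= (5 ^+ 2 / (- ln R) * ((1 + R) / (1 - R)) ^+ 2)%:E)%E].
Proof.
move=> R01 clS s0E s0R usub u0 r_itv h0 hN.
have /andP[R0 R1] := R01; have /andP[r0 rR] := r_itv.
have [M [V [M0 supE Vs VM uV]]] := subharmonic_flip usub u0.
have SR z : S z -> modulus z < R by move=> Sz; apply: clS; exact: subset_closure.
have N_ge0 : (0 <= N0 h r)%E.
  apply: integral_ge0 => t; rewrite /= in_itv/= => /andP[t0 tr].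
  by rewrite lee_fin divr_ge0 ?h0 ?(ltW t0).
pose E := [set z | S z /\ exists t, varying V M R r h z t].
exists E; split; first by move=> z [].
  rewrite supE; move: hN N_ge0; case hN : (N0 h r) => [N| |]// _; rewrite lee_fin => N_ge0.
  rewrite -EFinD -EFinM -EFinN; apply: le_ereal_inf_tmp => _ [z [Sz nEz] <-].
  have zR := SR _ Sz.
  have steady : ~ exists t, varying V M R r h z t by move=> vz; apply: nEz.
  have := steady_bound Vs VM M0 R01 r_itv h0 zR steady hN.
  rewrite uV ?(lt_trans zR)//; have := superharmonic_ge0 Vs z.
  case: (V z) => [c| |]// _; rewrite -EFinB !lee_fin => c_le.
  have zs0 : modulus z <= s0.
    rewrite s0E; apply: sup_upper_bound; last by exists z.
    by split; [exists (modulus z), z|exists R => _ [w Sw <-]; exact/ltW/SR].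
  have frac : (R + modulus z) / (R - modulus z) <= 1 + 2 * s0 / (R - s0).
    have -> : (R + modulus z) / (R - modulus z) = 1 + 2 * modulus z / (R - modulus z).
      by field; rewrite gt_eqF// subr_gt0.
    rewrite lerD2l; apply: ler_pM; rewrite ?mulr_ge0 ?modulus_ge0 ?invr_ge0 ?subr_ge0 ?(ltW zR) ?ler_pM2l//.
    by rewrite lef_pV2 ?posrE ?subr_gt0// lerB.
  have := ler_wpM2r M0 frac; move: c_le; rewrite /capacity.
  set lnr := ln (2 * R / r); set iln := (- ln R)^-1; set q := ((1 + R) / (1 - R)) ^+ 2.
  move: ((R + modulus z) / _) (2 * s0 / _) => x y.
  rewrite (_ : M * (iln * q) * lnr = lnr * iln * q * M); last by ring.
  by rewrite !mulrDl mul1r [M * N]mulrC; lra.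
have := exceptional_content h Vs VM M0 R01 r_itv SR.
by rewrite /capacity mulrA.
Qed.

End exceptional_set.

Unset Implicit Arguments.
Theorem theorem2 (K : realType) (R : K) (S : set (Cplx K))
    (u : Cplx K -> \bar K) (r s0 : K)
    (R_itv : 0 < R < 1)
    (clS : closure S `<=` disc R)
    (s0E : s0 = sup_modulus S)
    (s0_lt : s0 < R)
    (u_sub : subharmonic_on (closure (disc 1)) u)
    (u0 : u 0 = 0%:E)
    (r_itv : 0 < r <= 2 * R) :
  (forall h : K -> K,
     (forall t, 0 <= t <= r -> 0 <= h t) ->
     h 0 = 0 ->
     (N0 h r < +oo)%E ->
     exists E : set (Cplx K),
       [/\ E `<=` S,
           (- (((2 * s0 / (R - s0)
                 + ln (2 * R / r) / (- ln R) * ((1 + R) / (1 - R)) ^+ 2)%:E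
                + N0 h r)
               * ereal_sup [set u z | z in boundary (disc 1)])
            <= ereal_inf [set u z | z in S `\` E])%E,
           (hausdorff_content h r E
            <= (5 ^+ 2 / (- ln R) * ((1 + R) / (1 - R)) ^+ 2)%:E)%E
         & 5 ^+ 2 / (- ln R) * ((1 + R) / (1 - R)) ^+ 2
           <= 100 / ((1 - R) ^+ 2 * ln (1 / R))]) /\
  (forall p B : K, 0 < p <= 2 -> 0 < B ->
     let h := fun t : K => B * h_ p t in
     N0 h r = (B * (c_ p / p) * r `^ p)%:E /\
     exists E : set (Cplx K),
       [/\ E `<=` S,
           (- (((2 * s0 / (R - s0)
                 + ln (2 * R / r) / (- ln R) * ((1 + R) / (1 - R)) ^+ 2)%:E
                + N0 h r)
               * ereal_sup [set u z | z in boundary (disc 1)])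
            <= ereal_inf [set u z | z in S `\` E])%E,
           (hausdorff_content h r E
            <= (5 ^+ 2 / (- ln R) * ((1 + R) / (1 - R)) ^+ 2)%:E)%E,
           (dim_content p r E
            <= (1 / B * (5 ^+ 2 / (- ln R) * ((1 + R) / (1 - R)) ^+ 2))%:E)%E
         & 1 / B * (5 ^+ 2 / (- ln R) * ((1 + R) / (1 - R)) ^+ 2)
           <= 100 / (B * (1 - R) ^+ 2 * ln (1 / R))]).
Proof.
have /andP[r0 _] := r_itv; split=> [h h_ge0' _ hN|p B /andP[p0 _] B0 h].
  have [E [ES low cont]] := exceptional_set R_itv clS s0E s0_lt u_sub u0 r_itv h_ge0' hN.
  by exists E; split => //; exact: capacity_le.
have NE : N0 h r = (B * (c_ p / p) * r `^ p)%:E by apply: N0_power => //; exact: ltW.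
split => //.
have hN : (N0 h r < +oo)%E by rewrite NE ltry.
have h_pos t : 0 <= t <= r -> 0 <= h t by move=> _; rewrite mulr_ge0 ?h_ge0// ltW.
have [E [ES low cont]] := exceptional_set R_itv clS s0E s0_lt u_sub u0 r_itv h_pos hN.
exists E; split => //; first exact: hausdorff_content_scale B0 cont.
rewrite -[X in _ <= 100 / X]mulrA [X in _ <= 100 * X]invfM [leRHS]mulrCA div1r.
apply: ler_wpM2l; first by rewrite invr_ge0 ltW.
exact: capacity_le.
Qed.
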